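(* Let $\mathbb{F}$ be $\mathbb{R}$ or $\mathbb{C}$ and let $G$ be a semisimple Lie group over $\mathbb{F}$, with Lie algebra $\mathfrak{g}$ and Cartan subalgebra $\mathfrak{h}$, such that $\mathfrak{g}_0=\mathfrak{h}$. Let $\rho:G\to\mathrm{GL}(\mathbb{V})$ be an irreducible representation with highest weight $\omega_1$ such that $\dim_{\mathbb{F}}(\mathfrak{h})=\dim_{\mathbb{F}}(d\rho(\mathfrak{h}))=:n$. Let $\mathcal{O}_{\omega_1}=\{s(\omega_1): s\in\mathcal{W}\}$ be the orbit of $\omega_1$ under the Weyl group $\mathcal{W}$. If $\rho$ is Cayley, then: (a) Either $\{\lambda\in\Lambda:\mathbb{V}_\lambda\ne 0\}=\mathcal{O}_{\omega_1}$ or $\{\lambda\in\Lambda:\mathbb{V}_\lambda\ne 0\}=\mathcal{O}_{\omega_1}\sqcup\{0\}$. In particular, a weight of $\mathbb{V}$ is either zero or an extreme weight. (b) $\mathrm{rank}(\mathcal{O}_{\omega_1})=n$. (c) There exist $\omega_2,\dots,\omega_n\in\Lambda$ such that $\mathcal{O}_{\omega_1}=\{\pm\omega_1,\dots,\pm\omega_n\}$.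
   Context: Semisimple Lie groups are connected. A representation of a Lie group $G$ over $\mathbb{F}$ is a homomorphism $\rho: G\to\mathrm{GL}(\mathbb{V})$, $\mathbb{V}$ a finite-dimensional complex vector space, which is smooth if $\mathbb{F}=\mathbb{R}$ and complex analytic if $\mathbb{F}=\mathbb{C}$; $d\rho$ is its differential. The Cayley transform is $C(u)=(1+u)(1-u)^{-1}$, for $u\in\mathfrak{gl}(\mathbb{V})$ with $1-u$ invertible. $\rho$ is Cayley if there is an open neighbourhood $N$ of $0$ in $\mathfrak{g}$ such that $C$ is defined on $d\rho(N)$ and $C(d\rho(N))\subseteq\rho(G)$. $\Lambda$ is the weight lattice, $\mathcal{W}$ the Weyl group and $\mathbb{V}=\bigoplus_{\lambda\in\Lambda}\mathbb{V}_\lambda$ the weight space decomposition. When $\mathbb{F}=\mathbb{R}$, weights, roots and Weyl group are those of $\mathfrak{g}^{\mathbb{C}}=\mathfrak{g}\otimes\mathbb{C}$ with respect to $\mathfrak{h}^{\mathbb{C}}$, and $\mathbb{V}$ is viewed as a representation of $\mathfrak{g}^{\mathbb{C}}$ by extending $d\rho$ complex linearly. For $S\subseteq\Lambda$, $\mathrm{rank}(S)$ is the rank of the subgroup of $\Lambda$ generated by $S$. An extreme weight is an element of $\mathcal{O}_{\omega_1}$. The subalgebra $\mathfrak{g}_0$ is the zero part of the (restricted) root space decomposition of $\mathfrak{g}$: if $\mathbb{F}=\mathbb{C}$, then $\mathfrak{g}=\mathfrak{g}_0\oplus\bigoplus_{\alpha\in\Phi}\mathfrak{g}_\alpha$ with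 $\mathfrak{g}_0=\mathfrak{h}$; if $\mathfrak{g}$ is a compact real form of $\mathfrak{g}^{\mathbb{C}}$, then $\mathfrak{g}_0=\mathfrak{h}$ as well; if $\mathfrak{g}$ is a non-compact real form of $\mathfrak{g}^{\mathbb{C}}$, then $\mathfrak{g}=\mathfrak{g}_0\oplus\bigoplus_{\sigma\in\Sigma}\mathfrak{g}_\sigma$ is the restricted root space decomposition with respect to $\mathfrak{a}$, where $\mathfrak{a}$ is a maximal abelian subspace of $\mathfrak{p}$ for a Cartan decomposition $\mathfrak{g}=\mathfrak{k}\oplus\mathfrak{p}$, $\Sigma$ is the set of restricted roots, $\mathfrak{g}_0$ is the centralizer of $\mathfrak{a}$ in $\mathfrak{g}$, and $\mathfrak{h}\supseteq\mathfrak{a}$ is a Cartan subalgebra. In this last case $\mathfrak{g}_0=\mathfrak{h}$ may fail, but it holds for split real forms.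
   Formalization: For F = R, part (b) is proved under the added assumption that dρ(h^C) has complex dimension n; without it (b) fails, e.g. for SL_2(C) as a real Lie group acting on C^2, where n = 2 but the orbit {±ω_1} has rank 1. *)

(* Defs.v *)
From HB Require Import structures.
From mathcomp Require Import all_boot all_order all_algebra.
From mathcomp Require Import all_classical all_reals all_analysis.
From mathcomp Require Import complex.

Set Implicit Arguments.
Unset Strict Implicit.
Unset Printing Implicit Defensive.

Import Order.TTheory GRing.Theory Num.Theory.
Import numFieldNormedType.Exports.

Local Open Scope classical_set_scope.
Local Open Scope ring_scope.

Variant ground := RealField | ComplexField.

Definition gfield (R : realType) (b : ground) : numFieldType :=
  match b with RealField => R | ComplexField => R[i] end.

Definition toC (R : realType) (b : ground) : gfield R b -> R[i] :=
  match b return gfield R b -> R[i] with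
  | RealField => fun x => x%:C%C
  | ComplexField => id
  end.

Section Smooth.
Variables (F : numFieldType) (n : nat) (W : normedModType F).

(* All partial derivatives of order at most [k] exist and are continuous on
   [U]; only used for [U] open.  Over the complex numbers the derivatives are
   complex ones, so that this (already for [k = 1]) means holomorphic. *)
Fixpoint Ck_on (k : nat) (U : set 'rV[F]_n) (f : 'rV[F]_n -> W) : Prop :=
  (forall x, U x -> {for x, continuous f}) /\
  match k with
  | 0 => True
  | k'.+1 => forall i : 'I_n,
      (forall x, U x -> derivable f x (delta_mx 0 i)) /\
      Ck_on k' U (fun x => 'D_(delta_mx 0 i) f x)
  end.

Definition smooth_on (U : set 'rV[F]_n) (f : 'rV[F]_n -> W) : Prop :=
  forall k, Ck_on k U f.

End Smooth.

Record chart (F : numFieldType) (d : nat) (G : topologicalType) := Chart {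
  cdom : set G;
  cmap : G -> 'rV[F]_d;
  cinv : 'rV[F]_d -> G;
  cdom_open : open cdom;
  cimg_open : open (cmap @` cdom);
  cmapK : forall x, cdom x -> cinv (cmap x) = x;
  cmap_continuous : {within cdom, continuous cmap};
  cinv_continuous : {within cmap @` cdom, continuous cinv}
}.

Definition cimg F d G (c : @chart F d G) : set 'rV[F]_d := cmap c @` cdom c.

HB.mixin Record isLieGroup (F : numFieldType) (d : nat) G
    of Group G & Topological G := {
  lie_hausdorff : hausdorff_space G;
  lie_second_countable : @second_countable G;
  atlas : set (chart F d G);
  atlas_cover : forall x : G, exists2 c, atlas c & cdom c x;
  atlas_compat : forall c c', atlas c -> atlas c' ->
    smooth_on (cmap c @` (cdom c `&` cdom c')) (cmap c' \o cinv c);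
  lie_mul_continuous : continuous (fun p : G * G => (p.1 * p.2)%g);
  lie_inv_continuous : continuous (fun x : G => x^-1%g);
  lie_mul_smooth : forall c1 c2 c3, atlas c1 -> atlas c2 -> atlas c3 ->
    smooth_on
      [set z : 'rV[F]_(d + d) | [/\ cimg c1 (lsubmx z), cimg c2 (rsubmx z)
         & cdom c3 (cinv c1 (lsubmx z) * cinv c2 (rsubmx z))%g]]
      (fun z => cmap c3 (cinv c1 (lsubmx z) * cinv c2 (rsubmx z))%g);
  lie_inv_smooth : forall c c', atlas c -> atlas c' ->
    smooth_on [set z | cimg c z /\ cdom c' ((cinv c z)^-1)%g]
      (fun z => cmap c' ((cinv c z)^-1)%g)
}.

#[short(type="lieGroupType")]
HB.structure Definition LieGroup (F : numFieldType) (d : nat) :=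
  {G of isLieGroup F d G & Group G & Topological G}.

(* The tangent space at the identity is identified with ['rV[F]_d] by means of
   a chart [c] around the identity. *)
Section LieAlgebraOfLieGroup.
Variables (F : numFieldType) (d : nat) (G : lieGroupType F d) (c : chart F d G).

Definition Ad (g : G) (y : 'rV[F]_d) : 'rV[F]_d :=
  'D_y (fun z => cmap c (g * cinv c z * g^-1)%g) (cmap c 1%g).

(* The bracket is [[x, y] = ad x y], where [ad] is the differential of [Ad]. *)
Definition lie_bracket (x y : 'rV[F]_d) : 'rV[F]_d :=
  'D_x (fun z => Ad (cinv c z) y) (cmap c 1%g).

End LieAlgebraOfLieGroup.

Section LieAlgebra.
Variables (F : fieldType) (d : nat).
Variable br : 'rV[F]_d -> 'rV[F]_d -> 'rV[F]_d.
Implicit Types h : {vspace 'rV[F]_d}.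

Definition ad (x : 'rV[F]_d) : 'M[F]_d := lin1_mx (br x).

Definition killing (x y : 'rV[F]_d) : F := \tr (ad x *m ad y).

(* Helgason's definition (Differential Geometry, Lie Groups and Symmetric
   Spaces, II.6); the zero Lie algebra is excluded. *)
Definition semisimple : Prop :=
  (0 < d)%N /\ forall x, (forall y, killing x y = 0) -> x = 0.

Definition abelian_sub h : Prop :=
  forall x y, x \in h -> y \in h -> br x y = 0.

Definition centralizes h (x : 'rV[F]_d) : Prop :=
  forall y, y \in h -> br y x = 0.

(* Helgason's definition (III.3) for a complex semisimple Lie algebra.  A
   subalgebra of a real one is a Cartan subalgebra when its complexification
   is one. *)
Definition cartan_subalgebra h : Prop :=
  [/\ abelian_sub h,
      forall h', abelian_sub h' -> (h <= h')%VS -> h' = h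
    & forall x, x \in h -> diagonalizable (ad x)].

End LieAlgebra.

Section RealForms.
Variables (F : numFieldType) (d : nat).
Variable br : 'rV[F]_d -> 'rV[F]_d -> 'rV[F]_d.
Implicit Types k p a : {vspace 'rV[F]_d}.

(* For a semisimple real Lie algebra. *)
Definition compact_lie_algebra : Prop :=
  forall x, x != 0 -> killing br x x < 0.

Definition cartan_decomposition k p : Prop :=
  [/\ (k + p)%VS = fullv /\ (k :&: p)%VS = 0%VS,
      forall x y, x \in k -> y \in k -> br x y \in k,
      forall x y, x \in k -> y \in p -> br x y \in p,
      forall x y, x \in p -> y \in p -> br x y \in k
    & (forall x, x \in k -> x != 0 -> killing br x x < 0) /\
      (forall x, x \in p -> x != 0 -> 0 < killing br x x)].

Definition maximal_abelian_in a p : Prop :=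
  [/\ (a <= p)%VS, abelian_sub br a
    & forall a', (a' <= p)%VS -> abelian_sub br a' -> (a <= a')%VS -> a' = a].

End RealForms.

(* [g0] is the zero part of the (restricted) root space decomposition of the
   Lie algebra [br] for some choices compatible with [h]. *)
Definition zero_part (R : realType) (b : ground) (d : nat)
    (br : 'rV[gfield R b]_d -> 'rV[gfield R b]_d -> 'rV[gfield R b]_d)
    (h g0 : {vspace 'rV[gfield R b]_d}) : Prop :=
  match b with
  | ComplexField => forall x, x \in g0 <-> centralizes br h x
  | RealField =>
      (compact_lie_algebra br /\
        forall x, x \in g0 <-> centralizes br h x) \/
      (~ compact_lie_algebra br /\
        exists k p a, [/\ cartan_decomposition br k p,
          maximal_abelian_in br a p, (a <= h)%VS
          & forall x, x \in g0 <-> centralizes br a x])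
  end.

(* When the ground field is complex, the complexification is the Lie algebra
   itself. *)
Section Complexification.
Variables (R : realType) (b : ground) (d : nat).
Local Notation F := (gfield R b).

Definition complexify_bracket (br : 'rV[F]_d -> 'rV[F]_d -> 'rV[F]_d)
    (x y : 'rV[R[i]]_d) : 'rV[R[i]]_d :=
  \sum_(i < d) \sum_(j < d) (x 0 i * y 0 j) *:
    map_mx (@toC R b) (br (delta_mx 0 i) (delta_mx 0 j)).

Definition complexify_sub (h : {vspace 'rV[F]_d}) : {vspace 'rV[R[i]]_d} :=
  <<[seq map_mx (@toC R b) x | x <- vbasis h]>>%VS.

Definition complexify_map (m : nat) (f : 'rV[F]_d -> 'M[R[i]]_m)
    (x : 'rV[R[i]]_d) : 'M[R[i]]_m :=
  \sum_(i < d) x 0 i *: f (delta_mx 0 i).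

End Complexification.

Section Roots.
Variables (K : fieldType) (d : nat).
Variable br : 'rV[K]_d -> 'rV[K]_d -> 'rV[K]_d.
Variable h : {vspace 'rV[K]_d}.

Definition hdual := 'Hom(subvs_of h, K^o).
Implicit Types l mu alpha : hdual.

Definition root_vector alpha (x : 'rV[K]_d) : Prop :=
  forall H : subvs_of h, br (vsval H) x = alpha H *: x.

Definition is_root alpha : Prop :=
  alpha != 0 /\ exists2 x, x != 0 & root_vector alpha x.

(* The element of [h] representing [l] through the Killing form. *)
Definition killing_dual l : subvs_of h :=
  xget 0 [set t : subvs_of h |
    forall H : subvs_of h, killing br (vsval t) (vsval H) = l H].

Definition dual_form l mu : K :=
  killing br (vsval (killing_dual l)) (vsval (killing_dual mu)).

Definition cartan_integer l alpha : K :=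
  2%:R * dual_form l alpha / dual_form alpha alpha.

Definition root_reflection alpha l : hdual :=
  l - (cartan_integer l alpha : K) *: alpha.

(* Reflections are involutive, so inverses need not be added. *)
Inductive weyl : (hdual -> hdual) -> Prop :=
| weyl_id : weyl id
| weyl_refl alpha s :
    is_root alpha -> weyl s -> weyl (root_reflection alpha \o s).

Definition weyl_orbit l : set hdual :=
  [set mu | exists2 s, weyl s & mu = s l].

Definition weight_lattice : set hdual :=
  [set l | forall alpha, is_root alpha ->
    exists z : int, cartan_integer l alpha = z%:~R].

Definition positive_system (P : set hdual) : Prop :=
  [/\ P `<=` is_root,
      forall alpha, is_root alpha -> P alpha \/ P (- alpha),
      forall alpha, P alpha -> ~ P (- alpha)
    & forall alpha beta, P alpha -> P beta ->
        is_root (alpha + beta) -> P (alpha + beta)].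

Variables (m : nat) (f : 'rV[K]_d -> 'M[K]_m).

Definition weight_vector l (v : 'cV[K]_m) : Prop :=
  forall H : subvs_of h, f (vsval H) *m v = l H *: v.

Definition weights : set hdual :=
  [set l | weight_lattice l /\ exists2 v, v != 0 & weight_vector l v].

(* [P] is a positive system; [v] is a maximal vector. *)
Definition highest_weight (P : set hdual) l : Prop :=
  exists v, [/\ v != 0, weight_vector l v
    & forall alpha x, P alpha -> root_vector alpha x -> f x *m v = 0].

End Roots.

Section AbelianGroupRank.
Variable A : zmodType.

Definition gen_subgroup (S : set A) : set A :=
  [set x | forall B : set A, B 0 -> (forall y z, B y -> B z -> B (y - z)) ->
    S `<=` B -> B x].

Definition Z_independent (k : nat) (e : 'I_k -> A) : Prop :=
  forall z : 'I_k -> int, \sum_(i < k) e i *~ z i = 0 -> forall i, z i = 0.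

Definition subgroup_rank (B : set A) (n : nat) : Prop :=
  (exists e : 'I_n -> A, (forall i, B (e i)) /\ Z_independent e) /\
  (forall k (e : 'I_k -> A),
     (forall i, B (e i)) -> Z_independent e -> (k <= n)%N).

End AbelianGroupRank.

Section ComplexValued.
Variables (R : realType) (d : nat).

Definition Csmooth_on (b : ground) :
    set 'rV[gfield R b]_d -> ('rV[gfield R b]_d -> R[i]) -> Prop :=
  match b return
    set 'rV[gfield R b]_d -> ('rV[gfield R b]_d -> R[i]) -> Prop with
  | RealField => fun U f =>
      @smooth_on R d R^o U (fun x => complex.Re (f x)) /\
      @smooth_on R d R^o U (fun x => complex.Im (f x))
  | ComplexField => fun U f =>
      @smooth_on (gfield R ComplexField) d (gfield R ComplexField)^o U f
  end.

Definition Cderive (b : ground) : ('rV[gfield R b]_d -> R[i]) ->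
    'rV[gfield R b]_d -> 'rV[gfield R b]_d -> R[i] :=
  match b return ('rV[gfield R b]_d -> R[i]) ->
    'rV[gfield R b]_d -> 'rV[gfield R b]_d -> R[i] with
  | RealField => fun f a v =>
      (@derive R 'rV[R]_d R^o (fun x => complex.Re (f x)) a v +i*
       @derive R 'rV[R]_d R^o (fun x => complex.Im (f x)) a v)%C
  | ComplexField => fun f a v =>
      @derive (gfield R ComplexField) 'rV[gfield R ComplexField]_d
        (gfield R ComplexField)^o f a v
  end.

End ComplexValued.

Section Representations.
Variables (R : realType) (b : ground) (d : nat).
Local Notation F := (gfield R b).
Variables (G : lieGroupType F d) (m : nat) (rho : G -> 'M[R[i]]_m).

Definition representation : Prop :=
  [/\ forall g, rho g \in unitmx,
      forall g g', rho (g * g')%g = rho g *m rho g'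
    & forall (c : chart F d G), atlas c -> forall i j,
        Csmooth_on (cimg c) (fun z => rho (cinv c z) i j)].

Definition irreducible_rep : Prop :=
  (0 < m)%N /\ forall W : {vspace 'cV[R[i]]_m},
    (forall g v, v \in W -> rho g *m v \in W) -> W = 0%VS \/ W = fullv.

Variable c : chart F d G.

Definition drho (x : 'rV[F]_d) : 'M[R[i]]_m :=
  \matrix_(i, j) Cderive (fun z => rho (cinv c z) i j) (cmap c 1%g) x.

Definition cayley_transform (u : 'M[R[i]]_m) : 'M[R[i]]_m :=
  (1%:M + u) *m invmx (1%:M - u).

Definition Cayley : Prop :=
  exists N : set 'rV[F]_d, [/\ open N, N 0
    & forall u, N u -> 1%:M - drho u \in unitmx /\
        exists g, rho g = cayley_transform (drho u)].

(* [S] is an [F]-linear subspace of dimension [n] of the complex matrices. *)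
Definition F_dim (S : set 'M[R[i]]_m) (n : nat) : Prop :=
  exists e : 'I_n -> 'M[R[i]]_m,
    (forall a : 'I_n -> F,
       \sum_(i < n) toC (a i) *: e i = 0 -> forall i, a i = 0) /\
    S = [set A | exists a : 'I_n -> F, A = \sum_(i < n) toC (a i) *: e i].

End Representations.

(* Main.v *)
(** For [x] in the Cartan subalgebra [h] and [N] large, the Cayley transform of [u = drho (x / N)]
    is some [rho g], hence conjugation by it permutes the matrices [f y], where [f] is the
    complexification of [drho], and its determinant is 1.

    - Conjugation.  On a vector of weight [l] the transform is the scalar [(1 + a) / (1 - a)] with
      [a = l x / N].  Since root spaces are lines, the ratio of these scalars at [l + alpha] and [l]
      does not depend on the weight [l] for which the root space of [alpha] does not kill the weight
      space of [l].  Varying [x], two such weights [l], [l'] satisfy [l' = l] or [l' = - l - alpha].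
    - Determinant.  [det (1 + u) = det (1 - u)], so [f x] and [- f x] have the same characteristic
      polynomial, and the set of weights is stable under [l |-> - l].

    Together with sl2 theory this bounds the pairings of weights with coroots by 2 in absolute value,
    and forces two weights not orthogonal to the same root to agree up to sign and the reflection in
    that root.  The weight spaces over the Weyl orbit of [omega1], with the part of the zero weight
    space they generate, then span an invariant subspace.  A linear relation between representatives
    of the orbit modulo signs has Weyl invariant odd coefficients, which therefore vanish.

    On the group side, differentiating [rho (g y g^-1)] along conjugation shows that [drho] is a
    morphism for the bracket defined by [Ad]; applied to the adjoint representation this gives the
    Jacobi identity.  A subspace invariant under [drho] is invariant under [rho] near 1 by
    uniqueness for linear differential systems, and everywhere since an open subgroup of a connected
    group is the whole group. *)
Require Import Defs.
From HB Require Import structures.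
From mathcomp Require Import all_boot all_order all_algebra.
From mathcomp Require Import all_classical all_reals all_analysis.
From mathcomp Require Import perm complex.
From mathcomp Require Import ring.

Set Implicit Arguments.
Unset Strict Implicit.
Unset Printing Implicit Defensive.

Import Order.TTheory GRing.Theory Num.Theory.
Import numFieldNormedType.Exports.

Local Open Scope classical_set_scope.
Local Open Scope ring_scope.

(** * Differential calculus over the ground field *)

(** The Cayley condition concerns a neighbourhood of 0 in the Lie algebra over the ground field,
    hence for a real group only real points of the Cartan subalgebra, and only after division by a
    large integer. Two devices cope with this. The points are taken on a moment curve through a real
    basis, where finitely many nonzero complex linear forms can be avoided at once. The integer [N]
    stays free: equality of two determinants for all large [N] is an equality of characteristic
    polynomials. Both consequences are needed, because conjugation sees the transform only up to a
    scalar. If [a], [a'] are the values of two weights and [e] that of the root, equality of the two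
    ratios is the vanishing of [2 e (a - a') (a + a' + e)]; this is where [- l - alpha] comes from.
    The determinant is 1 because a perfect Lie algebra has no nonzero character. The analysis takes
    place near the identity, without exponential map. Over the reals, [rho] has complex values on a
    real manifold, so differentiability is stated separately for the two ground fields, and mean
    value estimates go through real and imaginary parts. *)

Section ComplexPaths.
Variable R : realType.
Implicit Types (t : R).
Local Notation C := (gfield R ComplexField).

Lemma ReD (x y : R[i]) : complex.Re (x + y) = complex.Re x + complex.Re y.
Proof. by case: x; case: y. Qed.

Lemma ImD (x y : R[i]) : complex.Im (x + y) = complex.Im x + complex.Im y.
Proof. by case: x; case: y. Qed.

Lemma ReN (x : R[i]) : complex.Re (- x) = - complex.Re x.
Proof. by case: x. Qed.

Lemma ImN (x : R[i]) : complex.Im (- x) = - complex.Im x.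
Proof. by case: x. Qed.

Lemma ReM (x y : R[i]) : complex.Re (x * y) =
  complex.Re x * complex.Re y - complex.Im x * complex.Im y.
Proof. by case: x; case: y. Qed.

Lemma ImM (x y : R[i]) : complex.Im (x * y) =
  complex.Re x * complex.Im y + complex.Im x * complex.Re y.
Proof. by case: x; case: y. Qed.

Lemma normc_re_le (x : R[i]) : (`|complex.Re x|%:C%C : R[i]) <= `|x|.
Proof. exact: normc_ge_Re. Qed.

Lemma normc_im_le (x : R[i]) : (`|complex.Im x|%:C%C : R[i]) <= `|x|.
Proof.
rewrite normc_def lecR -[leLHS]sqrtr_sqr ler_wsqrtr // lerDr; exact: sqr_ge0.
Qed.

Lemma normc_le_reim (x : R[i]) :
  `|x| <= ((`|complex.Re x| + `|complex.Im x|)%:C%C : R[i]).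
Proof.
rewrite normc_def lecR -[leRHS]ger0_norm ?addr_ge0 // -sqrtr_sqr ler_wsqrtr //.
rewrite sqrrD !real_normK ?num_real // -addrA lerD2l lerDr.
by rewrite mulrn_wge0 // mulr_ge0.
Qed.

Lemma norm_realc t : `|t%:C%C : R[i]| = (`|t|)%:C%C.
Proof. by rewrite normc_def /= expr0n addr0 sqrtr_sqr. Qed.

Lemma cvg_re (T : Type) (F : set_system T) {FF : Filter F} (f : T -> R[i]) (l : R[i]) :
  f @ F --> (l : C^o) -> (fun x => complex.Re (f x)) @ F --> (complex.Re l : R^o).
Proof.
move=> fl; apply/cvgrPdist_lt => e e0.
have e0' : (0 : R[i]) < e%:C%C by rewrite ltcR.
have := (@cvgrPdist_lt C C^o T F FF f l).1 fl _ e0'; apply: filterS => x.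
move=> /(le_lt_trans (normc_re_le _)); rewrite ltcR.
by rewrite ReD ReN.
Qed.

Lemma cvg_im (T : Type) (F : set_system T) {FF : Filter F} (f : T -> R[i]) (l : R[i]) :
  f @ F --> (l : C^o) -> (fun x => complex.Im (f x)) @ F --> (complex.Im l : R^o).
Proof.
move=> fl; apply/cvgrPdist_lt => e e0.
have e0' : (0 : R[i]) < e%:C%C by rewrite ltcR.
have := (@cvgrPdist_lt C C^o T F FF f l).1 fl _ e0'; apply: filterS => x.
move=> /(le_lt_trans (normc_im_le _)); rewrite ltcR.
by rewrite ImD ImN.
Qed.

Lemma real_complex_dnbhs0 : (fun h : R => h%:C%C : C) @ (0 : R)^' --> (0 : C)^'.
Proof.
move=> A /= [e /= e0 eA].
have e_real : e = (complex.Re e)%:C%C by rewrite RRe_real // gtr0_real.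
have re0 : 0 < complex.Re e by rewrite -ltcR -e_real.
exists (complex.Re e) => //= h /= he h0; apply: eA.
  by rewrite /= sub0r normrN norm_realc e_real ltcR; rewrite sub0r normrN in he.
by rewrite fmorph_eq0.
Qed.

(** Real increments form a subfamily of the complex ones, so the complex difference quotient still
    converges along them, and its real and imaginary parts converge with it. *)
Lemma cpath_derive d (f : 'rV[C]_d -> R[i]) (a v : 'rV[C]_d) t :
  @derivable C _ C^o f (a + t%:C%C *: v) v ->
  is_derive t (1 : R) (fun s : R => complex.Re (f (a + s%:C%C *: v)) : R^o)
    (complex.Re (@derive C _ C^o f (a + t%:C%C *: v) v)) /\
  is_derive t (1 : R) (fun s : R => complex.Im (f (a + s%:C%C *: v)) : R^o)
    (complex.Im (@derive C _ C^o f (a + t%:C%C *: v) v)).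
Proof.
move=> /cvg_ex [l fl].
have -> : @derive C _ C^o f (a + t%:C%C *: v) v = l by exact: cvg_lim fl.
have H := cvg_comp _ _ real_complex_dnbhs0 fl.
have E1 : (fun h : R => h^-1 *: (((fun s : R => complex.Re (f (a + s%:C%C *: v)) : R^o)
   \o shift t) (h *: 1) - (complex.Re (f (a + t%:C%C *: v)) : R^o))) =
   fun h : R => complex.Re ((fun h0 : C => h0^-1 *: ((f \o shift (a + t%:C%C *: v)) (h0 *: v) -
            f (a + t%:C%C *: v) : C^o)) h%:C%C).
  apply/funext => h /=.
  have -> : (h *: 1 + t)%:C%C *: v = (h%:C%C *: v + t%:C%C *: v) :> 'rV[C]_d.
    by rewrite [h *: _]mulr1 rmorphD scalerDl.
  rewrite addrCA -fmorphV /=.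
  set u := f _; set w := f _.
  by case: u => u1 u2; case: w => w1 w2 /=; rewrite !mul0r subr0.
have E2 : (fun h : R => h^-1 *: (((fun s : R => complex.Im (f (a + s%:C%C *: v)) : R^o)
   \o shift t) (h *: 1) - (complex.Im (f (a + t%:C%C *: v)) : R^o))) =
   fun h : R => complex.Im ((fun h0 : C => h0^-1 *: ((f \o shift (a + t%:C%C *: v)) (h0 *: v) -
            f (a + t%:C%C *: v) : C^o)) h%:C%C).
  apply/funext => h /=.
  have -> : (h *: 1 + t)%:C%C *: v = (h%:C%C *: v + t%:C%C *: v) :> 'rV[C]_d.
    by rewrite [h *: _]mulr1 rmorphD scalerDl.
  rewrite addrCA -fmorphV /=.
  set u := f _; set w := f _.
  by case: u => u1 u2; case: w => w1 w2 /=; rewrite !mul0r addr0.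
have R1 := cvg_re H; have R2 := cvg_im H.
split; apply: DeriveDef.
- by apply/cvg_ex; exists (complex.Re l); rewrite E1; exact: R1.
- by apply: cvg_lim => //; rewrite E1; exact: R1.
- by apply/cvg_ex; exists (complex.Im l); rewrite E2; exact: R2.
- by apply: cvg_lim => //; rewrite E2; exact: R2.
Qed.

End ComplexPaths.

(** Segments and radii are measured by reals whatever the ground field is; [ofR] turns such a real
    into a scalar. *)
Definition ofR (R : realType) (b : ground) : R -> gfield R b :=
  match b return R -> gfield R b with
  | RealField => id
  | ComplexField => fun x => x%:C%C
  end.

Definition Cderivable (R : realType) (d : nat) (b : ground) :
    ('rV[gfield R b]_d -> R[i]) -> 'rV[gfield R b]_d -> 'rV[gfield R b]_d -> Prop :=
  match b return ('rV[gfield R b]_d -> R[i]) ->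
    'rV[gfield R b]_d -> 'rV[gfield R b]_d -> Prop with
  | RealField => fun f a v =>
      @derivable R 'rV[R]_d R^o (fun x => complex.Re (f x)) a v /\
      @derivable R 'rV[R]_d R^o (fun x => complex.Im (f x)) a v
  | ComplexField => fun f a v =>
      @derivable (gfield R ComplexField) 'rV[gfield R ComplexField]_d
        (gfield R ComplexField)^o f a v
  end.

Section MeanValue.
Variables (R : realType) (b : ground) (d : nat).
Local Notation F := (gfield R b).

Lemma path_derive (f : 'rV[F]_d -> R[i]) (a v : 'rV[F]_d) (t : R) :
  Cderivable f (a + ofR b t *: v) v ->
  is_derive t (1 : R) (fun s : R => complex.Re (f (a + ofR b s *: v)) : R^o)
    (complex.Re (Cderive f (a + ofR b t *: v) v)) /\
  is_derive t (1 : R) (fun s : R => complex.Im (f (a + ofR b s *: v)) : R^o)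
    (complex.Im (Cderive f (a + ofR b t *: v) v)).
Proof.
move: f a v; case: b => f a v; last exact: cpath_derive.
have E (g : 'rV[R]_d -> R^o) : @derivable R 'rV[R]_d R^o g (a + t *: v) v ->
    is_derive t (1 : R) (fun s : R => g (a + s *: v) : R^o)
      (@derive R 'rV[R]_d R^o g (a + t *: v) v).
  have E : (fun h : R => h^-1 *: (((fun s : R => g (a + s *: v) : R^o)
     \o shift t) (h *: 1) - (g (a + t *: v) : R^o))) =
     fun h : R => h^-1 *: ((g \o shift (a + t *: v)) (h *: v) - g (a + t *: v) : R^o).
    apply/funext => h /=; congr (_ *: (g _ - _)).
    by rewrite [h *: 1]mulr1 scalerDl addrCA.
  by move=> dg; apply: DeriveDef; rewrite /derivable /derive E.
by move=> [/= d1 d2]; split; apply: (E (fun x => _ (f x))).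
Qed.

(** The real mean value theorem is applied to the real and the imaginary part separately, which
    explains the bound [M + M]. *)
Lemma mean_value_bound (f : 'rV[F]_d -> R[i]) (a v : 'rV[F]_d) (M : R) :
  (forall t : R, 0 <= t <= 1 -> Cderivable f (a + ofR b t *: v) v) ->
  (forall t : R, 0 <= t <= 1 -> `|Cderive f (a + ofR b t *: v) v| <= M%:C%C) ->
  `|f (a + v) - f a| <= (M + M)%:C%C.
Proof.
move=> df bf.
have H (g : R -> R^o) (dg : R -> R) : (forall t : R, 0 <= t <= 1 -> is_derive t (1 : R) g (dg t)) ->
    (forall t : R, 0 <= t <= 1 -> `|dg t| <= M) -> `|g 1 - g 0| <= M.
  move=> dgg bg.
  have [||c] := @MVT_segment R g dg 0 1 ler01.
  - by move=> x; rewrite in_itv /= => /andP[/ltW x0 /ltW x1]; apply: dgg; rewrite x0.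
  - apply: derivable_within_continuous => x; rewrite in_itv /= => xI.
    by have [] := dgg x xI.
  - by rewrite in_itv /= subr0 mulr1 => cI ->; exact: bg.
have o1 : ofR b 1 *: v = v by move: {df bf} v; case: b => v; rewrite scale1r.
have o0 : ofR b 0 *: v = 0 by move: {df bf o1} v; case: b => v; rewrite scale0r.
apply: (le_trans (normc_le_reim _)); rewrite lecR lerD //.
  rewrite ReD ReN.
  have := H (fun s => complex.Re (f (a + ofR b s *: v)))
            (fun s => complex.Re (Cderive f (a + ofR b s *: v) v)).
  rewrite o1 o0 addr0; apply => t tI; first by have [] := path_derive (df t tI).
  by rewrite -lecR (le_trans _ (bf t tI)) // normc_re_le.
rewrite ImD ImN.
have := H (fun s => complex.Im (f (a + ofR b s *: v)))
          (fun s => complex.Im (Cderive f (a + ofR b s *: v) v)).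
rewrite o1 o0 addr0; apply => t tI; first by have [] := path_derive (df t tI).
by rewrite -lecR (le_trans _ (bf t tI)) // normc_im_le.
Qed.

End MeanValue.

Section RowVectorNorm.
Variables (K : numFieldType) (n : nat).
Implicit Types (u : 'rV[K]_n) (r : K).

Lemma rV_norm_le u r : 0 <= r -> (forall j, `|u 0 j| <= r) -> `|u| <= r.
Proof.
move=> r0 ur; rewrite [leLHS]/Num.norm /= mx_normE.
have -> : r = (NngNum r0)%:num by [].
by rewrite num_le; apply/bigmax_leP; split => // -[i j] _ /=;
  rewrite -num_le /= ord1.
Qed.

Lemma rV_norm_coord u j : `|u 0 j| <= `|u|.
Proof.
rewrite [leRHS]/Num.norm /= mx_normE.
set M := \big[_/_]_i _.
have /bigmax_leP[_ H] := lexx M.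
by have := H (0, j) isT; rewrite -num_le.
Qed.

End RowVectorNorm.

Section DirectionScaling.
Variables (K : numFieldType) (V W : normedModType K).

(** Only derivability in the direction [v] is assumed, so there is no differential whose linearity
    could be used; the increment is rescaled by [k] instead. *)
Lemma is_derive_scale (f : V -> W) (a v : V) (k : K) :
  derivable f a v -> is_derive a (k *: v) f (k *: 'D_v f a).
Proof.
move=> df; have [->|k0] := eqVneq k 0.
  by rewrite !scale0r; exact: is_derive0.
have H : (fun h => h^-1 *: ((f \o shift a) (h *: (k *: v)) - f a)) @ 0^' --> k *: 'D_v f a.
  have -> : (fun h => h^-1 *: ((f \o shift a) (h *: (k *: v)) - f a)) =
     (fun h => k *: ((fun h => h^-1 *: ((f \o shift a) (h *: v) - f a)) (h * k))).
    apply/funext => h /=; rewrite !scalerA invfM mulrA.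
    by rewrite [k * _ / k]mulrAC divff // mul1r.
  apply: cvgZ; first exact: cvg_cst.
  have C : (fun h : K => h * k) @ 0^' --> (0 : K)^'.
    move=> A [e /= e0 eA].
    exists (e / `|k|) => /=; first by rewrite divr_gt0 // normr_gt0.
    move=> h /=; rewrite sub0r normrN => he h0; apply: eA.
      by rewrite /= sub0r normrN normrM -ltr_pdivlMr ?normr_gt0.
    by rewrite mulf_neq0.
  exact: (cvg_comp _ _ C df).
by apply: DeriveDef; [apply/cvg_ex; exists (k *: 'D_v f a) | exact: cvg_lim].
Qed.

End DirectionScaling.

Section OfR.
Variables (R : realType) (b : ground).
Local Notation F := (gfield R b).

Lemma ofR_lt (x y : R) : (ofR b x < ofR b y) = (x < y).
Proof. by case: b => //=; rewrite ltcR. Qed.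

Lemma ofR_le (x y : R) : (ofR b x <= ofR b y) = (x <= y).
Proof. by case: b => //=; rewrite lecR. Qed.

Lemma ofR0 : ofR b (0 : R) = 0.
Proof. by case: b. Qed.

Lemma ofR1 : ofR b (1 : R) = 1.
Proof. by case: b. Qed.

Lemma ofRD (x y : R) : ofR b (x + y) = ofR b x + ofR b y.
Proof. by case: b => //=; rewrite rmorphD. Qed.

Lemma ofRM (x y : R) : ofR b (x * y) = ofR b x * ofR b y.
Proof. by case: b => //=; rewrite rmorphM. Qed.

Lemma ofR_norm (x : R) : `|ofR b x| = ofR b `|x|.
Proof. by case: b => //=; rewrite norm_realc. Qed.

Lemma ofR_pos (e : F) : 0 < e -> exists2 r : R, 0 < r & e = ofR b r.
Proof.
move: e; case: b => e e0; first by exists e.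
exists (complex.Re e); first by rewrite -ltcR RRe_real ?gtr0_real.
by rewrite /= RRe_real ?gtr0_real.
Qed.

Lemma ofR_nneg (e : F) : 0 <= e -> exists2 r : R, 0 <= r & e = ofR b r.
Proof.
move: e; case: b => e e0; first by exists e.
exists (complex.Re e); first by rewrite -lecR RRe_real ?ger0_real.
by rewrite /= RRe_real ?ger0_real.
Qed.

Lemma toC_norm (x : F) : exists2 r : R, `|x| = ofR b r & `|toC x| = r%:C%C.
Proof.
move: x; case: b => x; first by exists `|x| => //; exact: norm_realc.
have E : (complex.Re `|x : R[i]|)%:C%C = `|x : R[i]| by rewrite RRe_real ?ger0_real.
by exists (complex.Re `|x : R[i]|); rewrite /= E.
Qed.

Lemma toC_is_additive : additive (@toC R b).
Proof. by case: b => x y //=; rewrite rmorphB. Qed.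

Lemma toC_is_multiplicative : multiplicative (@toC R b).
Proof. by case: b; split => // x y /=; rewrite rmorphM. Qed.

End OfR.

HB.instance Definition _ (R : realType) (b : ground) :=
  GRing.isAdditive.Build (gfield R b) R[i] (@toC R b) (@toC_is_additive R b).
HB.instance Definition _ (R : realType) (b : ground) :=
  GRing.isMultiplicative.Build (gfield R b) R[i] (@toC R b) (@toC_is_multiplicative R b).

Section CderiveToC.
Variables (R : realType) (b : ground) (d : nat).
Local Notation F := (gfield R b).

Lemma Cderivable_toC (f : 'rV[F]_d -> F) (a v : 'rV[F]_d) :
  @derivable F _ F^o f a v ->
  Cderivable (fun z => toC (f z)) a v /\
  Cderive (fun z => toC (f z)) a v = toC (@derive F _ F^o f a v).
Proof.
move: f a v; case: b => f a v //= df.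
split; first by split => //; exact: derivable_cst.
by rewrite (derive_cst (0 : R^o)).
Qed.

Lemma mean_value_boundF (f : 'rV[F]_d -> F) (a v : 'rV[F]_d) (M : F) :
  (forall t : R, 0 <= t <= 1 -> @derivable F _ F^o f (a + ofR b t *: v) v) ->
  (forall t : R, 0 <= t <= 1 ->
     `|@derive F _ F^o f (a + ofR b t *: v) v| <= M) ->
  `|f (a + v) - f a| <= M + M.
Proof.
move=> df bf.
have M0 : 0 <= M by apply: le_trans (bf 0 _) => //; rewrite lexx ler01.
have [m m0 E] := ofR_nneg M0.
have := @mean_value_bound R b d (fun z => toC (f z)) a v m.
rewrite -rmorphB; have [r -> ->] := toC_norm (f (a + v) - f a).
rewrite lecR E -ofRD ofR_le; apply => t tI.
  exact: (Cderivable_toC (df t tI)).1.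
rewrite (Cderivable_toC (df t tI)).2.
have [s s1 ->] := toC_norm (@derive F _ F^o f (a + ofR b t *: v) v).
by rewrite lecR -(ofR_le b) -s1 -E; exact: bf.
Qed.

End CderiveToC.

Lemma near_forall_fin (T : topologicalType) (I : finType) (P : I -> set T) (a : T) :
  (forall i, \forall x \near a, P i x) -> \forall x \near a, forall i, P i x.
Proof. by move=> H; apply: filter_forall. Qed.

Lemma continuous_near_le (K : numFieldType) (V W : normedModType K) (g : V -> W) (a : V) (q : K) :
  {for a, continuous g} -> 0 < q -> \forall x \near a, `|g x - g a| <= q.
Proof.
move=> gc q0.
have H : \forall x \near a, `|g a - g x| <= q by exact: ((@cvgrPdist_le K W _ _ _ _ _).1 gc _ q0).
by apply: filterS H => x; rewrite distrC.
Qed.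

Lemma differentiable_of_bound (K : numFieldType) (V W : normedModType K)
    (f : V -> W) (L : {linear V -> W}) (a : V) :
  continuous L ->
  (forall e : K, 0 < e -> \forall h \near (0 : V), `|f (a + h) - f a - L h| <= e * `|h|) ->
  differentiable f a.
Proof.
move=> Lc H.
have E : f \o shift a = cst (f a) + L +o_ 0 id.
  apply/eqaddoP => e e0; apply: filterS (H e e0) => h.
  rewrite -[X in _ -> `|X| <= _]/(f (h + a) - (f a + L h)).
  by rewrite opprD addrA [h + a]addrC.
by apply/diff_locallyP; rewrite (diff_unique Lc E).
Qed.

(** * Differentiability from continuous partial derivatives *)

Section PartialsDifferentiable.
Variables (R : realType) (b : ground) (n : nat).
Local Notation F := (gfield R b).
Implicit Types (a h : 'rV[F]_n).

(** The segment from [a] to [a + h] is replaced by a path along the coordinate axes. On each piece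
    the mean value bound is applied to [f] minus a linear function of slope [c k], whose partial
    derivative has norm at most [e]. *)
Lemma partial_increment_bound (f : 'rV[F]_n -> F) (c : 'I_n -> F) (a : 'rV[F]_n) (r e : F) :
  0 <= e ->
  (forall x, `|x - a| < r -> forall i, @derivable F _ F^o f x (delta_mx 0 i) /\
     `|@derive F _ F^o f x (delta_mx 0 i) - c i| <= e) ->
  forall h, `|h| < r ->
  `|f (a + h) - f a - \sum_i h 0 i * c i| <= (e * `|h| + e * `|h|) *+ n.
Proof.
move=> e0 Hf h hr.
(* [p k] keeps the first [k] coordinates of [h], so that the points [a + p k] are the corners of the
   path. *)
pose p k : 'rV[F]_n := \row_j (if (j < k)%N then h 0 j else 0).
have p0 : p 0%N = 0 by apply/rowP => j; rewrite !mxE.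
have pn : p n = h by apply/rowP => j; rewrite !mxE ltn_ord.
have pS (k : 'I_n) : p k.+1 = p k + h 0 k *: delta_mx 0 k.
  apply/rowP => j; rewrite !mxE eqxx /= ltnS leq_eqVlt.
  have [->|jk] := eqVneq j k; first by rewrite eqxx ltnn mulr1 add0r.
  by rewrite -val_eqE in jk; rewrite (negbTE jk) mulr0 addr0.
have near_p (k : 'I_n) t : 0 <= t <= 1 ->
    `|a + p k + ofR b t *: (h 0 k *: delta_mx 0 k) - a| < r.
  move=> /andP[t0 t1]; apply: le_lt_trans hr.
  rewrite -[a + _ + _]addrA [_ - a]addrC addKr; apply: rV_norm_le => // j; rewrite !mxE eqxx /=.
  have [->|jk] := eqVneq j k; last first.
    rewrite !mulr0 addr0; case: ifP => _; first exact: rV_norm_coord.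
    by rewrite normr0.
  rewrite ltnn add0r mulr1 normrM ofR_norm (ger0_norm t0).
  apply: le_trans (rV_norm_coord h k).
  by rewrite ler_piMl // -(ofR1 R b) ofR_le.
have -> : f (a + h) - f a - \sum_i h 0 i * c i =
    \sum_(k < n) (f (a + p k + h 0 k *: delta_mx 0 k) - f (a + p k) - h 0 k * c k).
  rewrite [RHS]sumrB; congr (_ - _).
  under eq_bigr => k _ do rewrite -addrA -pS.
  rewrite -(big_mkord xpredT (fun k => f (a + p k.+1) - f (a + p k))).
  by rewrite (telescope_sumr (fun k => f (a + p k))) // p0 pn addr0.
apply: (le_trans (ler_norm_sum _ _ _)).
rewrite -[X in _ *+ X](card_ord n) -sumr_const; apply: ler_sum => k _.
pose g z := f z - z 0 k * c k.
have -> : f (a + p k + h 0 k *: delta_mx 0 k) - f (a + p k) - h 0 k * c k =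
    g (a + p k + h 0 k *: delta_mx 0 k) - g (a + p k).
  have -> : g (a + p k + h 0 k *: delta_mx 0 k) =
      f (a + p k + h 0 k *: delta_mx 0 k) - ((a + p k) 0 k + h 0 k) * c k.
    by rewrite /g !mxE !eqxx mulr1.
  rewrite /g; ring.
have dg t : 0 <= t <= 1 -> is_derive (a + p k + ofR b t *: (h 0 k *: delta_mx 0 k))
    (h 0 k *: delta_mx 0 k) (g : _ -> F^o)
    (h 0 k *: (@derive F _ F^o f (a + p k + ofR b t *: (h 0 k *: delta_mx 0 k))
                (delta_mx 0 k) - c k)).
  move=> tI; set x := a + p k + _.
  have [dfx _] := Hf x (near_p k t tI) k.
  have dl : is_derive x (delta_mx 0 k) (fun z : 'rV[F]_n => z 0 k * c k : F^o) (c k).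
    have E : (fun h : F => h^-1 *: (((fun z : 'rV[F]_n => z 0 k * c k : F^o) \o shift x)
       (h *: delta_mx 0 k) - x 0 k * c k : F^o)) = (fun s : F => if s == 0 then 0 else c k).
      apply/funext => s /=; rewrite !mxE !eqxx mulr1 -mulrBl addrK.
      case: eqVneq => [->|s0]; first by rewrite invr0 scale0r.
      by rewrite [_ *: _]mulrA mulVf // mul1r.
    have C : (fun s : F => if s == 0 then 0 else c k : F^o) @ (0 : F)^' --> (c k : F^o).
      apply: cvg_near_cst; near=> s.
      have s0 : s != 0 by near: s; exact: nbhs_dnbhs_neq.
      by rewrite (negbTE s0).
    apply: DeriveDef; last by apply: cvg_lim => //; rewrite E.
    by apply/cvg_ex; exists (c k); rewrite E.
  have dgx : is_derive x (delta_mx 0 k) (g : _ -> F^o)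
     (@derive F _ F^o f x (delta_mx 0 k) - c k).
    exact: is_deriveB (derivableP dfx) dl.
  have := @is_derive_scale F _ F^o g x (delta_mx 0 k) (h 0 k) (@ex_derive _ _ _ _ _ _ _ dgx).
  by rewrite (@derive_val _ _ _ _ _ _ _ dgx).
apply: (@mean_value_boundF R b n g _ _ (e * `|h|)) => t tI.
  by have [] := dg t tI.
rewrite (@derive_val _ _ _ _ _ _ _ (dg t tI)) normrM mulrC ler_pM //.
  by have [_] := Hf _ (near_p k t tI) k.
exact: rV_norm_coord.
Unshelve. all: by end_near. Qed.

Lemma partials_differentiable (f : 'rV[F]_n -> F) (a : 'rV[F]_n) :
  (\forall x \near a, forall i, @derivable F _ F^o f x (delta_mx 0 i)) ->
  (forall i, {for a, continuous (fun x => @derive F _ F^o f x (delta_mx 0 i) : F^o)}) ->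
  differentiable (f : 'rV[F]_n -> F^o) a.
Proof.
move=> dU cU.
pose c i := @derive F _ F^o f a (delta_mx 0 i).
pose L (h : 'rV[F]_n) : F^o := \sum_i h 0 i * c i.
have Llin : linear L.
  move=> k u v; rewrite /L scaler_sumr -big_split; apply: eq_bigr => i _ /=.
  by rewrite !mxE mulrDl -mulrA.
pose LL : {linear 'rV[F]_n -> F^o} := HB.pack L (GRing.isLinear.Build _ _ _ _ L Llin).
have Lcont : continuous LL.
  have -> : (LL : _ -> _) = \sum_i (fun h : 'rV[F]_n => h 0 i * c i : F^o).
    by apply/funext => h; rewrite fct_sumE.
  move=> x; apply: differentiable_continuous; apply: differentiable_sum => i.
  apply: differentiableM; first exact: differentiable_coord.
  exact: differentiable_cst.
apply: (differentiable_of_bound Lcont) => e e0.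
(* The increment bound is [2 n q |h|]; using [n.+1] keeps the denominator nonzero when [n] is 0. *)
pose q := e / (n.+1 * 2)%:R.
  have q0 : 0 < q by rewrite divr_gt0 // ltr0n.
  have H : \forall x \near a, forall i, @derivable F _ F^o f x (delta_mx 0 i) /\
       `|@derive F _ F^o f x (delta_mx 0 i) - c i| <= q.
    have cl : \forall x \near a, forall i, `|@derive F _ F^o f x (delta_mx 0 i) - c i| <= q.
      apply: near_forall_fin => i.
      exact: (continuous_near_le (cU i)).
    by near=> x => i; split; [apply: (near dU x) | apply: (near cl x)].
  have [r /= r0 Hr] := (nbhs_ballP _ _).1 H.
  have HB x : `|x - a| < r -> forall i, @derivable F _ F^o f x (delta_mx 0 i) /\
       `|@derive F _ F^o f x (delta_mx 0 i) - c i| <= q.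
    by move=> xr; apply: Hr; rewrite -ball_normE /= distrC.
  near=> h.
  have hr : `|h| < r.
    near: h; exact: (@nbhs0_lt F 'rV[F]_n r r0).
  have := partial_increment_bound (ltW q0) HB hr.
  move=> /le_trans; apply.
  rewrite -mulr2n -mulrnA -mulr_natr mulrAC; apply: ler_wpM2r => //.
  rewrite /q -mulrA ler_piMr ?(ltW e0) //.
  rewrite mulrC. rewrite ler_pdivrMr ?ltr0n // mul1r ler_nat.
  by rewrite mulnC leq_mul2r leqnSn.
Unshelve. all: by end_near. Qed.

End PartialsDifferentiable.

Lemma near_differentiable (K : numFieldType) (V W : normedModType K) (f1 g1 : V -> W) (x : V)  :
(\forall y \near x, f1 y = g1 y) -> differentiable f1 x -> differentiable g1 x.
Proof.
move=> E df; apply: (@differentiable_of_bound _ _ _ g1 ('d f1 x) x); first exact: diff_continuous.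
move=> e e0.
have Ex : f1 x = g1 x by exact: (nbhs_singleton E).
have := (eqaddoP _ _ _ _).1 (diff_locally df) e e0.
have E0 : \forall h \near (0 : V), f1 (x + h) = g1 (x + h).
  have C : (fun h => x + h) @ (0 : V) --> x.
    by rewrite -[X in _ --> X]addr0; apply: cvgD; [exact: cvg_cst | exact: cvg_id].
  exact: (C _ E).
move=> H; apply: filterS2 E0 H => h eh.
rewrite -[X in (`|X| <= _) -> _]/(f1 (h + x) - (f1 x + 'd f1 x h)).
by rewrite -eh -Ex [x + h]addrC opprD addrA.
Qed.

Lemma cvg_near_congr (T U : topologicalType) (f g : T -> U) (a : T) (l : U) :
  (\forall x \near a, f x = g x) -> f @ a --> l -> g @ a --> l.
Proof. by move=> E; apply: cvg_trans; exact: near_eq_cvg. Qed.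

Lemma derive_comp (K : numFieldType) (U V W : normedModType K)
    (f : V -> W) (phi : U -> V) (a v : U) :
  differentiable phi a -> differentiable f (phi a) ->
  'D_v (fun x => f (phi x)) a = 'D_('D_v phi a) f (phi a).
Proof.
move=> dp df; rewrite (deriveE _ dp) (deriveE _ df).
by rewrite (deriveE _ (differentiable_comp dp df)) diff_comp.
Qed.

Section CoordinateDifferentiability.
Variables (K : numFieldType) (V : normedModType K) (p : nat).

Lemma differentiable_rV (f : V -> 'rV[K]_p) (a : V) :
  (forall j, differentiable (fun x => f x 0 j : K^o) a) -> differentiable f a.
Proof.
move=> df.
have -> : f = \sum_(j < p) (fun x => f x 0 j *: delta_mx 0 j).
  by apply/funext => x; rewrite fct_sumE; exact: row_sum_delta.
by apply: differentiable_sum => j; apply: differentiableZl.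
Qed.

Lemma derivable_coord (f : V -> 'rV[K]_p) (a v : V) j :
  derivable f a v -> derivable (fun x => f x 0 j : K^o) a v /\
    'D_v (fun x => f x 0 j : K^o) a = ('D_v f a) 0 j.
Proof.
move=> df.
have H : (fun h => h^-1 *: (((fun x => f x 0 j : K^o) \o shift a) (h *: v) - f a 0 j)) @ 0^'
    --> (('D_v f a) 0 j : K^o).
  have -> : (fun h => h^-1 *: (((fun x => f x 0 j : K^o) \o shift a) (h *: v) - f a 0 j)) =
     (fun M : 'rV[K]_p => M 0 j : K^o) \o (fun h => h^-1 *: ((f \o shift a) (h *: v) - f a)).
    by apply/funext => h /=; rewrite !mxE.
  exact: (cvg_comp _ _ df (@coord_continuous K 1 p 0 j _)).
by split; [apply/cvg_ex; exists (('D_v f a) 0 j) | exact: cvg_lim].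
Qed.

End CoordinateDifferentiability.

Section SmoothDifferentiable.
Variables (R : realType) (b : ground) (n : nat).
Local Notation F := (gfield R b).

Lemma Ck1_differentiable_scalar (U : set 'rV[F]_n) (f : 'rV[F]_n -> F) (a : 'rV[F]_n) :
  open U -> @Ck_on F n F^o 1 U f -> U a -> differentiable (f : _ -> F^o) a.
Proof.
move=> oU [_ df] Ua; apply: partials_differentiable.
  have N : nbhs a U by exact: open_nbhs_nbhs.
  by apply: filterS N => x Ux i; have [] := df i; move=> /(_ _ Ux).
by move=> i; have [_ [/(_ _ Ua)]] := df i.
Qed.

Lemma Ck1_differentiable p (U : set 'rV[F]_n) (f : 'rV[F]_n -> 'rV[F]_p) (a : 'rV[F]_n) :
  open U -> Ck_on 1 U f -> U a -> differentiable f a.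
Proof.
move=> oU [_ df] Ua; apply: differentiable_rV => j.
apply: partials_differentiable.
  have N : nbhs a U by exact: open_nbhs_nbhs.
  apply: filterS N => x Ux i; have [dfx _] := df i.
  exact: (derivable_coord j (dfx _ Ux)).1.
move=> i; have [dfx [/(_ _ Ua) cf _]] := df i.
have Ea := (derivable_coord j (dfx _ Ua)).2.
have N : nbhs a U by exact: open_nbhs_nbhs.
have C : (fun x => ('D_(delta_mx 0 i) f x) 0 j : F^o) @ a --> (('D_(delta_mx 0 i) f a) 0 j : F^o).
  exact: (cvg_comp _ _ cf (@coord_continuous F 1 p 0 j _)).
have C2 : (fun x => ('D_(delta_mx 0 i) f x) 0 j : F^o) @ a -->
    (@derive F _ F^o (fun x => f x 0 j) a (delta_mx 0 i) : F^o) by rewrite Ea.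
apply: (cvg_near_congr _ C2).
apply: filterS N => x Ux; exact: (esym (derivable_coord j (dfx _ Ux)).2).
Qed.

End SmoothDifferentiable.

(** Over the reals the values and the scalars lie in different fields, so the real case works with
    real and imaginary parts, in parallel with [Csmooth_on]. *)
Definition Cdiff (R : realType) (d : nat) (b : ground) :
    ('rV[gfield R b]_d -> R[i]) -> 'rV[gfield R b]_d -> Prop :=
  match b return ('rV[gfield R b]_d -> R[i]) -> 'rV[gfield R b]_d -> Prop with
  | RealField => fun f a =>
      differentiable ((fun x => complex.Re (f x)) : 'rV[R]_d -> R^o) a /\
      differentiable ((fun x => complex.Im (f x)) : 'rV[R]_d -> R^o) a
  | ComplexField => fun f a =>
      differentiable (f : 'rV[gfield R ComplexField]_d -> (gfield R ComplexField)^o) a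
  end.

Definition is_Cdiff (R : realType) (d : nat) (b : ground)
    (f : 'rV[gfield R b]_d -> R[i]) (a : 'rV[gfield R b]_d) (D : 'rV[gfield R b]_d -> R[i]) :=
  Cdiff f a /\ forall v, Cderive f a v = D v.

Section CdiffTheory.
Variables (R : realType) (b : ground).
Local Notation F := (gfield R b).

Lemma Csmooth_Cdiff d (U : set 'rV[F]_d) (f : 'rV[F]_d -> R[i]) (a : 'rV[F]_d) :
  open U -> Csmooth_on U f -> U a -> Cdiff f a.
Proof.
move: U f a; case: b => U f a oU fs Ua /=; last exact: (@Ck1_differentiable_scalar R ComplexField _ _ _ _ oU (fs 1%N)).
by split; [exact: (@Ck1_differentiable_scalar R RealField _ _ _ _ oU (fs.1 1%N)) |
           exact: (@Ck1_differentiable_scalar R RealField _ _ _ _ oU (fs.2 1%N))].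
Qed.

Lemma Cdiff_is d (f : 'rV[F]_d -> R[i]) (a : 'rV[F]_d) : Cdiff f a -> is_Cdiff f a (Cderive f a).
Proof. by []. Qed.

Lemma Cdiff_derivable d (f : 'rV[F]_d -> R[i]) (a v : 'rV[F]_d) : Cdiff f a -> Cderivable f a v.
Proof.
move: f a v; case: b => f a v /=; last exact: diff_derivable.
by case=> d1 d2; split; exact: diff_derivable.
Qed.

Lemma is_Cdiff_cst d (k : R[i]) (a : 'rV[F]_d) : is_Cdiff (fun=> k) a (fun=> 0).
Proof.
move: a; case: b => a; split => /=; first by split; exact: differentiable_cst.
- by move=> v; rewrite (derive_cst (complex.Re k : R^o)) (derive_cst (complex.Im k : R^o)).
- exact: differentiable_cst.
- by move=> v; rewrite (derive_cst (k : (gfield R ComplexField)^o)).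
Qed.

Lemma is_CdiffD d (f g : 'rV[F]_d -> R[i]) (a : 'rV[F]_d) Df Dg :
  is_Cdiff f a Df -> is_Cdiff g a Dg ->
  is_Cdiff (fun x => f x + g x) a (fun v => Df v + Dg v).
Proof.
move: f g a Df Dg; case: b => f g a Df Dg [df ef] [dg eg]; last first.
  split; first exact: (differentiableD df dg).
  move=> v; rewrite -ef -eg.
  exact: (deriveD (diff_derivable df) (diff_derivable dg)).
case: df dg => [df1 df2] [dg1 dg2].
have ER : (fun x => complex.Re (f x + g x)) =
    ((fun x => complex.Re (f x)) : _ -> R^o) + (fun x => complex.Re (g x)).
  by apply/funext => x; rewrite ReD.
have EI : (fun x => complex.Im (f x + g x)) =
    ((fun x => complex.Im (f x)) : _ -> R^o) + (fun x => complex.Im (g x)).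
  by apply/funext => x; rewrite ImD.
rewrite /is_Cdiff /= ER EI; split; first by split; exact: differentiableD.
by move=> v; rewrite !deriveD; [|exact: diff_derivable..]; rewrite -ef -eg.
Qed.

Lemma is_CdiffM d (f g : 'rV[F]_d -> R[i]) (a : 'rV[F]_d) Df Dg :
  is_Cdiff f a Df -> is_Cdiff g a Dg ->
  is_Cdiff (fun x => f x * g x) a (fun v => f a * Dg v + g a * Df v).
Proof.
move: f g a Df Dg; case: b => f g a Df Dg [df ef] [dg eg]; last first.
  split; first exact: (differentiableM df dg).
  move=> v; rewrite -ef -eg.
  exact: (deriveM (diff_derivable df) (diff_derivable dg)).
case: df dg => [df1 df2] [dg1 dg2].
pose f1 x := complex.Re (f x) : R^o; pose f2 x := complex.Im (f x) : R^o.
pose g1 x := complex.Re (g x) : R^o; pose g2 x := complex.Im (g x) : R^o.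
have ER : (fun x => complex.Re (f x * g x)) = (f1 * g1 - f2 * g2 : _ -> R^o).
  by apply/funext => x; rewrite ReM.
have EI : (fun x => complex.Im (f x * g x)) = (f1 * g2 + f2 * g1 : _ -> R^o).
  by apply/funext => x; rewrite ImM.
have [mR1 mR2] : differentiable (f1 * g1 : _ -> R^o) a /\ differentiable (f2 * g2 : _ -> R^o) a.
  by split; exact: differentiableM.
have [mI1 mI2] : differentiable (f1 * g2 : _ -> R^o) a /\ differentiable (f2 * g1 : _ -> R^o) a.
  by split; exact: differentiableM.
rewrite /is_Cdiff /= ER EI; split.
  by split; [exact: differentiableB | exact: differentiableD].
move=> v; rewrite deriveB ?deriveD; [|exact: diff_derivable..].
rewrite !deriveM; [|exact: diff_derivable..].
rewrite -ef -eg /= /f1 /f2 /g1 /g2 /=.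
case: (f a) => x1 x2; case: (g a) => y1 y2 /=.
apply/eqP; rewrite eq_complex /=; apply/andP; split; apply/eqP; rewrite /GRing.scale /=; ring.
Qed.

Lemma is_Cdiff_sum d (I : Type) (r : seq I) (P : pred I) (f : I -> 'rV[F]_d -> R[i]) (a : 'rV[F]_d) Df :
  (forall i, is_Cdiff (f i) a (Df i)) ->
  is_Cdiff (fun x => \sum_(i <- r | P i) f i x) a (fun v => \sum_(i <- r | P i) Df i v).
Proof.
move=> H; elim: r => [|i r IH].
  have := is_Cdiff_cst 0 a; congr is_Cdiff; apply/funext => x; by rewrite big_nil.
have -> : (fun x => \sum_(j <- i :: r | P j) f j x) =
    fun x => (if P i then f i x else 0) + \sum_(j <- r | P j) f j x.
  by apply/funext => x; rewrite big_cons; case: ifP; rewrite ?add0r.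
have -> : (fun x => \sum_(j <- i :: r | P j) Df j x) =
    fun x => (if P i then Df i x else 0) + \sum_(j <- r | P j) Df j x.
  by apply/funext => x; rewrite big_cons; case: ifP; rewrite ?add0r.
apply: (is_CdiffD _ IH); case: (P i); [exact: H | exact: is_Cdiff_cst].
Qed.

Lemma is_Cdiff_near d (f g : 'rV[F]_d -> R[i]) (a : 'rV[F]_d) Df :
  (\forall x \near a, f x = g x) -> is_Cdiff f a Df -> is_Cdiff g a Df.
Proof.
move: f g a Df; case: b => f g a Df E [df ef]; last first.
  split; first exact: (@near_differentiable (gfield R ComplexField) _ (gfield R ComplexField)^o f g a E df).
  move=> v; rewrite -ef; symmetry.
  exact: (@near_eq_derive (gfield R ComplexField) _ (gfield R ComplexField)^o f g a v E).
have E1 : \forall x \near a, complex.Re (f x) = complex.Re (g x).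
  by apply: filterS E => x ->.
have E2 : \forall x \near a, complex.Im (f x) = complex.Im (g x).
  by apply: filterS E => x ->.
split; first by split; [exact: (@near_differentiable R _ R^o _ _ a E1 df.1) | exact: (@near_differentiable R _ R^o _ _ a E2 df.2)].
move=> v; rewrite -ef /=.
by rewrite -(near_eq_derive (W := R^o) v E1) -(near_eq_derive (W := R^o) v E2).
Qed.

Lemma is_Cdiff_comp d e (f : 'rV[F]_d -> R[i]) (phi : 'rV[F]_e -> 'rV[F]_d) (a : 'rV[F]_e) Df :
  is_Cdiff f (phi a) Df -> differentiable phi a ->
  is_Cdiff (fun x => f (phi x)) a (fun v => Df ('D_v phi a)).
Proof.
move: f phi a Df; case: b => f phi a Df [df ef] dphi; last first.
  split; first exact: (differentiable_comp dphi df).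
  move=> v; rewrite -ef.
  exact: (@derive_comp (gfield R ComplexField) _ _ (gfield R ComplexField)^o f phi a v dphi df).
case: df => df1 df2; split.
  by split; [exact: (differentiable_comp dphi df1) | exact: (differentiable_comp dphi df2)].
move=> v; rewrite -ef; congr (_ +i* _)%C.
  exact: (@derive_comp R _ _ R^o (fun x => complex.Re (f x)) phi a v dphi df1).
exact: (@derive_comp R _ _ R^o (fun x => complex.Im (f x)) phi a v dphi df2).
Qed.

Lemma is_Cdiff_toC d (f : 'rV[F]_d -> F) (a : 'rV[F]_d) :
  differentiable (f : _ -> F^o) a ->
  is_Cdiff (fun x => toC (f x)) a (fun v => toC (@derive F _ F^o f a v)).
Proof.
move=> df; split; last by move=> v; exact: (Cderivable_toC (@diff_derivable _ _ _ _ _ _ df)).2.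
by move: f a df; case: b => f a df //=.
Qed.

Lemma Cderive_linear d (f : 'rV[F]_d -> R[i]) (a : 'rV[F]_d) (k : F) (v w : 'rV[F]_d) :
  Cdiff f a -> Cderive f a (k *: v + w) = toC k * Cderive f a v + Cderive f a w.
Proof.
have Q (K : numFieldType) (V W : normedModType K) (g : V -> W) (x u u' : V) (l : K) :
    differentiable g x -> 'D_(l *: u + u') g x = l *: 'D_u g x + 'D_u' g x.
  by move=> dg; rewrite !(deriveE _ dg) linearP.
move: f a k v w; case: b => f a k v w df.
  have [df1 df2] := df.
  rewrite /Cderive (Q R _ R^o _ a v w k df1) (Q R _ R^o _ a v w k df2).
  apply/eqP; rewrite eq_complex /=; apply/andP; split; apply/eqP; rewrite /GRing.scale /=; ring.
exact: (Q (gfield R ComplexField) _ (gfield R ComplexField)^o f a v w k df).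
Qed.

End CdiffTheory.

(** * Adjoint action and bracket in a chart *)

Section RowBlocks.
Variables (K : numFieldType) (V : normedModType K) (p q : nat).
Variables (f : V -> 'rV[K]_p) (g : V -> 'rV[K]_q) (a : V).
Hypotheses (df : differentiable f a) (dg : differentiable g a).

Lemma differentiable_coord_comp k (h : V -> 'rV[K]_k) j :
  differentiable h a -> differentiable (fun x => h x 0 j : K^o) a.
Proof. by move=> dh; exact: (differentiable_comp dh (differentiable_coord (h a) 0 j)). Qed.

Lemma differentiable_row_mx : differentiable (fun x => row_mx (f x) (g x)) a.
Proof.
apply: differentiable_rV => j; case: (split_ordP j) => k ->.
  have -> : (fun x => row_mx (f x) (g x) 0 (lshift q k) : K^o) = (fun x => f x 0 k).
    by apply/funext => x; rewrite row_mxEl.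
  exact: differentiable_coord_comp.
have -> : (fun x => row_mx (f x) (g x) 0 (rshift p k) : K^o) = (fun x => g x 0 k).
  by apply/funext => x; rewrite row_mxEr.
exact: differentiable_coord_comp.
Qed.

Lemma derive_row_mx v :
  'D_v (fun x => row_mx (f x) (g x)) a = row_mx ('D_v f a) ('D_v g a).
Proof.
apply/rowP => j.
rewrite -(derivable_coord j (diff_derivable (v := v) differentiable_row_mx)).2.
case: (split_ordP j) => k ->.
  have -> : (fun x => row_mx (f x) (g x) 0 (lshift q k) : K^o) = (fun x => f x 0 k).
    by apply/funext => x; rewrite row_mxEl.
  by rewrite (derivable_coord k (diff_derivable df)).2 row_mxEl.
have -> : (fun x => row_mx (f x) (g x) 0 (rshift p k) : K^o) = (fun x => g x 0 k).
  by apply/funext => x; rewrite row_mxEr.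
by rewrite (derivable_coord k (diff_derivable dg)).2 row_mxEr.
Qed.

End RowBlocks.

Section Charts.
Variables (R : realType) (b : ground) (d : nat).
Local Notation F := (gfield R b).
Variable G : lieGroupType F d.
Implicit Types (c : chart F d G) (x g : G) (z : 'rV[F]_d).

Lemma cdom_nbhs c x : cdom c x -> nbhs x (cdom c).
Proof. by move=> cx; apply: open_nbhs_nbhs; split => //; exact: cdom_open. Qed.

Lemma cimg_nbhs c z : cimg c z -> nbhs z (cimg c).
Proof. by move=> cx; apply: open_nbhs_nbhs; split => //; exact: cimg_open. Qed.

Lemma cmap_cimg c x : cdom c x -> cimg c (cmap c x).
Proof. by move=> cx; exists x. Qed.

Lemma cinv_cdom c z : cimg c z -> cdom c (cinv c z).
Proof. by case=> x cx <-; rewrite cmapK. Qed.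

Lemma cinvK c z : cimg c z -> cmap c (cinv c z) = z.
Proof. by case=> x cx <-; rewrite cmapK. Qed.

Lemma cmap_at c x : cdom c x -> {for x, continuous (cmap c)}.
Proof.
move=> cx; have := @cmap_continuous _ _ _ c.
rewrite (continuous_open_subspace _ (cdom_open c)); apply; exact/mem_set.
Qed.

Lemma cinv_at c z : cimg c z -> {for z, continuous (cinv c)}.
Proof.
move=> cx; have := @cinv_continuous _ _ _ c.
rewrite (continuous_open_subspace _ (@cimg_open _ _ _ c)); apply; exact/mem_set.
Qed.

Lemma mulg_cvg (T : topologicalType) (a : T) (u v : T -> G) :
  {for a, continuous u} -> {for a, continuous v} ->
  {for a, continuous (fun t => (u t * v t)%g)}.
Proof.
move=> cu cv; apply: (cvg_comp (fun t => (u t, v t)) (fun p : G * G => (p.1 * p.2)%g)).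
  exact: (cvg_pair cu cv).
exact: (@lie_mul_continuous F d G (u a, v a)).
Qed.

Lemma invg_cvg (T : topologicalType) (a : T) (u : T -> G) :
  {for a, continuous u} -> {for a, continuous (fun t => (u t)^-1%g)}.
Proof.
move=> cu; apply: (cvg_comp u (fun x : G => x^-1%g) cu).
exact: (@lie_inv_continuous F d G (u a)).
Qed.

Definition mul_dom c1 c2 c3 : set 'rV[F]_(d + d) :=
  [set z | [/\ cimg c1 (lsubmx z), cimg c2 (rsubmx z)
         & cdom c3 (cinv c1 (lsubmx z) * cinv c2 (rsubmx z))%g]].

Lemma mul_dom_open c1 c2 c3 : open (mul_dom c1 c2 c3).
Proof.
rewrite openE => z [z1 z2 z3]; rewrite /interior.
have L : {for z, continuous (lsubmx : 'rV[F]_(d + d) -> 'rV[F]_d)} by exact: continuous_lsubmx.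
have Rr : {for z, continuous (rsubmx : 'rV[F]_(d + d) -> 'rV[F]_d)} by exact: continuous_rsubmx.
have N1 : \forall w \near z, cimg c1 (lsubmx w) by exact: (L _ (cimg_nbhs z1)).
have N2 : \forall w \near z, cimg c2 (rsubmx w) by exact: (Rr _ (cimg_nbhs z2)).
have C1 : {for z, continuous (fun w : 'rV[F]_(d + d) => cinv c1 (lsubmx w))}.
  exact: (cvg_comp _ _ L (cinv_at z1)).
have C2 : {for z, continuous (fun w : 'rV[F]_(d + d) => cinv c2 (rsubmx w))}.
  exact: (cvg_comp _ _ Rr (cinv_at z2)).
have N3 : \forall w \near z, cdom c3 (cinv c1 (lsubmx w) * cinv c2 (rsubmx w))%g.
  exact: (mulg_cvg C1 C2 (cdom_nbhs z3)).
by apply: filterS3 N1 N2 N3 => w w1 w2 w3; split.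
Qed.

Lemma inv_dom_open c c' : open [set z | cimg c z /\ cdom c' ((cinv c z)^-1)%g].
Proof.
rewrite openE => z [z1 z2]; rewrite /interior.
have N2 : \forall w \near z, cdom c' (cinv c w)^-1%g.
  exact: (invg_cvg (cinv_at z1) (cdom_nbhs z2)).
by apply: filterS2 (cimg_nbhs z1) N2 => w w1 w2; split.
Qed.

Lemma mul_chart_differentiable c1 c2 c3 (z : 'rV[F]_(d + d)) :
  atlas c1 -> atlas c2 -> atlas c3 -> mul_dom c1 c2 c3 z ->
  differentiable (fun w : 'rV[F]_(d + d) => cmap c3 (cinv c1 (lsubmx w) * cinv c2 (rsubmx w))%g) z.
Proof.
move=> a1 a2 a3 Mz; have S := lie_mul_smooth c1 c2 c3 a1 a2 a3 1%N.
exact: (Ck1_differentiable (@mul_dom_open c1 c2 c3) S Mz).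
Qed.

(** Multiplication is known to be smooth only as a function of two chart points; the fixed factor
    [g] is read in a chart around [g] and frozen. *)
Lemma left_translation_differentiable c1 c2 g x :
  atlas c1 -> atlas c2 -> cdom c1 x -> cdom c2 (g * x)%g ->
  differentiable (fun z => cmap c2 (g * cinv c1 z)%g) (cmap c1 x).
Proof.
move=> a1 a2 x1 x2; have [c ac cg] := atlas_cover g.
have -> : (fun z => cmap c2 (g * cinv c1 z)%g) =
  (fun w : 'rV[F]_(d + d) => cmap c2 (cinv c (lsubmx w) * cinv c1 (rsubmx w))%g) \o
  (fun z => row_mx (cmap c g) z).
  by apply/funext => z /=; rewrite row_mxKl row_mxKr cmapK.
apply: differentiable_comp.
  by apply: differentiable_row_mx; [exact: differentiable_cst | exact: ex_diff].
apply: mul_chart_differentiable => //; split; rewrite ?row_mxKl ?row_mxKr ?cmapK //.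
  exact: cmap_cimg.
exact: cmap_cimg.
Qed.

Lemma right_translation_differentiable c1 c2 g x :
  atlas c1 -> atlas c2 -> cdom c1 x -> cdom c2 (x * g)%g ->
  differentiable (fun z => cmap c2 (cinv c1 z * g)%g) (cmap c1 x).
Proof.
move=> a1 a2 x1 x2; have [c ac cg] := atlas_cover g.
have -> : (fun z => cmap c2 (cinv c1 z * g)%g) =
  (fun w : 'rV[F]_(d + d) => cmap c2 (cinv c1 (lsubmx w) * cinv c (rsubmx w))%g) \o
  (fun z => row_mx z (cmap c g)).
  by apply/funext => z /=; rewrite row_mxKl row_mxKr cmapK.
apply: differentiable_comp.
  by apply: differentiable_row_mx; [exact: ex_diff | exact: differentiable_cst].
apply: mul_chart_differentiable => //; split; rewrite ?row_mxKl ?row_mxKr ?cmapK //.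
  exact: cmap_cimg.
exact: cmap_cimg.
Qed.

End Charts.

Section Conjugation.
Variables (R : realType) (b : ground) (d : nat).
Local Notation F := (gfield R b).
Variable G : lieGroupType F d.
Variables (c : chart F d G) (c_atlas : atlas c) (c_one : cdom c 1%g).
Local Notation e := (cmap c 1%g).
Implicit Types (g : G).

Definition conj_chart g (z : 'rV[F]_d) := cmap c (g * cinv c z * g^-1)%g.

Lemma cinv_e : cinv c e = 1%g.
Proof. exact: cmapK. Qed.

Lemma conj_chart_e g : conj_chart g e = e.
Proof. by rewrite /conj_chart cinv_e mulg1 mulgV. Qed.

Lemma cst_at (T U : topologicalType) (a : T) (k : U) : {for a, continuous (fun=> k)}.
Proof. exact: cvg_cst. Qed.

(** The intermediate product of [g] with a point near the identity may lie outside the domain of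
    [c], hence the detour through a chart around [g]. *)
Lemma conj_chart_differentiable g : differentiable (conj_chart g) e.
Proof.
have [c' ac' cg] := atlas_cover g.
have d1 : differentiable (fun z => cmap c' (g * cinv c z)%g) e.
  by apply: left_translation_differentiable; rewrite ?mulg1.
have d2 : differentiable (fun w => cmap c (cinv c' w * g^-1)%g)
    ((fun z => cmap c' (g * cinv c z)%g) e).
  rewrite /= cinv_e mulg1.
  by apply: right_translation_differentiable; rewrite ?mulgV.
have dc := differentiable_comp d1 d2.
apply: near_differentiable dc.
have N : \forall z \near e, cdom c' (g * cinv c z)%g.
  have C := mulg_cvg (@cst_at _ _ e g) (cinv_at (cmap_cimg c_one)).
  by apply: C; apply: cdom_nbhs; rewrite cinv_e mulg1.
by apply: filterS N => z Hz /=; rewrite cmapK.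
Qed.

Lemma conj_chart_near g : \forall z \near e, cdom c (g * cinv c z * g^-1)%g.
Proof.
have C := mulg_cvg (mulg_cvg (@cst_at _ _ e g) (cinv_at (cmap_cimg c_one)))
                   (@cst_at _ _ e (g^-1)%g).
by apply: C; apply: cdom_nbhs; rewrite cinv_e mulg1 mulgV.
Qed.

Lemma Ad_diff g y : Ad c g y = 'd (conj_chart g) e y.
Proof. by rewrite /Ad deriveE //; exact: conj_chart_differentiable. Qed.

Lemma Ad_is_linear g : linear (Ad c g).
Proof. by move=> k x y; rewrite !Ad_diff linearP. Qed.

Lemma Ad_mul g g' y : Ad c (g * g')%g y = Ad c g (Ad c g' y).
Proof.
have E : \forall z \near e, conj_chart g (conj_chart g' z) = conj_chart (g * g')%g z.
  apply: filterS (conj_chart_near g') => z Hz.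
  by rewrite /conj_chart cmapK // invgM !mulgA.
rewrite /Ad -/(conj_chart _) -(near_eq_derive _ E).
rewrite (derive_comp y (conj_chart_differentiable g')) ?conj_chart_e //.
exact: conj_chart_differentiable.
Qed.

Lemma Ad_one y : Ad c 1%g y = y.
Proof.
have E : \forall z \near e, conj_chart 1%g z = z.
  apply: filterS (cimg_nbhs (cmap_cimg c_one)) => z Hz.
  by rewrite /conj_chart mul1g invg1 mulg1 cinvK.
by rewrite /Ad -/(conj_chart _) (near_eq_derive _ E) derive_id.
Qed.

End Conjugation.

Lemma derive_lincomb (K : numFieldType) (V W : normedModType K)
    (f g h : V -> W) (a x : V) (k : K) :
  derivable f a x -> derivable g a x -> (forall z, h z = k *: f z + g z) ->
  'D_x h a = k *: 'D_x f a + 'D_x g a.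
Proof.
move=> df dg E; have -> : h = (k *: f) + g by apply/funext => z; exact: E.
by rewrite deriveD ?deriveZ //; exact: derivableZ.
Qed.

Lemma derive_partials (K : numFieldType) (n : nat) (W : normedModType K)
    (f : 'rV[K]_n -> W) (a u : 'rV[K]_n) :
  differentiable f a -> 'D_u f a = \sum_i u 0 i *: 'D_(delta_mx 0 i) f a.
Proof.
move=> df; rewrite (deriveE _ df) {1}(row_sum_delta u) linear_sum.
by apply: eq_bigr => i _; rewrite linearZ (deriveE _ df).
Qed.

Section AdDifferentiable.
Variables (R : realType) (b : ground) (d : nat).
Local Notation F := (gfield R b).
Variable G : lieGroupType F d.
Variables (c : chart F d G) (c_atlas : atlas c) (c_one : cdom c 1%g).
Local Notation e := (cmap c 1%g).

Definition mul_chart (w : 'rV[F]_(d + d)) : 'rV[F]_d :=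
  cmap c (cinv c (lsubmx w) * cinv c (rsubmx w))%g.
Definition inv_chart (z : 'rV[F]_d) : 'rV[F]_d := cmap c (cinv c z)^-1%g.
Definition mul_partial q := fun p => 'D_(delta_mx 0 q) mul_chart p.

Local Notation m := mul_chart.
Local Notation iv := inv_chart.
Local Notation Dm := mul_partial.
Local Notation MD := (mul_dom c c c).

Lemma inv_chart_differentiable : differentiable iv e.
Proof.
apply: (Ck1_differentiable (@inv_dom_open R b d G c c)).
  exact: (lie_inv_smooth c c c_atlas c_atlas 1%N).
by split; [exact: cmap_cimg | rewrite cinv_e // invg1].
Qed.

Lemma mul_chart_diff p : MD p -> differentiable m p.
Proof. exact: mul_chart_differentiable. Qed.

Lemma mul_partial_differentiable q p : MD p -> differentiable (Dm q) p.
Proof.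
apply: (Ck1_differentiable (@mul_dom_open R b d G c c c)).
have [_ /(_ q)[_]] := lie_mul_smooth c c c c_atlas c_atlas c_atlas 2%N.
exact.
Qed.

Lemma mul_dom_id z : cimg c z -> MD (row_mx z e).
Proof.
move=> cz; split; rewrite ?row_mxKl ?row_mxKr //; first exact: cmap_cimg.
by rewrite cinv_e // mulg1; exact: cinv_cdom.
Qed.

Lemma mul_dom_inv z : cimg c z -> cdom c (cinv c z)^-1%g -> MD (row_mx z (iv z)).
Proof.
move=> cz ci; split; rewrite ?row_mxKl ?row_mxKr //; first exact: cmap_cimg.
by rewrite /iv cmapK // mulgV.
Qed.

(** [S y z] is the derivative at the identity of left translation by the point [z], in the direction
    [y]; [H y z] applies to it the derivative of right translation by the inverse of that point. *)
Let S y z : 'rV[F]_d := \sum_r (row_mx (0 : 'rV[F]_d) y) 0 r *: Dm r (row_mx z e).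
Let H y z : 'rV[F]_d := \sum_q (row_mx (S y z) (0 : 'rV[F]_d)) 0 q *: Dm q (row_mx z (iv z)).

(** Conjugation is a left followed by a right translation, so the chain rule expresses [Ad] through
    first partials of the multiplication, with [z] entering only through their coefficients and base
    points. *)
Lemma Ad_partials z y : cimg c z -> cdom c (cinv c z)^-1%g -> Ad c (cinv c z) y = H y z.
Proof.
move=> cz ci.
have dl : differentiable (fun w : 'rV[F]_d => row_mx z w) e.
  by apply: differentiable_row_mx; [exact: differentiable_cst | exact: ex_diff].
have dr : differentiable (fun a : 'rV[F]_d => row_mx a (iv z)) z.
  by apply: differentiable_row_mx; [exact: ex_diff | exact: differentiable_cst].
have M1 := mul_dom_id cz; have M2 := mul_dom_inv cz ci.
have me : m (row_mx z e) = z.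
  by rewrite /m row_mxKl row_mxKr cinv_e // mulg1 cinvK.
have dphi : differentiable (fun w => m (row_mx z w)) e.
  exact: (differentiable_comp dl (mul_chart_diff M1)).
have df : differentiable (fun a => m (row_mx a (iv z))) (m (row_mx z e)).
  by rewrite me; exact: (differentiable_comp dr (mul_chart_diff M2)).
have E : \forall w \near e, conj_chart c (cinv c z) w = m (row_mx (m (row_mx z w)) (iv z)).
  have C := mulg_cvg (@cst_at _ _ e (cinv c z)) (cinv_at (cmap_cimg c_one)).
  have N : \forall w \near e, cdom c (cinv c z * cinv c w)%g.
    by apply: C; apply: cdom_nbhs; rewrite cinv_e // mulg1; exact: cinv_cdom.
  apply: filterS N => w Hw; rewrite /m !row_mxKl !row_mxKr /iv.
  by rewrite [cinv c (cmap c (_ * _)%g)]cmapK // cmapK.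
rewrite /Ad -/(conj_chart c _) (near_eq_derive _ E).
rewrite (derive_comp y dphi df) me.
have -> : 'D_y (fun w => m (row_mx z w)) e = S y z.
  rewrite (derive_comp y dl (mul_chart_diff M1)).
  rewrite (derive_row_mx (differentiable_cst z e) ex_diff) derive_cst derive_id.
  exact: derive_partials (mul_chart_diff M1).
rewrite (derive_comp (S y z) dr (mul_chart_diff M2)).
rewrite (derive_row_mx ex_diff (differentiable_cst (iv z) z)) derive_cst derive_id.
exact: derive_partials (mul_chart_diff M2).
Qed.

Lemma Ad_near y : \forall z \near e, Ad c (cinv c z) y = H y z.
Proof.
have N : \forall z \near e, cdom c (cinv c z)^-1%g.
  apply: (invg_cvg (cinv_at (cmap_cimg c_one))); apply: cdom_nbhs.
  by rewrite cinv_e // invg1.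
by apply: filterS2 (cimg_nbhs (cmap_cimg c_one)) N => z; exact: Ad_partials.
Qed.

(** The formula [H] already contains first partials of the multiplication, so second derivatives of
    the multiplication enter here. The result makes the bracket a genuine differential, hence linear
    in its first argument. *)
Lemma Ad_differentiable y : differentiable (fun z => Ad c (cinv c z) y) e.
Proof.
have cie : cdom c (cinv c e)^-1%g by rewrite cinv_e // invg1.
have M1 := mul_dom_id (cmap_cimg c_one); have M2 := mul_dom_inv (cmap_cimg c_one) cie.
have dl : differentiable (fun z : 'rV[F]_d => row_mx z e) e.
  by apply: differentiable_row_mx; [exact: ex_diff | exact: differentiable_cst].
have dr : differentiable (fun z : 'rV[F]_d => row_mx z (iv z)) e.
  by apply: differentiable_row_mx; [exact: ex_diff | exact: inv_chart_differentiable].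
have dS : differentiable (S y) e.
  have -> : S y = \sum_r (fun z => (row_mx (0 : 'rV[F]_d) y) 0 r *: Dm r (row_mx z e)).
    by apply/funext => z; rewrite fct_sumE.
  apply: differentiable_sum => r; apply: differentiableZ.
  exact: (differentiable_comp dl (mul_partial_differentiable r M1)).
have dH : differentiable (H y) e.
  apply: differentiable_rV => j.
  have -> : (fun x => H y x 0 j : F^o) = \sum_q
      ((fun z => (row_mx (S y z) (0 : 'rV[F]_d)) 0 q : F^o) *
       (fun z => Dm q (row_mx z (iv z)) 0 j : F^o)).
    by apply/funext => z; rewrite fct_sumE /H summxE; apply: eq_bigr => q _; rewrite mxE.
  apply: differentiable_sum => q; apply: differentiableM.
    exact: (differentiable_coord_comp q (differentiable_row_mx dS (differentiable_cst (0 : 'rV[F]_d) e))).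
  apply: differentiable_coord_comp.
  exact: (differentiable_comp dr (mul_partial_differentiable q M2)).
apply: near_differentiable dH.
by apply: filterS (Ad_near y) => z ->.
Qed.

Lemma lie_bracket_linear_l y : linear (fun x => lie_bracket c x y).
Proof.
move=> k u v; rewrite /lie_bracket.
by rewrite !(deriveE _ (Ad_differentiable y)) linearP.
Qed.

Lemma lie_bracket_linear_r x : linear (lie_bracket c x).
Proof.
move=> k u v; rewrite /lie_bracket.
have D w : derivable (fun z => Ad c (cinv c z) w) e x.
  exact: diff_derivable (Ad_differentiable w).
apply: derive_lincomb (D u) (D v) _ => z.
exact: (Ad_is_linear c_atlas c_one).
Qed.

End AdDifferentiable.

Lemma near_all (T : topologicalType) (P : T -> Prop) (a : T) :
  (forall x, P x) -> \forall x \near a, P x.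
Proof. by move=> H; apply: nearW. Qed.

(** * Differentials of matrix homomorphisms *)

Section LocalRepresentations.
Variables (R : realType) (b : ground) (d : nat).
Local Notation F := (gfield R b).
Variable G : lieGroupType F d.
Variables (c : chart F d G) (c_atlas : atlas c) (c_one : cdom c 1%g).
Local Notation e := (cmap c 1%g).

Lemma is_Cdiff_unique (f g : 'rV[F]_d -> R[i]) (a v : 'rV[F]_d) Df Dg :
  (\forall x \near a, f x = g x) -> is_Cdiff f a Df -> is_Cdiff g a Dg -> Df v = Dg v.
Proof. by move=> E /(is_Cdiff_near E) [_ <-] [_ <-]. Qed.

Section OneRepresentation.
(** [sigma] is kept general, and differentiable only at the identity, because it stands for [rho],
    for the adjoint representation and for the determinant. *)
Variables (k : nat) (sigma : G -> 'M[R[i]]_k).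
Hypothesis sigma1 : sigma 1%g = 1%:M.
Hypothesis sigmaM : forall g g', sigma (g * g')%g = sigma g *m sigma g'.
Hypothesis sigma_diff : forall i j, Cdiff (fun z => sigma (cinv c z) i j) e.

Lemma sigma_is_Cdiff i j :
  is_Cdiff (fun z => sigma (cinv c z) i j) e (fun v => drho sigma c v i j).
Proof. by split=> // v; rewrite mxE. Qed.

Lemma drho_linear (l : F) (x y : 'rV[F]_d) :
  drho sigma c (l *: x + y) = toC l *: drho sigma c x + drho sigma c y.
Proof. by apply/matrixP => i j; rewrite !mxE Cderive_linear. Qed.

Lemma drho_sum (x : 'rV[F]_d) :
  drho sigma c x = \sum_i toC (x 0 i) *: drho sigma c (delta_mx 0 i).
Proof.
have D0 : drho sigma c 0 = 0.
  have := drho_linear 1 0 0; rewrite scale1r addr0 rmorph1 scale1r => /eqP.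
  by rewrite -[X in X == _]addr0 (inj_eq (addrI _)) eq_sym => /eqP.
have DD u v : drho sigma c (u + v) = drho sigma c u + drho sigma c v.
  by rewrite -[u]scale1r drho_linear rmorph1 !scale1r.
have DZ l u : drho sigma c (l *: u) = toC l *: drho sigma c u.
  by rewrite -[l *: u]addr0 drho_linear D0 addr0.
rewrite {1}(row_sum_delta x) (big_morph _ DD D0).
by apply: eq_bigr => i _; rewrite DZ.
Qed.

(** Differentiate [sigma (g x g^-1) sigma g = sigma g sigma x] in [x] at the identity. *)
Lemma drho_Ad g (y : 'rV[F]_d) :
  sigma g *m drho sigma c y = drho sigma c (Ad c g y) *m sigma g.
Proof.
apply/matrixP => i j; rewrite !mxE.
have L : is_Cdiff (fun z => \sum_l sigma (cinv c (conj_chart c g z)) i l * sigma g l j) e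
   (fun v => \sum_l (sigma (cinv c (conj_chart c g e)) i l * 0 +
       sigma g l j * drho sigma c ('D_v (conj_chart c g) e) i l)).
  apply: is_Cdiff_sum => l; apply: is_CdiffM; last exact: is_Cdiff_cst.
  have H : is_Cdiff (fun z => sigma (cinv c z) i l) (conj_chart c g e)
      (fun v => drho sigma c v i l).
    by rewrite conj_chart_e //; exact: sigma_is_Cdiff.
  exact: (is_Cdiff_comp H (conj_chart_differentiable c_atlas c_one g)).
have Rr : is_Cdiff (fun z => \sum_l sigma g i l * sigma (cinv c z) l j) e
   (fun v => \sum_l (sigma g i l * drho sigma c v l j + sigma (cinv c e) l j * 0)).
  by apply: is_Cdiff_sum => l; apply: is_CdiffM; [exact: is_Cdiff_cst | exact: sigma_is_Cdiff].
have E : \forall z \near e, \sum_l sigma (cinv c (conj_chart c g z)) i l * sigma g l j =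
     \sum_l sigma g i l * sigma (cinv c z) l j.
  apply: filterS (conj_chart_near c_one g) => z Hz.
  have := sigmaM (g * cinv c z * g^-1)%g g; rewrite mulgVK sigmaM => /matrixP /(_ i j).
  by rewrite !mxE /conj_chart cmapK // => ->.
have := is_Cdiff_unique y E L Rr.
under eq_bigr do rewrite mulr0 add0r mulrC.
by under [X in _ = X -> _]eq_bigr do rewrite mulr0 addr0.
Qed.

(** Differentiate [drho_Ad] in [g] at the identity, in the direction [x]: the product rule gives
    [drho [x, y] + drho y drho x] on one side and [drho x drho y] on the other. *)
Lemma drho_bracket (x y : 'rV[F]_d) :
  drho sigma c (lie_bracket c x y) =
  drho sigma c x *m drho sigma c y - drho sigma c y *m drho sigma c x.
Proof.
apply/matrixP => i j.
have dAd l : is_Cdiff (fun z => toC (Ad c (cinv c z) y 0 l)) e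
    (fun v => toC (lie_bracket c v y 0 l)).
  have D := Ad_differentiable c_atlas c_one y.
  have [DC E] := is_Cdiff_toC (differentiable_coord_comp l D).
  split=> // v; rewrite E (derivable_coord l (diff_derivable D)).2.
  by [].
have dA i' l' : is_Cdiff (fun z => drho sigma c (Ad c (cinv c z) y) i' l') e
    (fun v => drho sigma c (lie_bracket c v y) i' l').
  have -> : (fun z => drho sigma c (Ad c (cinv c z) y) i' l') = fun z =>
      \sum_q toC (Ad c (cinv c z) y 0 q) * drho sigma c (delta_mx 0 q) i' l'.
    by apply/funext => z; rewrite drho_sum summxE; apply: eq_bigr => q _; rewrite mxE.
  have -> : (fun v => drho sigma c (lie_bracket c v y) i' l') = fun v =>
      \sum_q (toC (Ad c (cinv c e) y 0 q) * 0 +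
         drho sigma c (delta_mx 0 q) i' l' * toC (lie_bracket c v y 0 q)).
    apply/funext => v; rewrite drho_sum summxE; apply: eq_bigr => q _.
    by rewrite mxE mulr0 add0r mulrC.
  by apply: is_Cdiff_sum => q; apply: is_CdiffM; [exact: dAd | exact: is_Cdiff_cst].
have L : is_Cdiff (fun z => \sum_l drho sigma c (Ad c (cinv c z) y) i l * sigma (cinv c z) l j) e
   (fun v => \sum_l (drho sigma c (Ad c (cinv c e) y) i l * drho sigma c v l j +
       sigma (cinv c e) l j * drho sigma c (lie_bracket c v y) i l)).
  by apply: is_Cdiff_sum => l; apply: is_CdiffM; [exact: dA | exact: sigma_is_Cdiff].
have Rr : is_Cdiff (fun z => \sum_l sigma (cinv c z) i l * drho sigma c y l j) e
   (fun v => \sum_l (sigma (cinv c e) i l * 0 + drho sigma c y l j * drho sigma c v i l)).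
  by apply: is_Cdiff_sum => l; apply: is_CdiffM; [exact: sigma_is_Cdiff | exact: is_Cdiff_cst].
have E : \forall z \near e,
    \sum_l drho sigma c (Ad c (cinv c z) y) i l * sigma (cinv c z) l j =
    \sum_l sigma (cinv c z) i l * drho sigma c y l j.
  apply: near_all => z; have /matrixP/(_ i j) := drho_Ad (cinv c z) y.
  by rewrite !mxE => ->.
have := is_Cdiff_unique x E L Rr.
rewrite big_split /= cinv_e // Ad_one // sigma1.
have -> : \sum_l (1%:M : 'M[R[i]]_k) l j * drho sigma c (lie_bracket c x y) i l =
    drho sigma c (lie_bracket c x y) i j.
  rewrite (bigD1 j) //= big1 ?addr0; first by rewrite mxE eqxx mul1r.
  by move=> l lj; rewrite mxE (negbTE lj) mul0r.
move=> H; rewrite [RHS]mxE [X in _ = _ + X]mxE [X in _ = X + _]mxE [X in _ = _ - X]mxE.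
apply/eqP; rewrite eq_sym subr_eq addrC; apply/eqP; rewrite H.
by apply: eq_bigr => l _; rewrite mulr0 add0r mulrC.
Qed.

End OneRepresentation.
End LocalRepresentations.

(** * From invariance under the Lie algebra to invariance under the group *)

Section VanishingSolutions.
Variables (R : realType) (b : ground) (d : nat).
Local Notation F := (gfield R b).

(* Gronwall-type uniqueness for a linear differential system: by the mean value bound, a bound [M]
   on all the unknowns improves to [M / 2]. *)
Lemma linear_system_vanish (I : Type) (u : I -> 'rV[F]_d -> R[i]) (a : 'rV[F]_d) (r S : R) :
  0 <= S ->
  (forall j, u j a = 0) ->
  (forall z j, `|z - a| < ofR b r -> `|u j z| <= S%:C%C) ->
  (forall z j, `|z - a| < ofR b r -> Cdiff (u j) z) ->
  (forall z v j M, `|z - a| < ofR b r -> `|v| < ofR b r -> 0 <= M ->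
     (forall l, `|u l z| <= M%:C%C) -> `|Cderive (u j) z v| <= (M / 4)%:C%C) ->
  forall z j, `|z - a| < ofR b r -> u j z = 0.
Proof.
move=> S0 ua uS du bu.
have H n : forall z j, `|z - a| < ofR b r -> `|u j z| <= (S / 2 ^+ n)%:C%C.
  elim: n => [|n IH] z j zr; first by rewrite expr0 divr1; exact: uS.
  have near_seg t : 0 <= t <= 1 -> `|a + ofR b t *: (z - a) - a| < ofR b r.
    move=> /andP[t0 t1]; rewrite addrAC subrr add0r normrZ ofR_norm (ger0_norm t0).
    by apply: le_lt_trans zr; rewrite ler_piMl // -(ofR1 R b) ofR_le.
  have -> : u j z = u j (a + (z - a)) - u j a by rewrite ua subr0 addrC subrK.
  (* The mean value lemma doubles the bound [M / 4] on the derivative, whence the halving at each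
     step of the induction. *)
  have -> : S / 2 ^+ n.+1 = (S / 2 ^+ n) / 4 + (S / 2 ^+ n) / 4.
    rewrite exprS; field.
    by rewrite expf_eq0 pnatr_eq0 andbF.
  apply: mean_value_bound => t tI.
    by apply: Cdiff_derivable; apply: du; exact: near_seg.
  apply: bu => //; first exact: near_seg.
    by rewrite divr_ge0 // exprn_ge0.
  by move=> l; apply: IH; exact: near_seg.
move=> z j zr.
have [q qE] : exists q : R, `|u j z| = q%:C%C.
  by exists (complex.Re `|u j z|); rewrite RRe_real // ger0_real.
have q0 : 0 <= q by rewrite -lecR -qE normr_ge0.
suff q00 : q <= 0.
  apply/eqP; rewrite -normr_le0 qE lecR; exact: q00.
have {}H n : q * 2 ^+ n <= S.
  have p2 : 0 < 2 ^+ n :> R by exact: exprn_gt0.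
  by have := H n z j zr; rewrite qE lecR ler_pdivlMr.
rewrite leNgt; apply/negP => qpos.
have [n Hn] : exists n : nat, S / q < n%:R.
  exists (Num.Def.archi_bound (S / q)); apply: archi_boundP.
  by rewrite divr_ge0.
have := H n; rewrite leNgt => /negP; apply.
rewrite mulrC -ltr_pdivrMr //; apply: (lt_trans Hn).
by rewrite -natrX ltr_nat; exact: ltn_expl.
Qed.

End VanishingSolutions.

Section OpenSubgroup.
Variables (R : realType) (b : ground) (d : nat).
Local Notation F := (gfield R b).
Variable G : lieGroupType F d.

(** Cosets of [T] are neighbourhoods of their points, so the complement of [T] is open as well. *)
Lemma open_subgroup_full (T : set G) :
  connected [set: G] -> nbhs (1%g : G) T ->
  (forall x y, T x -> T y -> T (x * y)%g) -> (forall x, T x -> T x^-1%g) ->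
  forall x, T x.
Proof.
move=> conn N TM TV.
have C x : {for x, continuous (fun y : G => (x^-1 * y)%g)}.
  by apply: (@mulg_cvg R b d G); [exact: cvg_cst | exact: cvg_id].
have NT x : \forall y \near x, T (x^-1 * y)%g by apply: C; rewrite mulVg.
have oT : open T.
  rewrite openE => x Tx; rewrite /interior; apply: filterS (NT x) => y Ty.
  by have := TM _ _ Tx Ty; rewrite mulVKg.
have cT : open (~` T).
  rewrite openE => x Tx; rewrite /interior; apply: filterS (NT x) => y Ty Ty'.
  apply: Tx; have := TM _ _ Ty' (TV _ Ty).
  by rewrite invgM invgK mulVKg.
have -> : T = setT; last by [].
apply: conn.
- by exists 1%g; exact: nbhs_singleton.
- by exists T => //; rewrite setTI.
- by exists T; [rewrite -openC | rewrite setTI].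
Qed.

End OpenSubgroup.

Section InvariantSubspaces.
Variables (R : realType) (b : ground) (d : nat).
Local Notation F := (gfield R b).
Variable G : lieGroupType F d.
Variables (c : chart F d G) (c_atlas : atlas c) (c_one : cdom c 1%g).
Local Notation e := (cmap c 1%g).

Lemma toC_norm_le (x : F) (q : R) : `|x| <= ofR b q -> `|toC x| <= q%:C%C.
Proof. by have [r -> ->] := toC_norm x; rewrite ofR_le lecR. Qed.

Lemma Cdiff_near_le (f : 'rV[F]_d -> R[i]) (a : 'rV[F]_d) (q : R) :
  Cdiff f a -> 0 < q -> \forall z \near a, `|f z - f a| <= q%:C%C.
Proof.
move: f a; case: b => f a df q0.
  have q2 : 0 < q / 2 by rewrite divr_gt0.
  case: df => /differentiable_continuous c1 /differentiable_continuous c2.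
  have N1 := continuous_near_le (W := R^o) c1 q2.
  have N2 := continuous_near_le (W := R^o) c2 q2.
  apply: filterS2 N1 N2 => z z1 z2; apply: (le_trans (normc_le_reim _)).
  by rewrite lecR ReD ReN ImD ImN [leRHS](splitr q) lerD.
have q0' : 0 < q%:C%C :> R[i] by rewrite ltcR.
exact: (@continuous_near_le _ _ (gfield R ComplexField)^o f a _ (differentiable_continuous df) q0').
Qed.

Lemma is_Cdiff_mulmx k (M : 'rV[F]_d -> 'M[R[i]]_k) (D : 'rV[F]_d -> 'M[R[i]]_k)
    (A B : 'M[R[i]]_k) (a : 'rV[F]_d) i j :
  (forall i j, is_Cdiff (fun z => M z i j) a (fun v => D v i j)) ->
  is_Cdiff (fun z => (A *m M z *m B) i j) a (fun v => (A *m D v *m B) i j).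
Proof.
move=> H.
have E (N : 'M[R[i]]_k) : (A *m N *m B) i j = \sum_q \sum_p (A i p * B q j) * N p q.
  rewrite mxE; apply: eq_bigr => q _; rewrite mxE mulr_suml; apply: eq_bigr => p _.
  by rewrite mulrAC.
have -> : (fun z => (A *m M z *m B) i j) =
    fun z => \sum_q \sum_p (A i p * B q j) * M z p q by apply/funext => z; exact: E.
have -> : (fun v => (A *m D v *m B) i j) =
    fun v => \sum_q \sum_p ((A i p * B q j) * D v p q + M a p q * 0).
  by apply/funext => v; rewrite E; do 2!apply: eq_bigr => ? _; rewrite mulr0 addr0.
do 2!apply: is_Cdiff_sum => ?; apply: is_CdiffM; first exact: is_Cdiff_cst.
exact: H.
Qed.

Section OneRepresentation.
Variables (k : nat) (sigma : G -> 'M[R[i]]_k).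
Hypothesis sigma1 : sigma 1%g = 1%:M.
Hypothesis sigmaM : forall g g', sigma (g * g')%g = sigma g *m sigma g'.
Hypothesis sigma_diff : forall i j, Cdiff (fun z => sigma (cinv c z) i j) e.

(** The right Maurer-Cartan form in the chart: the derivative at [z], in the direction [v], of right
    translation by the inverse of the point [z]. *)
Definition log_derivative (z v : 'rV[F]_d) : 'rV[F]_d :=
  \sum_q row_mx v (0 : 'rV[F]_d) 0 q *: mul_partial c q (row_mx z (inv_chart c z)).

(** For [w] near [z], [sigma w] is [sigma (w z^-1) sigma z], where [w z^-1] is close to the
    identity; differentiability at the identity thus spreads to other points. *)
Lemma sigma_is_Cdiff_at z i j : cimg c z -> cdom c (cinv c z)^-1%g ->
  is_Cdiff (fun w => sigma (cinv c w) i j) z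
    (fun v => (drho sigma c (log_derivative z v) *m sigma (cinv c z)) i j).
Proof.
move=> cz ci.
have M2 := mul_dom_inv c_one cz ci.
have dr : differentiable (fun a : 'rV[F]_d => row_mx a (inv_chart c z)) z.
  by apply: differentiable_row_mx; [exact: ex_diff | exact: differentiable_cst].
pose psi w := mul_chart c (row_mx w (inv_chart c z)).
have dpsi : differentiable psi z := differentiable_comp dr (mul_chart_diff c_atlas M2).
have psiE w : psi w = cmap c (cinv c w * (cinv c z)^-1)%g.
  by rewrite /psi /mul_chart row_mxKl row_mxKr /inv_chart cmapK.
have psi_e : psi z = e by rewrite psiE mulgV.
have Dpsi v : 'D_v psi z = log_derivative z v.
  rewrite /psi (derive_comp v dr (mul_chart_diff c_atlas M2)).
  rewrite (derive_row_mx ex_diff (differentiable_cst (inv_chart c z) z)) derive_cst derive_id.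
  exact: derive_partials (mul_chart_diff c_atlas M2).
have S i' j' : is_Cdiff (fun w => sigma (cinv c (psi w)) i' j') z
    (fun v => drho sigma c (log_derivative z v) i' j').
  have H : is_Cdiff (fun w => sigma (cinv c w) i' j') (psi z) (fun v => drho sigma c v i' j').
    by rewrite psi_e; exact: sigma_is_Cdiff.
  have := is_Cdiff_comp H dpsi; congr is_Cdiff.
  by apply/funext => v; rewrite Dpsi.
have E : \forall w \near z, (1%:M *m sigma (cinv c (psi w)) *m sigma (cinv c z)) i j =
    sigma (cinv c w) i j.
  have C := mulg_cvg (cinv_at cz) (@cst_at _ _ z (cinv c z)^-1%g).
  have N : \forall w \near z, cdom c (cinv c w * (cinv c z)^-1)%g.
    by apply: C; apply: cdom_nbhs; rewrite mulgV.
  by apply: filterS N => w Hw; rewrite psiE cmapK // mul1mx -sigmaM mulgVK.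
apply: (is_Cdiff_near E).
have := @is_Cdiff_mulmx k (fun w => sigma (cinv c (psi w)))
  (fun v => drho sigma c (log_derivative z v)) 1%:M (sigma (cinv c z)) z i j S.
by congr is_Cdiff; apply/funext => v; rewrite mul1mx.
Qed.

(** The partials of the multiplication are continuous at the identity, so near it their norms exceed
    a common bound at the identity by at most 1; there are [d + d] of them. *)
Lemma log_derivative_bound : exists2 K : R, 0 <= K & \forall z \near e,
  forall v (s : R), 0 <= s -> `|v| <= ofR b s -> `|log_derivative z v| <= ofR b (K * s).
Proof.
have cie : cdom c (cinv c e)^-1%g by rewrite cinv_e // invg1.
have M2 := mul_dom_inv c_one (cmap_cimg c_one) cie.
have dr : differentiable (fun z : 'rV[F]_d => row_mx z (inv_chart c z)) e.
  by apply: differentiable_row_mx; [exact: ex_diff | exact: inv_chart_differentiable].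
pose D q z := mul_partial c q (row_mx z (inv_chart c z)).
have [k0 k00 Hk0] : exists2 k0 : R, 0 <= k0 & forall q, `|D q e| <= ofR b k0.
  have [k0 k00 E] := @ofR_nneg R b (\sum_q `|D q e|) (sumr_ge0 _ (fun i _ => normr_ge0 _)).
  exists k0 => // q; rewrite -E (bigD1 q) //= lerDl; exact: sumr_ge0.
have N : \forall z \near e, forall q, `|D q z| <= ofR b (k0 + 1).
  apply: near_forall_fin => q.
  have cD := differentiable_continuous
    (differentiable_comp dr (mul_partial_differentiable c_atlas q M2)).
  have := continuous_near_le cD (ltr01 : 0 < 1 :> F) => N.
  apply: filterS N => z Hz; rewrite ofRD ofR1 -[D q z](subrK (D q e)) addrC.
  by apply: (le_trans (ler_normD _ _)); apply: lerD.
exists ((d + d)%:R * (k0 + 1)); first by rewrite mulr_ge0 // addr_ge0.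
apply: filterS N => z Hz v s s0 vs.
apply: (le_trans (ler_norm_sum _ _ _)).
have -> : ofR b ((d + d)%:R * (k0 + 1) * s) = \sum_(q < d + d) ofR b ((k0 + 1) * s).
  by rewrite sumr_const card_ord -mulrA mulr_natl; case: (b) => //=; rewrite rmorphMn.
apply: ler_sum => q _; rewrite normrZ mulrC ofRM ler_pM //; first exact: Hz.
case: (split_ordP q) => q' ->.
  by rewrite row_mxEl; exact: le_trans (rV_norm_coord _ _) vs.
by rewrite row_mxEr mxE normr0 -(ofR0 R b) ofR_le.
Qed.

(** An invariant subspace is encoded as the kernel of an idempotent [Q]: since [1%:M - Q] projects
    onto this kernel, [A] preserves it exactly when [Q *m A *m (1%:M - Q) = 0]. *)
Variable Q : 'M[R[i]]_k.
Hypothesis QQ : Q *m Q = Q.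
Hypothesis Qdrho : forall x, Q *m drho sigma c x *m (1%:M - Q) = 0.

(** Invariance under the Lie algebra gives [Q X = Q X Q] for every [X] in the image of [drho]. Hence
    the entries of [Q sigma (1 - Q)] satisfy a homogeneous linear system and vanish at the
    identity. *)
Lemma invariant_near : \forall z \near e, Q *m sigma (cinv c z) *m (1%:M - Q) = 0.
Proof.
pose P := 1%:M - Q.
have Qd x : Q *m drho sigma c x = Q *m drho sigma c x *m Q.
  by have /eqP := Qdrho x; rewrite mulmxBr mulmx1 subr_eq0 => /eqP.
pose u (ij : 'I_k * 'I_k) z := (Q *m sigma (cinv c z) *m P) ij.1 ij.2.
have ue ij : u ij e = 0.
  by rewrite /u cinv_e // sigma1 mulmx1 /P mulmxBr mulmx1 QQ subrr mxE.
have du z ij : cimg c z -> cdom c (cinv c z)^-1%g ->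
    is_Cdiff (u ij) z
      (fun v => \sum_l (Q *m drho sigma c (log_derivative z v)) ij.1 l * u (l, ij.2) z).
  move=> cz ci.
  have := @is_Cdiff_mulmx k (fun w => sigma (cinv c w))
    (fun v => drho sigma c (log_derivative z v) *m sigma (cinv c z)) Q P z ij.1 ij.2
    (fun i j => sigma_is_Cdiff_at i j cz ci).
  congr is_Cdiff; apply/funext => v.
  have -> : Q *m (drho sigma c (log_derivative z v) *m sigma (cinv c z)) *m P =
      (Q *m drho sigma c (log_derivative z v)) *m (Q *m sigma (cinv c z) *m P).
    by rewrite mulmxA {1}Qd !mulmxA.
  by rewrite mxE.
have [K K0 NK] := log_derivative_bound.
have [C0 C00 HC0] : exists2 C0 : R, 0 <= C0 & forall i j (x : 'rV[F]_d) s,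
    `|x| <= ofR b s -> `|(Q *m drho sigma c x) i j| <= (s * C0)%:C%C.
  pose T := \sum_i \sum_j \sum_q `|(Q *m drho sigma c (delta_mx 0 q)) i j|.
  have T0 : 0 <= T by do 3!apply: sumr_ge0 => ? _.
  have TE : T = (complex.Re T)%:C%C by rewrite RRe_real // ger0_real.
  exists (complex.Re T); first by rewrite -lecR -TE.
  move=> i j x s xs.
  rewrite (drho_sum sigma_diff) mulmx_sumr summxE.
  apply: (le_trans (ler_norm_sum _ _ _)).
  rewrite rmorphM /= -TE.
  have s0 : 0 <= s%:C%C :> R[i].
    by rewrite lecR -(ofR_le b) ofR0; exact: le_trans (normr_ge0 _) xs.
  apply: (@le_trans _ _ (\sum_q s%:C%C * `|(Q *m drho sigma c (delta_mx 0 q)) i j|)).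
    apply: ler_sum => q _; rewrite -scalemxAr mxE normrM ler_wpM2r //.
    by apply: toC_norm_le; exact: le_trans (rV_norm_coord _ _) xs.
  rewrite -mulr_sumr ler_wpM2l // /T (bigD1 i) //= (bigD1 j) //= -addrA lerDl.
  by rewrite addr_ge0 //; do 3?[apply: sumr_ge0 => ? _].
have NU : \forall z \near e, forall ij, `|u ij z| <= 1%:C%C.
  apply: near_forall_fin => ij.
  have cie : cdom c (cinv c e)^-1%g by rewrite cinv_e // invg1.
  have := Cdiff_near_le (du e ij (cmap_cimg c_one) cie).1 (ltr01 : 0 < 1 :> R) => N.
  by apply: filterS N => z; rewrite ue subr0.
have NI : \forall z \near e, cdom c (cinv c z)^-1%g.
  apply: (invg_cvg (cinv_at (cmap_cimg c_one))); apply: cdom_nbhs.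
  by rewrite cinv_e // invg1.
have NC := cimg_nbhs (cmap_cimg c_one).
have [r0 r00 Hr0] : exists2 r0 : R, 0 < r0 & forall z, `|z - e| < ofR b r0 ->
    [/\ cimg c z, cdom c (cinv c z)^-1%g, (forall ij, `|u ij z| <= 1%:C%C) &
     forall v (s : R), 0 <= s -> `|v| <= ofR b s -> `|log_derivative z v| <= ofR b (K * s)].
  have N : \forall z \near e, [/\ cimg c z, cdom c (cinv c z)^-1%g,
     (forall ij, `|u ij z| <= 1%:C%C) &
     forall v (s : R), 0 <= s -> `|v| <= ofR b s -> `|log_derivative z v| <= ofR b (K * s)].
    by apply: filterS2 (filterI NC NI) (filterI NU NK) => z [? ?] [? ?]; split.
  have [q /= q0 Hq] := (nbhs_ballP _ _).1 N.
  have [r0 r00 E] := ofR_pos q0; exists r0 => // z zr; apply: Hq.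
  by rewrite -ball_normE /= distrC E.
pose L := k%:R * (K * C0) + 1.
have L1 : 0 < L by rewrite ltr_wpDl // mulr_ge0 // mulr_ge0.
(* Each derivative is a sum of [k] terms bounded by [K r C0 M]; this radius brings the total below
   [M / 4]. The summand 1 in [L] makes it positive. *)
pose r := Num.min r0 (4 * L)^-1.
have r_gt0 : 0 < r by rewrite lt_min r00 invr_gt0 mulr_gt0.
have rr0 (q : F) : q < ofR b r -> q < ofR b r0.
  by move=> zr; apply: lt_le_trans zr _; rewrite ofR_le ge_min lexx.
have V := @linear_system_vanish R b d _ u e r 1 ler01 ue.
have {}V : forall z j, `|z - e| < ofR b r -> u j z = 0.
  apply: V => [z j zr|z j zr|z v j M zr vr M0 uM].
  - by have [_ _ + _] := Hr0 z (rr0 _ zr); apply.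
  - by have [cz ci _ _] := Hr0 z (rr0 _ zr); have [] := du z j cz ci.
  have [cz ci _ KB] := Hr0 z (rr0 _ zr).
  have [_ ->] := du z j cz ci.
  apply: (le_trans (ler_norm_sum _ _ _)).
  have LB := KB v r (ltW r_gt0) (ltW vr).
  apply: (@le_trans _ _ (\sum_(l < k) (K * r * C0 * M)%:C%C)).
    apply: ler_sum => l _; rewrite normrM [leRHS]rmorphM /= ler_pM //.
    exact: HC0 LB.
  rewrite sumr_const card_ord -rmorphMn lecR.
  rewrite -mulr_natl -[leRHS]mulrC !mulrA ler_wpM2r //.
  have -> : k%:R * K * r * C0 = (k%:R * (K * C0)) * r by ring.
  apply: (@le_trans _ _ (L * (4 * L)^-1)); last first.
    by rewrite invfM mulrCA mulfV ?mulr1 // gt_eqF.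
  rewrite ler_pM //.
  - by rewrite mulr_ge0 // mulr_ge0.
  - exact: ltW.
  - by rewrite lerDl.
  - by rewrite ge_min lexx orbT.
have N : \forall z \near e, `|z - e| < ofR b r.
  have rF : 0 < ofR b r by rewrite -(ofR0 R b) ofR_lt.
  apply/nbhs_ballP; exists (ofR b r) => //= z.
  by rewrite -ball_normE /= distrC.
apply: filterS N => z zr; apply/matrixP => i j.
by have := V z (i, j) zr; rewrite /u /= => ->; rewrite mxE.
Qed.

Lemma invariant_group : connected [set: G] ->
  forall g, Q *m sigma g *m (1%:M - Q) = 0.
Proof.
move=> conn g.
(* The condition on the inverse is included so that [T] is stable under inversion. *)
pose T := [set g : G | Q *m sigma g *m (1%:M - Q) = 0 /\ Q *m sigma g^-1%g *m (1%:M - Q) = 0].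
suff : T g by case.
apply: (@open_subgroup_full R b d G T conn).
- have cm1 : {for (1%g : G), continuous (cmap c)} := cmap_at c_one.
  have N1 : \forall x \near (1%g : G), Q *m sigma x *m (1%:M - Q) = 0.
    have N : \forall x \near (1%g : G), Q *m sigma (cinv c (cmap c x)) *m (1%:M - Q) = 0.
      exact: (cm1 _ invariant_near).
    by apply: filterS2 N (cdom_nbhs c_one) => x + cx; rewrite cmapK.
  have CI : {for (1%g : G), continuous (fun x : G => x^-1%g)}.
    by apply: (@invg_cvg R b d G); exact: cvg_id.
  have N2 : \forall x \near (1%g : G), Q *m sigma x^-1%g *m (1%:M - Q) = 0.
    have cm2 : {for (1^-1%g : G), continuous (cmap c)} by rewrite invg1.
    have N : \forall x \near (1%g : G), Q *m sigma (cinv c (cmap c x^-1%g)) *m (1%:M - Q) = 0.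
      have CC : {for (1%g : G), continuous (fun x : G => cmap c x^-1%g)}.
        exact: (cvg_comp _ _ CI cm2).
      have I : nbhs (cmap c (1 : G)^-1%g)
          [set z | Q *m sigma (cinv c z) *m (1%:M - Q) = 0].
        by rewrite invg1; exact: invariant_near.
      exact: (CC _ I).
    have NV : \forall x \near (1%g : G), cdom c (x^-1)%g.
      by apply: CI; rewrite /= invg1; exact: cdom_nbhs.
    by apply: filterS2 N NV => x + cx; rewrite cmapK.
  by apply: filterS2 N1 N2 => x x1 x2; split.
- have M x y : Q *m sigma x *m (1%:M - Q) = 0 -> Q *m sigma y *m (1%:M - Q) = 0 ->
      Q *m sigma (x * y)%g *m (1%:M - Q) = 0.
    move=> Hx Hy; rewrite sigmaM mulmxA.
    have -> : Q *m sigma x = Q *m sigma x *m Q.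
      by have /eqP := Hx; rewrite mulmxBr mulmx1 subr_eq0 => /eqP.
    by rewrite -!mulmxA (mulmxA Q (sigma y)) Hy !mulmx0.
  move=> x y [x1 x2] [y1 y2]; split; first exact: M.
  by rewrite invgM; exact: M.
- by move=> x [x1 x2]; split; rewrite ?invgK.
Qed.

End OneRepresentation.
End InvariantSubspaces.

(** * Root decomposition of a semisimple Lie algebra *)

Section Sl2Strings.
(** Finite dimension enters only through a finite list [spec] containing all eigenvalues of [H]; the
    same lemmas then serve the adjoint action and a representation. *)
Variables (K : numFieldType) (V : lmodType K) (E F H : {linear V -> V}) (spec : seq K).
Hypothesis EF : forall v, E (F v) - F (E v) = H v.
Hypothesis HE : forall v, H (E v) = E (H v) + 2%:R *: E v.
Hypothesis HF : forall v, H (F v) = F (H v) - 2%:R *: F v.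
Hypothesis spec_finite : forall (c : K) v, v != 0 -> H v = c *: v -> c \in spec.

Lemma iter_raise_weight (c : K) u j : H u = c *: u ->
  H (iter j E u) = (c + (2 * j)%:R) *: iter j E u.
Proof.
move=> Hu; elim: j => [|j IH]; first by rewrite muln0 addr0.
by rewrite iterS HE IH linearZ -scalerDl; congr (_ *: _); rewrite mulnS natrD; ring.
Qed.

Lemma iter_lower_weight (c : K) u j : H u = c *: u ->
  H (iter j F u) = (c - (2 * j)%:R) *: iter j F u.
Proof.
move=> Hu; elim: j => [|j IH]; first by rewrite muln0 subr0.
by rewrite iterS HF IH linearZ -scalerBl; congr (_ *: _); rewrite mulnS natrD; ring.
Qed.

Lemma raise_vanish (c : K) u : H u = c *: u -> exists j, iter j E u == 0.
Proof.
move=> Hu; apply/not_existsP => nz.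
pose t := [seq c + (2 * j)%:R | j <- iota 0 (size spec).+1].
have tu : uniq t.
  rewrite map_inj_uniq ?iota_uniq // => i j /addrI /eqP.
  by rewrite eqr_nat eqn_pmul2l // => /eqP.
have ts : {subset t <= spec}.
  move=> x /mapP [j _ ->]; apply: spec_finite (iter_raise_weight j Hu).
  by apply/negP; exact: nz.
by have := uniq_leq_size tu ts; rewrite size_map size_iota ltnn.
Qed.

Lemma lower_vanish (c : K) u : H u = c *: u -> exists j, iter j F u == 0.
Proof.
move=> Hu; apply/not_existsP => nz.
pose t := [seq c - (2 * j)%:R | j <- iota 0 (size spec).+1].
have tu : uniq t.
  rewrite map_inj_uniq ?iota_uniq // => i j /addrI /oppr_inj /eqP.
  by rewrite eqr_nat eqn_pmul2l // => /eqP.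
have ts : {subset t <= spec}.
  move=> x /mapP [j _ ->]; apply: spec_finite (iter_lower_weight j Hu).
  by apply/negP; exact: nz.
by have := uniq_leq_size tu ts; rewrite size_map size_iota ltnn.
Qed.

(** Each commutation of [F] past [E] contributes minus a weight [c + 2 i], and these add up for [i]
    from 0 to [j]. *)
Lemma lower_raise (c : K) u j : H u = c *: u -> F u = 0 ->
  F (iter j.+1 E u) = - (j.+1%:R * (c + j%:R)) *: iter j E u.
Proof.
move=> Hu Fu.
have FE v : F (E v) = E (F v) - H v by rewrite -EF opprB addrC subrK.
elim: j => [|j IH].
  by rewrite /= FE Fu linear0 sub0r Hu addr0 mul1r scaleNr.
rewrite iterS FE IH linearZ (iter_raise_weight _ Hu) -iterS -scalerBl.
congr (_ *: _); rewrite mulnS natrD natrM -!natr1; ring.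
Qed.

(** At the last [k] with [E^k u] nonzero, applying [F] to [E^(k+1) u = 0] gives
    [(k + 1)(c + k) = 0]. *)
Lemma lowest_weight_string (c : K) u : u != 0 -> H u = c *: u -> F u = 0 ->
  exists2 k : nat, c = - k%:R & forall j, (j <= k)%N -> iter j E u != 0.
Proof.
move=> u0 Hu Fu; have ex := raise_vanish Hu.
case: (ex_minnP ex) => [[|k]] kz kmin; first by rewrite /= (negbTE u0) in kz.
have nz j : (j <= k)%N -> iter j E u != 0.
  by move=> jk; apply/negP => /kmin; rewrite ltnNge jk.
exists k => //; apply/eqP; rewrite -addr_eq0.
have := lower_raise k Hu Fu; rewrite (eqP kz) linear0 => /esym/eqP.
rewrite scaler_eq0 (negbTE (nz k (leqnn k))) orbF oppr_eq0 mulf_eq0 pnatr_eq0 /=.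
by [].
Qed.

(** Lowering [v] as far as possible reaches a lowest weight vector of weight [c - 2 N], which
    [lowest_weight_string] identifies with [- k]. *)
Lemma weight_string (c : K) v : v != 0 -> H v = c *: v ->
  exists N k : nat, exists u, [/\ u != 0, u = iter N F v, c = (2 * N)%:R - k%:R
    & forall j, (j <= k)%N -> iter j E u != 0].
Proof.
move=> v0 Hv; have ex := lower_vanish Hv.
case: (ex_minnP ex) => [[|N]] Nz Nmin; first by rewrite /= (negbTE v0) in Nz.
pose u := iter N F v.
have u0 : u != 0 by apply/negP => /Nmin; rewrite ltnn.
have [k kE ku] := lowest_weight_string u0 (iter_lower_weight N Hv) (eqP Nz).
by exists N, k, u; split=> //; rewrite -kE addrC subrK.
Qed.

End Sl2Strings.

(** Antisymmetry is derived in [br_anti]: the Jacobi identity in derivation form makes [ad] send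
    brackets to commutators, and the nondegenerate Killing form makes it injective. *)
Record ss_lie (K : numFieldType) (d : nat) (br : 'rV[K]_d -> 'rV[K]_d -> 'rV[K]_d) : Prop := {
  ss_linl : forall y, linear (br^~ y);
  ss_linr : forall x, linear (br x);
  ss_jacobi : forall x y z, br (br x y) z = br x (br y z) - br y (br x z);
  ss_nondeg : forall x, (forall y, killing br x y = 0) -> x = 0
}.

Section LieBasics.
Variables (K : numFieldType) (d : nat) (br : 'rV[K]_d -> 'rV[K]_d -> 'rV[K]_d).
Hypothesis L : ss_lie br.
Implicit Types (x y z : 'rV[K]_d).

Let brr x : {linear 'rV[K]_d -> 'rV[K]_d} :=
  HB.pack (br x) (GRing.isLinear.Build _ _ _ _ _ (ss_linr L x)).
Let brl y : {linear 'rV[K]_d -> 'rV[K]_d} :=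
  HB.pack (br^~ y) (GRing.isLinear.Build _ _ _ _ _ (ss_linl L y)).

Lemma brDl x y z : br (x + y) z = br x z + br y z.
Proof. exact: (linearD (brl z)). Qed.
Lemma brDr x y z : br z (x + y) = br z x + br z y.
Proof. exact: (linearD (brr z)). Qed.
Lemma brZl k x z : br (k *: x) z = k *: br x z.
Proof. exact: (linearZZ (brl z)). Qed.
Lemma brZr k x z : br z (k *: x) = k *: br z x.
Proof. exact: (linearZZ (brr z)). Qed.
Lemma br0l z : br 0 z = 0.
Proof. exact: (linear0 (brl z)). Qed.
Lemma br0r z : br z 0 = 0.
Proof. exact: (linear0 (brr z)). Qed.
Lemma br_sumr (I : Type) (r : seq I) (P : pred I) (f : I -> 'rV[K]_d) z :
  br z (\sum_(i <- r | P i) f i) = \sum_(i <- r | P i) br z (f i).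
Proof. exact: (linear_sum (brr z)). Qed.
Lemma br_suml (I : Type) (r : seq I) (P : pred I) (f : I -> 'rV[K]_d) z :
  br (\sum_(i <- r | P i) f i) z = \sum_(i <- r | P i) br (f i) z.
Proof. exact: (linear_sum (brl z)). Qed.

Lemma mul_ad x y : y *m ad br x = br x y.
Proof. by rewrite /ad -[br x]/(brr x : _ -> _) mul_rV_lin1. Qed.

Lemma ad_ext (A B : 'M[K]_d) : (forall y, y *m A = y *m B) -> A = B.
Proof. by move=> H; apply/row_matrixP => i; rewrite !rowE. Qed.

Lemma ad_linear k x y : ad br (k *: x + y) = k *: ad br x + ad br y.
Proof.
by apply: ad_ext => z; rewrite mulmxDr -scalemxAr !mul_ad brDl brZl.
Qed.

(** The commutator appears reversed because matrices act on row vectors from the right. *)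
Lemma ad_bracket x y : ad br (br x y) = ad br y *m ad br x - ad br x *m ad br y.
Proof.
by apply: ad_ext => z; rewrite mulmxBr !mulmxA !mul_ad (ss_jacobi L).
Qed.

Lemma killingC x y : killing br x y = killing br y x.
Proof. exact: mxtrace_mulC. Qed.

Lemma killing_linear k x y z : killing br (k *: x + y) z = k * killing br x z + killing br y z.
Proof. by rewrite /killing ad_linear mulmxDl -scalemxAl linearD linearZ. Qed.

Lemma killingDl x y z : killing br (x + y) z = killing br x z + killing br y z.
Proof. by rewrite -[x]scale1r killing_linear mul1r scale1r. Qed.

Lemma killing0l z : killing br 0 z = 0.
Proof. by have := killing_linear (-1) 0 0 z; rewrite scaler0 addr0 mulN1r addNr. Qed.

Lemma killingZl k x z : killing br (k *: x) z = k * killing br x z.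
Proof. by rewrite -[k *: x]addr0 killing_linear killing0l addr0. Qed.

Lemma killing_suml (I : Type) (r : seq I) (P : pred I) (f : I -> 'rV[K]_d) z :
  killing br (\sum_(i <- r | P i) f i) z = \sum_(i <- r | P i) killing br (f i) z.
Proof.
by rewrite (big_morph (fun x => killing br x z) (fun x y => killingDl x y z) (killing0l z)).
Qed.

Lemma killingZr k x z : killing br x (k *: z) = k * killing br x z.
Proof. by rewrite killingC killingZl killingC. Qed.

Lemma killing_sumr (I : Type) (r : seq I) (P : pred I) (f : I -> 'rV[K]_d) z :
  killing br z (\sum_(i <- r | P i) f i) = \sum_(i <- r | P i) killing br z (f i).
Proof. by rewrite killingC killing_suml; apply: eq_bigr => i _; exact: killingC. Qed.

Lemma killing_invariant x y z : killing br (br x y) z = killing br x (br y z).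
Proof.
rewrite /killing !ad_bracket mulmxBl mulmxBr !linearB /=; congr (_ - _).
  by rewrite -mulmxA mxtrace_mulC -mulmxA.
by rewrite -!mulmxA.
Qed.

Lemma ad_injective x : ad br x = 0 -> x = 0.
Proof.
by move=> x0; apply: (ss_nondeg L) => y; rewrite /killing x0 mul0mx linear0.
Qed.

Lemma br_anti x y : br x y = - br y x.
Proof.
apply/eqP; rewrite -addr_eq0; apply/eqP; apply: ad_injective.
have -> : ad br (br x y + br y x) = ad br (br x y) + ad br (br y x).
  by rewrite -[br x y]scale1r ad_linear !scale1r.
by rewrite !ad_bracket addrC addrA subrK subrr.
Qed.

Lemma br_self x : br x x = 0.
Proof. by apply: ad_injective; rewrite ad_bracket subrr. Qed.

Lemma killing_represents (C : 'cV[K]_d) :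
  exists z, forall x, killing br z x = (x *m C) 0 0.
Proof.
pose B : 'M[K]_d := \matrix_(i, j) killing br (delta_mx 0 i) (delta_mx 0 j).
have BE z x : killing br z x = (z *m B *m x^T) 0 0.
  rewrite {1}(row_sum_delta z) killing_suml -mulmxA mxE; apply: eq_bigr => i _.
  rewrite killingZl; congr (_ * _); rewrite {1}(row_sum_delta x) killing_sumr mxE.
  by apply: eq_bigr => j _; rewrite killingZr !mxE mulrC.
have Bu : B \in unitmx.
  rewrite -row_free_unit -kermx_eq0; apply/rowV0P => z /sub_kermxP zB.
  by apply: (ss_nondeg L) => y; rewrite BE zB mul0mx mxE.
exists (C^T *m invmx B) => x; rewrite BE mulmxKV //.
by rewrite -trmx_mul mxE.
Qed.

(* [L = [L, L]], in dual form. *)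
Lemma perfect (C : 'cV[K]_d) : (forall x y, (br x y *m C) 0 0 = 0) -> C = 0.
Proof.
(* The linear form [C] is the Killing product with some [z]; by invariance every [[z, x]] is
   orthogonal to the whole algebra, so [ad z] and then [z] vanish. *)
move=> H; have [z zE] := killing_represents C.
have z0 : z = 0.
  apply: ad_injective; apply: ad_ext => x; rewrite mul_ad mulmx0.
  by apply: (ss_nondeg L) => y; rewrite killing_invariant zE.
apply/matrixP => i j; rewrite (ord1 j) mxE.
by have := zE (delta_mx 0 i); rewrite z0 killing0l -rowE mxE.
Qed.

End LieBasics.

(** * Joint eigenvectors, roots and coroots *)

Section RootBasis.
Variables (K : numFieldType) (d : nat) (br : 'rV[K]_d -> 'rV[K]_d -> 'rV[K]_d).
Hypothesis L : ss_lie br.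
Variable h : {vspace 'rV[K]_d}.
Hypothesis hC : cartan_subalgebra br h.

Lemma cartan_abelian (x y : subvs_of h) : br (vsval x) (vsval y) = 0.
Proof. by case: hC => hA _ _; apply: hA; exact: subvsP. Qed.

(** Adjoining [x] to [h] keeps it abelian, so maximality of [h] applies. *)
Lemma cartan_self_centralizing (x : 'rV[K]_d) :
  (forall y : subvs_of h, br (vsval y) x = 0) -> x \in h.
Proof.
move=> Hx; case: hC => hA hmax _.
rewrite -(hmax (h + <[x]>)%VS); first by rewrite memvE addvSr.
  have hx y : y \in h -> br y x = 0 by move=> yh; have := Hx (vsproj h y); rewrite vsprojK.
  move=> _ _ /memv_addP [u uh [_ /vlineP [k ->] ->]] /memv_addP [v vh [_ /vlineP [l ->] ->]].
  rewrite (brDl L) !(brDr L) hA // (brZr L) (hx u uh) scaler0 !add0r.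
  by rewrite (brZl L) (br_anti L x v) (hx v vh) oppr0 scaler0 add0r (brZl L) (brZr L)
    (br_self L) !scaler0.
exact: addvSl.
Qed.

Lemma joint_eigenbasis : exists P : 'M[K]_d, P \in unitmx /\
  forall y : subvs_of h, exists D : 'rV[K]_d,
    P *m ad br (vsval y) = diag_mx D *m P.
Proof.
case: (hC) => hA _ hD.
pose As := [seq ad br x | x <- vbasis h].
have /codiagonalizableP : {in As &, forall A B, comm_mx A B} /\ {in As, forall A, diagonalizable A}.
  split.
    move=> A B /mapP [x xh ->] /mapP [y yh ->].
    have := ad_bracket L x y; rewrite hA ?vbasis_mem // => /eqP.
    have -> : ad br 0 = 0.
      by apply: ad_ext => z; rewrite (mul_ad L) (br0l L) mulmx0.
    by rewrite eq_sym subr_eq0 => /eqP/esym.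
  by move=> A /mapP [x xh ->]; apply: hD; exact: vbasis_mem.
move=> [P Pu /allP HP]; exists P; split => // y.
have Hb x : x \in vbasis h -> exists D, P *m ad br x = diag_mx D *m P.
  move=> xh; have /HP : ad br x \in As by exact: map_f.
  by move=> /= /diagonalizable_forPex [D /(simmxP Pu)]; exists D.
have E := coord_vbasis (subvsP y).
have : exists D, P *m ad br (\sum_i coord (vbasis h) i (vsval y) *: (vbasis h)`_i) = diag_mx D *m P.
  elim/big_rec: _ => [|i x _ [D HD]].
    exists 0; have -> : ad br 0 = 0.
      by apply: ad_ext => z; rewrite (mul_ad L) (br0l L) mulmx0.
    by rewrite mulmx0 linear0 mul0mx.
  have [|D' HD'] := Hb (vbasis h)`_i; first by rewrite mem_nth // size_tuple.
  exists (coord (vbasis h) i (vsval y) *: D' + D).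
  by rewrite (ad_linear L) mulmxDr -scalemxAr HD HD' linearD linearZ mulmxDl -scalemxAl.
by rewrite -[\sum_i _]E.
Qed.

End RootBasis.

Section Roots.
Variables (K : numFieldType) (d : nat) (br : 'rV[K]_d -> 'rV[K]_d -> 'rV[K]_d).
Hypothesis L : ss_lie br.
Variable h : {vspace 'rV[K]_d}.
Hypothesis hC : cartan_subalgebra br h.
Variable P : 'M[K]_d.
Hypothesis Pu : P \in unitmx.
Hypothesis PD : forall y : subvs_of h, exists D : 'rV[K]_d,
    P *m ad br (vsval y) = diag_mx D *m P.
Local Notation hdual := (hdual h).
Implicit Types (y t : subvs_of h) (al l : hdual) (x : 'rV[K]_d).

Let beta_fun (i : 'I_d) (y : subvs_of h) : K^o := (P *m ad br (vsval y) *m invmx P) i i.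

Lemma beta_linear i : linear (beta_fun i).
Proof.
move=> k x y; rewrite /beta_fun linearP (ad_linear L) mulmxDr mulmxDl -scalemxAr -scalemxAl.
by rewrite !mxE.
Qed.

(** Rows of [P] with [beta i = 0] lie in the Cartan subalgebra, the others are root vectors; the
    root decomposition is handled through this finite list. *)
Definition beta i : hdual :=
  linfun (HB.pack (beta_fun i) (GRing.isLinear.Build _ _ _ _ _ (beta_linear i)) :
    {linear subvs_of h -> K^o}).

Lemma beta_eigen i y : br (vsval y) (row i P) = beta i y *: row i P.
Proof.
rewrite /beta lfunE /= /beta_fun; have [D HD] := PD y.
by rewrite HD mulmxK // mxE eqxx mulr1n -(mul_ad L) -row_mul HD row_mul row_diag_mx -scalemxAl -rowE.
Qed.

Local Notation co x i := ((x *m invmx P) 0 i).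

Lemma root_coord x : x = \sum_i co x i *: row i P.
Proof.
by rewrite -{1}(mulmxKV Pu x) mulmx_sum_row.
Qed.

Lemma co_row i j : co (row i P) j = (i == j)%:R.
Proof. by rewrite -row_mul mulmxV // !mxE. Qed.

Lemma row_neq0 i : row i P != 0.
Proof.
apply/eqP => r0; have := co_row i i; rewrite r0 mul0mx mxE eqxx => /eqP.
by rewrite eq_sym oner_eq0.
Qed.

Lemma coZ k x i : co (k *: x) i = k * co x i.
Proof. by rewrite -scalemxAl mxE. Qed.

Lemma br_coord y x : br (vsval y) x = \sum_i (beta i y * co x i) *: row i P.
Proof.
rewrite {1}(root_coord x) (br_sumr L); apply: eq_bigr => i _.
by rewrite (brZr L) beta_eigen scalerA mulrC.
Qed.

Lemma co_br y x i : co (br (vsval y) x) i = beta i y * co x i.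
Proof.
rewrite br_coord mulmx_suml summxE (bigD1 i) //= big1 ?addr0; last first.
  by move=> j ji; rewrite coZ co_row (negbTE ji) mulr0.
by rewrite coZ co_row eqxx mulr1.
Qed.

Lemma coP x z : (forall i, co x i = co z i) -> x = z.
Proof. by move=> H; rewrite (root_coord x) (root_coord z); apply: eq_bigr => i _; rewrite H. Qed.

Lemma co_neq0 x : x != 0 -> exists i, co x i != 0.
Proof.
move=> /eqP x0; apply/not_existsP => H; apply: x0; apply: coP => i.
by rewrite mul0mx [RHS]mxE; apply/eqP/negPn/negP; exact: H.
Qed.

Lemma root_vector_coord al x i : root_vector br al x -> co x i != 0 -> beta i = al.
Proof.
move=> Hx xi; apply/lfunP => y.
by have := congr1 (fun u => co u i) (Hx y); rewrite co_br coZ => /(mulIf xi).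
Qed.

Lemma row_root_vector i : root_vector br (beta i) (row i P).
Proof. by move=> y; exact: beta_eigen. Qed.

Lemma root_vectorD al x z : root_vector br al x -> root_vector br al z ->
  root_vector br al (x + z).
Proof. by move=> Hx Hz y; rewrite (brDr L) Hx Hz scalerDr. Qed.

Lemma root_vectorZ al x k : root_vector br al x -> root_vector br al (k *: x).
Proof. by move=> Hx y; rewrite (brZr L) Hx !scalerA mulrC. Qed.

Lemma is_rootP al : is_root br al <-> al != 0 /\ exists i, beta i = al.
Proof.
split=> [[a0 [x x0 Hx]]|[a0 [i Hi]]]; last first.
  by split=> //; exists (row i P); [exact: row_neq0 | rewrite -Hi; exact: row_root_vector].
split=> //; have [i xi] := co_neq0 x0.
by exists i; exact: root_vector_coord xi.
Qed.

Lemma root_vector0_mem x : root_vector br (0 : hdual) x -> x \in h.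
Proof.
move=> Hx; apply: (cartan_self_centralizing L hC) => y.
by rewrite Hx lfunE /= scale0r.
Qed.

Lemma mem_root_vector0 y : root_vector br (0 : hdual) (vsval y).
Proof. by move=> z; rewrite (cartan_abelian hC) lfunE /= scale0r. Qed.

Lemma br_root_vectors al ga x z : root_vector br al x -> root_vector br ga z ->
  root_vector br (al + ga) (br x z).
Proof.
move=> Hx Hz y.
have := ss_jacobi L (vsval y) x z; rewrite Hx Hz (brZl L) (brZr L) => /eqP.
by rewrite eq_sym subr_eq => /eqP ->; rewrite lfunE /= scalerDl.
Qed.

(** Moving [ad y] across the Killing form gives [(al + ga) y * killing br x z = 0] for all [y] in
    [h]. *)
Lemma killing_orthogonal al ga x z : root_vector br al x -> root_vector br ga z ->
  al + ga != 0 -> killing br x z = 0.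
Proof.
move=> Hx Hz ag0.
have E y : (al + ga) y * killing br x z = 0.
  have := killing_invariant L x (vsval y) z.
  rewrite (br_anti L x) Hx Hz (killingZr L) -scaleNr (killingZl L) => /eqP.
  rewrite mulNr eq_sym -subr_eq0 opprK -mulrDl => /eqP; rewrite lfunE /= addrC => <-.
  by [].
apply/eqP/negPn/negP => k0; move/eqP: ag0; apply; apply/lfunP => y.
have /eqP := E y; rewrite mulf_eq0 (negbTE k0) orbF => /eqP ->.
by rewrite lfunE.
Qed.

(** Root vectors are orthogonal to [h], so an element of [h] orthogonal to [h] is orthogonal to the
    whole algebra. *)
Lemma killing_cartan_nondeg y : (forall t, killing br (vsval y) (vsval t) = 0) -> y = 0.
Proof.
move=> Hy; apply: subvs_inj; rewrite linear0.
apply: (ss_nondeg L) => z; rewrite (root_coord z) (killing_sumr L) big1 // => i _.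
rewrite (killingZr L); have [bi|bi] := eqVneq (beta i) 0.
  have /vsprojK <- : row i P \in h.
    by apply: root_vector0_mem; rewrite -bi; exact: row_root_vector.
  by rewrite Hy mulr0.
by rewrite (killing_orthogonal (mem_root_vector0 y) (row_root_vector i)) ?mulr0 ?add0r.
Qed.

(** Extend [l] by 0 on the root vectors; the element representing this extension commutes with [h],
    hence belongs to it. *)
Lemma killing_dual_exists l : exists t, forall y, killing br (vsval t) (vsval y) = l y.
Proof.
pose phi j : K := if beta j == 0 then l (vsproj h (row j P)) else 0.
have [z zE] := killing_represents L (invmx P *m \col_j phi j).
have zb j : killing br z (row j P) = phi j.
  rewrite zE mulmxA mxE (bigD1 j) //= co_row eqxx mul1r mxE big1 ?addr0 // => i ij.
  by rewrite co_row eq_sym (negbTE ij) mul0r.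
have zh : z \in h.
  apply: (cartan_self_centralizing L hC) => y; apply: (ss_nondeg L) => x.
  rewrite (root_coord x) (killing_sumr L) big1 // => i _; rewrite (killingZr L).
  rewrite (br_anti L) -scaleN1r (killingZl L) (killing_invariant L) beta_eigen (killingZr L) zb /phi.
  by case: eqVneq => [->|_]; rewrite ?lfunE /= ?(mul0r, mulr0).
exists (vsproj h z) => y; rewrite vsprojK //.
have yE : y = \sum_(i | beta i == 0) co (vsval y) i *: vsproj h (row i P).
  apply: subvs_inj; rewrite linear_sum [LHS]root_coord (bigID (fun i => beta i == 0)) /=.
  rewrite [X in _ + X]big1 ?addr0.
    apply: eq_bigr => i /eqP bi. rewrite vsprojK //.
    by apply: root_vector0_mem; rewrite -bi; exact: row_root_vector.
  move=> i bi; have [->|ci] := eqVneq (co (vsval y) i) 0; first by rewrite scale0r.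
  by move: bi; rewrite (root_vector_coord (mem_root_vector0 y) ci) eqxx.
rewrite {2}yE linear_sum {1}(root_coord (vsval y)) (killing_sumr L) [RHS]big_mkcond /=.
apply: eq_bigr => i _; rewrite (killingZr L) zb /phi.
case: eqP => [bi|/eqP bi]; first by rewrite linearZ.
by rewrite mulr0.
Qed.

Lemma killing_dualP l y : killing br (vsval (killing_dual br l)) (vsval y) = l y.
Proof.
rewrite /killing_dual; case: xgetP => [t _ Ht|N]; first exact: Ht.
by have [t Ht] := killing_dual_exists l; case: (N t).
Qed.

Lemma dual_formE l al : dual_form br l al = l (killing_dual br al).
Proof. exact: killing_dualP. Qed.

(** Both sides lie in [h] and have the same Killing product with every element of [h]. *)
Lemma br_opposite al x z : root_vector br al x -> root_vector br (- al) z ->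
  br x z = killing br x z *: vsval (killing_dual br al).
Proof.
move=> Hx Hz.
have xzh : br x z \in h.
  by apply: root_vector0_mem; rewrite -[0](subrr al); exact: br_root_vectors.
rewrite -(vsprojK xzh) -linearZ; congr vsval; apply/eqP; rewrite -subr_eq0; apply/eqP.
apply: killing_cartan_nondeg => y; rewrite linearB linearZ /= vsprojK //.
rewrite scalerN -scaleNr addrC (killing_linear L) killing_dualP.
rewrite (killing_invariant L) (br_anti L z) Hz lfunE /= scaleNr opprK (killingZr L).
by rewrite mulNr mulrC addNr.
Qed.

Lemma opposite_root_vector al x : root_vector br al x -> x != 0 ->
  exists z, root_vector br (- al) z /\ killing br x z = 1.
Proof.
move=> Hx x0.
have [z Hz] : exists z, killing br x z != 0.
  apply/not_existsP => H; move/eqP: x0; apply; apply: (ss_nondeg L) => z.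
  by apply/eqP/negPn/negP; exact: H.
have [i Hi] : exists i, killing br x (row i P) != 0.
  apply/existsP; rewrite -negb_forall; apply/negP => /forallP H.
  move/negP: Hz; apply; rewrite (root_coord z) (killing_sumr L) big1 // => i _.
  by rewrite (killingZr L) (eqP (H i)) mulr0.
have bi : beta i = - al.
  apply/eqP; rewrite -addr_eq0 addrC; apply/negPn/negP => ab.
  by rewrite (killing_orthogonal Hx (row_root_vector i) ab) eqxx in Hi.
exists ((killing br x (row i P))^-1 *: row i P); split.
  by rewrite -bi; apply: root_vectorZ; exact: row_root_vector.
by rewrite (killingZr L) mulVf.
Qed.

(* [alpha (t_alpha) = 0] would make [ad t_alpha], a commutator of two matrices commuting with it,
   traceless on each of its eigenspaces, hence zero. *)
Lemma root_nonisotropic al : is_root br al -> al (killing_dual br al) != 0.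
Proof.
move=> [a0 [x x0 Hx]]; apply/negP => /eqP at0.
have [z [Hz xz1]] := opposite_root_vector Hx x0.
set t := killing_dual br al in at0.
have tE : br x z = vsval t by rewrite (br_opposite Hx Hz) xz1 scale1r.
have bt i : beta i t = 0.
  apply/eqP/negPn/negP => bt0.
  pose c := beta i t.
  (* The projection onto the eigenspace of [T] for [c]. It commutes with [X], so the trace of
     [E *m T] vanishes because [T] is a commutator with [X], while it also equals [c] times the
     dimension of the eigenspace. *)
  pose E := invmx P *m diag_mx (\row_j (beta j t == c)%:R) *m P.
  pose X := ad br x; pose Z := ad br z; pose T := ad br (vsval t).
  have TE : T = invmx P *m diag_mx (\row_j beta j t) *m P.
    apply: ad_ext => u; rewrite (mul_ad L); apply: coP => j.
    by rewrite co_br !mulmxA mulmxK // mul_mx_diag !mxE mulrC.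
  have XT : X *m T = T *m X.
    have := ad_bracket L (vsval t) x; rewrite Hx at0 scale0r.
    have -> : ad br 0 = 0 by apply: ad_ext => u; rewrite (mul_ad L) (br0l L) mulmx0.
    by move=> /esym/eqP; rewrite subr_eq0 => /eqP.
  have XE : X *m E = E *m X.
    pose X' := P *m X *m invmx P.
    have X'c j k : X' j k != 0 -> beta j t = beta k t.
      have : X' *m diag_mx (\row_j beta j t) = diag_mx (\row_j beta j t) *m X'.
        have -> : diag_mx (\row_j beta j t) = P *m T *m invmx P.
          by rewrite TE !mulmxA mulmxV // mul1mx mulmxK.
        by rewrite /X' !mulmxA !(mulmxKV Pu) -!(mulmxA P) XT.
      move=> /matrixP/(_ j k); rewrite mul_mx_diag mul_diag_mx !mxE => /eqP.
      rewrite mulrC => H X0; move: H; rewrite (inj_eq (mulIf _)) ?mxE //.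
      by move=> /eqP.
    have : X' *m diag_mx (\row_j (beta j t == c)%:R) = diag_mx (\row_j (beta j t == c)%:R) *m X'.
      apply/matrixP => j k; rewrite mul_mx_diag mul_diag_mx mxE [in RHS]mxE ![_ 0 _]mxE.
      have [->|X0] := eqVneq (X' j k) 0; first by rewrite mulr0 mul0r.
      by rewrite (X'c _ _ X0) mulrC.
    have conjM (A B : 'M[K]_d) : (invmx P *m A *m P) *m (invmx P *m B *m P) =
        invmx P *m (A *m B) *m P by rewrite !mulmxA mulmxK.
    have XX : X = invmx P *m X' *m P by rewrite /X' !mulmxA mulVmx // mul1mx mulmxKV.
    by move=> H; rewrite XX /E !conjM H.
  have trT : \tr (E *m T) = 0.
    have -> : T = Z *m X - X *m Z by rewrite /T -tE (ad_bracket L).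
    rewrite mulmxBr linearB /= !mulmxA -XE -(mulmxA X) [\tr (X *m _)]mxtrace_mulC.
    by rewrite subrr.
  have : \tr (E *m T) = c *+ #|[pred j | beta j t == c]|.
    rewrite TE /E !mulmxA mulmxK // mxtrace_mulC !mulmxA mulmxV // mul1mx.
    rewrite -sumr_const big_mkcond; apply: eq_bigr => j _.
    rewrite mul_diag_mx !mxE eqxx mulr1n inE.
    by case: eqP => [->|_]; rewrite ?mul1r ?mul0r.
  rewrite trT => /esym/eqP; rewrite mulrn_eq0 (negbTE bt0) orbF => /eqP.
  by move=> /card0_eq/(_ i); rewrite inE eqxx.
have t0 : t = 0.
  apply: subvs_inj; rewrite linear0; apply: (ad_injective L); apply: ad_ext => u.
  rewrite (mul_ad L) mulmx0; apply: coP => j.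
  by rewrite co_br bt mul0r mul0mx mxE.
move/eqP: a0; apply; apply/lfunP => y.
by rewrite -killing_dualP -/t t0 linear0 (killing0l L) lfunE.
Qed.

Definition coroot al : subvs_of h :=
  (2%:R / al (killing_dual br al)) *: killing_dual br al.

Lemma coroot_cartan_integer l al : l (coroot al) = cartan_integer br l al.
Proof.
rewrite /coroot linearZ /cartan_integer !dual_formE.
by rewrite [LHS]mulrAC.
Qed.

Lemma coroot2 al : is_root br al -> al (coroot al) = 2%:R.
Proof.
by move=> /root_nonisotropic ra; rewrite coroot_cartan_integer /cartan_integer dual_formE mulfK.
Qed.

Lemma killing_dualN al : killing_dual br (- al) = - killing_dual br al.
Proof.
apply/eqP; rewrite -subr_eq0 opprK; apply/eqP; apply: killing_cartan_nondeg => y.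
by rewrite linearD /= (killingDl L) !killing_dualP lfunE /= addNr.
Qed.

Lemma corootN al : coroot (- al) = - coroot al.
Proof.
rewrite /coroot killing_dualN scalerN; congr (- (_ / _ *: _)).
by rewrite opp_lfunE linearN opprK.
Qed.

Definition sl2_pair al (ef : 'rV[K]_d * 'rV[K]_d) : Prop :=
  [/\ root_vector br al ef.1, root_vector br (- al) ef.2 &
      br ef.1 ef.2 = vsval (coroot al)].

Lemma sl2_pair_exists al x : is_root br al -> root_vector br al x -> x != 0 ->
  exists z, sl2_pair al (x, z).
Proof.
move=> ra Hx x0; have [z [Hz xz1]] := opposite_root_vector Hx x0.
exists ((2%:R / al (killing_dual br al)) *: z); split => //=; first exact: root_vectorZ.
by rewrite (brZr L) (br_opposite Hx Hz) xz1 scale1r.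
Qed.

Lemma is_rootN al : is_root br al -> is_root br (- al).
Proof.
move=> [a0 [x x0 Hx]]; split; first by rewrite oppr_eq0.
have [z [Hz xz1]] := opposite_root_vector Hx x0; exists z => //.
apply/eqP => z0; move/eqP: xz1; rewrite z0 (killingC br) (killing0l L) eq_sym oner_eq0.
by [].
Qed.

Lemma ad_coroot_spec al (c : K) x : x != 0 -> br (vsval (coroot al)) x = c *: x ->
  c \in [seq beta i (coroot al) | i : 'I_d].
Proof.
move=> x0 Hx; have [i xi] := co_neq0 x0.
have := congr1 (fun u => co u i) Hx; rewrite co_br coZ => E; have <- := mulIf xi E; apply: map_f; exact: mem_enum.
Qed.

Let adl x : {linear 'rV[K]_d -> 'rV[K]_d} :=
  HB.pack (br x) (GRing.isLinear.Build _ _ _ _ _ (ss_linr L x)).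

(* A root vector killed by [ad f] would be a lowest weight vector of weight [2 > 0]. *)
Lemma root_space_dim1 al x z : is_root br al -> root_vector br al x -> x != 0 ->
  root_vector br al z -> exists k, z = k *: x.
Proof.
move=> ra Hx x0 Hz; have [f [_ Hf' ef']] := sl2_pair_exists ra Hx x0.
have Hf : root_vector br (- al) f := Hf'.
have ef : br x f = vsval (coroot al) := ef'.
have kxf : killing br x f != 0.
  apply/eqP => k0; have := coroot2 ra.
  have -> : coroot al = 0.
    by apply: subvs_inj; rewrite -ef (br_opposite Hx Hf) k0 scale0r linear0.
  by rewrite linear0 => /eqP; rewrite eq_sym pnatr_eq0.
(* This choice makes [z - k *: x] orthogonal to [f], so that it commutes with [f]. *)
pose k := killing br z f / killing br x f; exists k; apply/eqP; rewrite -subr_eq0.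
set u := z - k *: x; apply/negPn/negP => u0.
have Hu : root_vector br al u.
  by apply: root_vectorD => //; rewrite -scaleNr; exact: root_vectorZ.
have uf : br u f = 0.
  rewrite (br_opposite Hu Hf) /u addrC -scaleNr (killing_linear L) mulNr /k mulfVK //.
  by rewrite addNr scale0r.
have fu : br f u = 0 by rewrite (br_anti L) uf oppr0.
have HH v : br (vsval (coroot al)) v = br x (br f v) - br f (br x v).
  by rewrite -ef (ss_jacobi L).
have HE v : br (vsval (coroot al)) (br x v) = br x (br (vsval (coroot al)) v) + 2%:R *: br x v.
  have := ss_jacobi L (vsval (coroot al)) x v; rewrite Hx (coroot2 ra) (brZl L).
  by move=> /esym/eqP; rewrite subr_eq addrC => /eqP.
have uh : br (vsval (coroot al)) u = 2%:R *: u by rewrite Hu (coroot2 ra).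
have [j jE _] := @lowest_weight_string K _ (adl x) (adl f) (adl (vsval (coroot al)))
  [seq beta i (coroot al) | i : 'I_d] (fun v => esym (HH v)) HE (@ad_coroot_spec al) _ u u0 uh fu.
have : (2 + j)%:R == 0 :> K by rewrite natrD jE addNr.
by rewrite pnatr_eq0.
Qed.

End Roots.
#[global] Opaque coroot.

(** * Weights of an irreducible representation *)

Section WeightBasis.
Variables (K : numFieldType) (d : nat) (br : 'rV[K]_d -> 'rV[K]_d -> 'rV[K]_d).
Hypothesis L : ss_lie br.
Variable h : {vspace 'rV[K]_d}.
Hypothesis hC : cartan_subalgebra br h.
Variable P : 'M[K]_d.
Hypothesis Pu : P \in unitmx.
Hypothesis PD : forall y : subvs_of h, exists D : 'rV[K]_d,
    P *m ad br (vsval y) = diag_mx D *m P.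
Local Notation hdual := (hdual h).
Variables (m : nat) (f : 'rV[K]_d -> 'M[K]_m).
Hypothesis f_lin : linear f.
Hypothesis f_br : forall x y, f (br x y) = f x *m f y - f y *m f x.
Hypothesis f_irr : forall W : {vspace 'cV[K]_m},
  (forall x v, v \in W -> f x *m v \in W) -> W = 0%VS \/ W = fullv.
Implicit Types (y t : subvs_of h) (al l : hdual) (x : 'rV[K]_d) (v w : 'cV[K]_m).

Let fl : {linear 'rV[K]_d -> 'M[K]_m} :=
  HB.pack f (GRing.isLinear.Build _ _ _ _ f f_lin).

Lemma rep_sum (I : Type) (r : seq I) (Q : pred I) (g : I -> 'rV[K]_d) :
  f (\sum_(i <- r | Q i) g i) = \sum_(i <- r | Q i) f (g i).
Proof. exact: (linear_sum fl). Qed.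

Lemma repZ k x : f (k *: x) = k *: f x.
Proof. exact: (linearZZ fl). Qed.

Lemma rep_coord x : f x = \sum_i (x *m invmx P) 0 i *: f (row i P).
Proof. by rewrite {1}(root_coord Pu x) rep_sum; apply: eq_bigr => i _; rewrite repZ. Qed.

Lemma invariant_of_rows (W : {vspace 'cV[K]_m}) :
  (forall i v, v \in W -> f (row i P) *m v \in W) ->
  forall x v, v \in W -> f x *m v \in W.
Proof.
move=> H x v vW; rewrite rep_coord mulmx_suml memv_suml // => i _.
by rewrite -scalemxAl memvZ // H.
Qed.

Lemma rep_raise al l x v : root_vector br al x -> weight_vector f l v ->
  weight_vector f (l + al) (f x *m v).
Proof.
move=> Hx Hv y; have := f_br (vsval y) x; rewrite Hx repZ => /esym/eqP.
rewrite subr_eq => /eqP E; rewrite mulmxA E mulmxDl -mulmxA Hv -scalemxAl -scalemxAr.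
by rewrite -scalerDl add_lfunE addrC.
Qed.

(** The span of a maximal free family of weight vectors contains every weight vector, so it is
    invariant under the root vectors and, being nonzero, is everything. *)
Lemma weight_basis_exists l v : v != 0 -> weight_vector f l v ->
  exists n (s : n.-tuple 'cV[K]_m), basis_of fullv s /\
    forall j : 'I_n, exists l, weight_vector f l s`_j.
Proof.
move=> v0 Hv.
pose good n := `[< exists s : n.-tuple 'cV[K]_m, free s /\
    forall j : 'I_n, exists l, weight_vector f l s`_j >].
have g0 : exists n, good n.
  by exists 0%N; apply/asboolP; exists [tuple]; split; [exact: nil_free | case].
have gb n : good n -> (n <= \dim {: 'cV[K]_m})%N.
  move=> /asboolP [s [fs _]]; rewrite -[n](size_tuple s).
  by move: fs; rewrite /free => /eqP <-; exact: dimvS (subvf _).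
have [n /asboolP [s [fs ws]] nmax] := ex_maxnP g0 gb.
have inU l' w : weight_vector f l' w -> w \in (span s).
  move=> Hw; apply/negPn/negP => wU.
  suff : (n.+1 <= n)%N by rewrite ltnn.
  apply: nmax; apply/asboolP; exists [tuple of w :: s]; split.
    by rewrite /= free_cons wU.
  move=> j; case: (unliftP ord0 j) => [j' ->|->]; first exact: ws.
  by exists l'.
have sf : (span s) = fullv.
  have [|s0|//] := f_irr (W := (span s)).
    apply: invariant_of_rows => i w /coord_span ->.
    rewrite mulmx_sumr memv_suml // => j _.
    rewrite -scalemxAr memvZ //; have [l' Hl] := ws j.
    apply: inU; exact: rep_raise (beta_eigen L Pu PD i) Hl.
  by have := inU _ _ Hv; rewrite s0 memv0 (negbTE v0).
by exists n, s; split=> //; rewrite /basis_of sf eqxx fs.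
Qed.

End WeightBasis.

Section WeightStrings.
Variables (K : numFieldType) (d : nat) (br : 'rV[K]_d -> 'rV[K]_d -> 'rV[K]_d).
Hypothesis L : ss_lie br.
Variable h : {vspace 'rV[K]_d}.
Hypothesis hC : cartan_subalgebra br h.
Variable P : 'M[K]_d.
Hypothesis Pu : P \in unitmx.
Hypothesis PD : forall y : subvs_of h, exists D : 'rV[K]_d,
    P *m ad br (vsval y) = diag_mx D *m P.
Local Notation hdual := (hdual h).
Local Notation coroot := (coroot br).
Variables (m : nat) (f : 'rV[K]_d -> 'M[K]_m).
Hypothesis f_lin : linear f.
Hypothesis f_br : forall x y, f (br x y) = f x *m f y - f y *m f x.
Variables (n : nat) (s : n.-tuple 'cV[K]_m) (mu : 'I_n -> hdual).
Hypothesis s_basis : basis_of fullv s.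
Hypothesis s_weight : forall j, weight_vector f (mu j) s`_j.
Implicit Types (y t : subvs_of h) (al l : hdual) (x : 'rV[K]_d) (v w : 'cV[K]_m).

(** Membership in the weight lattice is left out, since [weight_in_lattice] recovers it. *)
Definition is_weight l := exists2 v, v != 0 & weight_vector f l v.

Lemma weight_coord v : v = \sum_j coord s j v *: s`_j.
Proof. exact: (coord_basis s_basis (memvf v)). Qed.

Lemma coord_weight y v j : coord s j (f (vsval y) *m v) = mu j y * coord s j v.
Proof.
rewrite {1}(weight_coord v) mulmx_sumr.
have -> : \sum_i f (vsval y) *m (coord s i v *: s`_i) = \sum_i (mu i y * coord s i v) *: s`_i.
  by apply: eq_bigr => i _; rewrite -scalemxAr s_weight scalerA mulrC.
by rewrite coord_sum_free // (basis_free s_basis).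
Qed.

Lemma weight_vector_coord l v j : weight_vector f l v -> coord s j v != 0 -> mu j = l.
Proof.
move=> Hv vj; apply/lfunP => y.
by have := congr1 (coord s j) (Hv y); rewrite coord_weight linearZ => /(mulIf vj).
Qed.

Lemma s_neq0 (j : 'I_n) : s`_j != 0.
Proof. by apply: (free_not0 (basis_free s_basis)); rewrite mem_nth // size_tuple. Qed.

Lemma coord_neq0 v : v != 0 -> exists j, coord s j v != 0.
Proof.
move=> /eqP v0; apply/not_existsP => H; apply: v0; rewrite (weight_coord v) big1 // => j _.
by have /negP/negPn/eqP -> := H j; rewrite scale0r.
Qed.

Lemma is_weightP l : is_weight l <-> exists j, mu j = l.
Proof.
split=> [[v v0 Hv]|[j <-]]; last by exists s`_j; [exact: s_neq0 | exact: s_weight].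
by have [j vj] := coord_neq0 v0; exists j; exact: weight_vector_coord vj.
Qed.

(** An arrow from the weight [l] to the weight [l + al]. *)
Definition edge al l := exists x v, [/\ root_vector br al x, weight_vector f l v & f x *m v != 0].

Lemma edge_weight al l : edge al l -> is_weight l.
Proof.
move=> [x [v [Hx Hv xv]]]; exists v => //; apply/eqP => v0.
by rewrite v0 mulmx0 eqxx in xv.
Qed.

Lemma edge_weightD al l : edge al l -> is_weight (l + al).
Proof.
by move=> [x [v [Hx Hv xv]]]; exists (f x *m v) => //; exact: rep_raise Hx Hv.
Qed.

Lemma coroot_spec al (c : K) v : v != 0 -> f (vsval (coroot al)) *m v = c *: v ->
  c \in [seq mu j (coroot al) | j : 'I_n].
Proof.
move=> v0 Hv; have [j vj] := coord_neq0 v0.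
have := congr1 (coord s j) Hv; rewrite coord_weight [RHS]linearZ => E; have <- := mulIf vj E.
by apply: map_f; exact: mem_enum.
Qed.

Let act x : {linear 'cV[K]_m -> 'cV[K]_m} := mulmx (f x).

(** The string starts at a lowest weight vector of weight [l - N al], obtained by [N] lowerings;
    raising it [k] times in succession stays nonzero, and each raise is an edge. *)
Lemma root_string al l : is_root br al -> is_weight l ->
  exists N k : nat, l (coroot al) = (2 * N)%:R - k%:R /\
    forall j, (j < k)%N -> edge al (l + j%:R *: al - N%:R *: al).
Proof.
move=> ra [v v0 Hv]; have [x x0 Hx] := ra.2.
have [f0 [_ Hf' ef']] := sl2_pair_exists L hC Pu PD ra Hx x0.
have Hf : root_vector br (- al) f0 := Hf'.
have ef : br x f0 = vsval (coroot al) := ef'.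
have EF w : act x (act f0 w) - act f0 (act x w) = act (vsval (coroot al)) w.
  by rewrite /act /= -ef f_br mulmxBl !mulmxA.
have HE w : act (vsval (coroot al)) (act x w) =
    act x (act (vsval (coroot al)) w) + 2%:R *: act x w.
  rewrite /act /=; have := f_br (vsval (coroot al)) x.
  rewrite Hx (coroot2 L hC Pu PD ra) (repZ f_lin) => /esym/eqP; rewrite subr_eq => /eqP E.
  by rewrite mulmxA E mulmxDl -scalemxAl mulmxA addrC.
have HF w : act (vsval (coroot al)) (act f0 w) =
    act f0 (act (vsval (coroot al)) w) - 2%:R *: act f0 w.
  rewrite /act /=; have := f_br (vsval (coroot al)) f0.
  rewrite Hf opp_lfunE (coroot2 L hC Pu PD ra) (repZ f_lin) => /esym/eqP; rewrite subr_eq => /eqP E.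
  by rewrite mulmxA E mulmxDl scaleNr mulNmx -scalemxAl mulmxA addrC.
have [N [k [u [u0 uE cE ku]]]] := weight_string EF HE HF (@coroot_spec al) v0 (Hv (coroot al)).
exists N, k; split=> // j jk.
have Hu : weight_vector f (l - N%:R *: al) u.
  rewrite uE; elim: (N) => [|N' IH]; first by rewrite scale0r subr0.
  rewrite iterS; have -> : l - N'.+1%:R *: al = l - N'%:R *: al - al.
    by rewrite -(addn1 N') natrD scalerDl scale1r opprD addrA.
  exact: rep_raise Hf IH.
have Huj i : weight_vector f (l - N%:R *: al + i%:R *: al) (iter i (act x) u).
  elim: i => [|i IH]; first by rewrite scale0r addr0.
  rewrite iterS -(addn1 i) natrD scalerDl scale1r addrA; exact: rep_raise Hx IH.
exists x, (iter j (act x) u); split=> //; first by rewrite addrAC.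
exact: (ku j.+1 jk).
Qed.

Lemma weight_integral al l : is_root br al -> is_weight l ->
  exists z : int, l (coroot al) = z%:~R.
Proof.
move=> ra wl; have [N [k [-> _]]] := root_string ra wl.
by exists ((2 * N)%:Z - k%:Z); rewrite rmorphB.
Qed.

Lemma weight_in_lattice l : is_weight l -> weight_lattice br l.
Proof.
by move=> wl al ra; rewrite -(coroot_cartan_integer L hC Pu PD); exact: weight_integral.
Qed.

Lemma negative_string al l (p : nat) : is_root br al -> is_weight l ->
  l (coroot al) = - p%:R -> forall i, (i < p)%N -> edge al (l + i%:R *: al).
Proof.
move=> ra wl lp i ip; have [N [k [E H]]] := root_string ra wl.
(* A string of [2 N + p] raises from [l - N al] passes [l] after [N] of them, leaving at least
   [p]. *)
have kE : k = (2 * N + p)%N.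
  apply/eqP; rewrite -(eqr_nat K) natrD.
  by move/eqP: E; rewrite lp eq_sym subr_eq addrC -subr_eq opprK eq_sym.
have -> : l + i%:R *: al = l + (N + i)%:R *: al - N%:R *: al.
  by rewrite natrD scalerDl [_ *: al + _]addrC addrA addrK.
by apply: H; rewrite kE mul2n -addnn -addnA ltn_add2l ltn_addl.
Qed.

End WeightStrings.

(** * Weight combinatorics from [edge_pair] and [wt_opp] *)

Section SymmetricWeights.
Variables (K : numFieldType) (d : nat) (br : 'rV[K]_d -> 'rV[K]_d -> 'rV[K]_d).
Hypothesis L : ss_lie br.
Variable h : {vspace 'rV[K]_d}.
Hypothesis hC : cartan_subalgebra br h.
Variable P : 'M[K]_d.
Hypothesis Pu : P \in unitmx.
Hypothesis PD : forall y : subvs_of h, exists D : 'rV[K]_d,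
    P *m ad br (vsval y) = diag_mx D *m P.
Local Notation hdual := (hdual h).
Local Notation beta := (beta L h P).
Local Notation coroot := (coroot br).
Variables (m : nat) (f : 'rV[K]_d -> 'M[K]_m).
Hypothesis f_lin : linear f.
Hypothesis f_br : forall x y, f (br x y) = f x *m f y - f y *m f x.
Hypothesis f_irr : forall W : {vspace 'cV[K]_m},
  (forall x v, v \in W -> f x *m v \in W) -> W = 0%VS \/ W = fullv.
Variables (n : nat) (s : n.-tuple 'cV[K]_m) (mu : 'I_n -> hdual).
Hypothesis s_basis : basis_of fullv s.
Hypothesis s_weight : forall j, weight_vector f (mu j) s`_j.
Local Notation wt := (is_weight (h := h) f).
Local Notation edge := (edge (h := h) br f).
Local Notation root := (is_root (h := h) br).
Hypothesis edge_pair : forall al l l', root al -> edge al l -> edge al l' ->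
  l' = l \/ l' = - l - al.
Hypothesis wt_opp : forall l, wt l -> wt (- l).
Implicit Types (y t : subvs_of h) (al l : hdual) (x : 'rV[K]_d) (v w : 'cV[K]_m).

Definition pairing l al : K := l (coroot al).
Local Notation pr := pairing.

Lemma pairing0 al : pr 0 al = 0.
Proof. by rewrite /pairing zero_lfunE. Qed.

Lemma pairingD l l' al : pr (l + l') al = pr l al + pr l' al.
Proof. by rewrite /pairing add_lfunE. Qed.

Lemma pairingN l al : pr (- l) al = - pr l al.
Proof. by rewrite /pairing opp_lfunE. Qed.

Lemma pairingZ k l al : pr (k *: l) al = k * pr l al.
Proof. by rewrite /pairing scale_lfunE. Qed.

Lemma pairing_opp_root l al : pr l (- al) = - pr l al.
Proof. by rewrite /pairing (corootN L hC Pu PD) linearN. Qed.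

Lemma pairing_self al : root al -> pr al al = 2%:R.
Proof. by move=> ra; rewrite /pairing (coroot2 L hC Pu PD ra). Qed.

Lemma pairing_int al l : root al -> wt l -> exists z : int, pr l al = z%:~R.
Proof. exact: (weight_integral L hC Pu PD f_lin f_br s_basis s_weight). Qed.

Lemma pairing_string al l (p : nat) : root al -> wt l -> pr l al = - p%:R ->
  forall i, (i < p)%N -> edge al (l + i%:R *: al).
Proof. exact: (negative_string L hC Pu PD f_lin f_br s_basis s_weight). Qed.

Definition refl al l : hdual := l - pr l al *: al.

Lemma reflE al l : refl al l = root_reflection br al l.
Proof. by rewrite /refl /pairing (coroot_cartan_integer L hC Pu PD). Qed.

Lemma double_eq0 l : l + l = 0 -> l = 0.
Proof.
by move=> /eqP; rewrite -mulr2n -scaler_nat scaler_eq0 pnatr_eq0 /= => /eqP.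
Qed.

Lemma opp_eq_self l : - l = l -> l = 0.
Proof. by move=> E; apply: double_eq0; rewrite -[X in X + _]E addNr. Qed.

Lemma refl_coroot al l : root al -> pr (refl al l) al = - pr l al.
Proof.
move=> ra; rewrite /refl pairingD pairingN pairingZ (pairing_self ra); ring.
Qed.

Lemma reflK al l : root al -> refl al (refl al l) = l.
Proof. by move=> ra; rewrite {1}/refl refl_coroot // scaleNr opprK /refl subrK. Qed.

Lemma refl_neg al l : refl (- al) l = refl al l.
Proof. by rewrite /refl pairing_opp_root scaleNr scalerN opprK. Qed.

Lemma refl_opp al l : refl al (- l) = - refl al l.
Proof. by rewrite /refl pairingN scaleNr opprB opprK addrC. Qed.

Lemma refl_self al : root al -> refl al al = - al.
Proof.
by move=> ra; rewrite /refl (pairing_self ra) scaler_nat mulr2n opprD addrA subrr sub0r.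
Qed.

Lemma refl_orth al l : pr l al = 0 -> refl al l = l.
Proof. by rewrite /refl => ->; rewrite scale0r subr0. Qed.

Lemma refl_neq0 al l : root al -> l != 0 -> refl al l != 0.
Proof.
move=> ra; apply: contraNneq => r0; rewrite -(reflK l ra) r0 /refl.
by rewrite pairing0 scale0r subr0.
Qed.

(** Two consecutive edges for the same root start at [l] and [l + al]; [edge_pair] then leaves only
    [l + al = - (l + al)]. *)
Lemma edge_sum_neq0 al l : root al -> edge al l -> l + al != 0 -> edge al (l + al) -> l + al = 0.
Proof.
move=> ra e1 n0 e2; have [] := edge_pair ra e1 e2.
  move=> /eqP; rewrite -subr_eq0 addrAC subrr add0r => /eqP a0.
  by case: ra; rewrite a0 eqxx.
move=> E; apply: double_eq0; rewrite {1}E -opprD; exact: addNr.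
Qed.

(** A pairing of -2 or less yields edges at both [l] and [l + al], which forces [l = - al]. *)
Lemma negative_cases al l (p : nat) : root al -> wt l -> pr l al = - p.+1%:R ->
  p = 0%N \/ l = - al.
Proof.
move=> ra wl lp; case: p lp => [|p] lp; [by left | right].
have H := pairing_string ra wl lp.
have := H 0%N isT; have := H 1%N isT; rewrite scale0r scale1r addr0 => e2 e1.
have [l0|n0] := eqVneq (l + al) 0; first by apply/eqP; rewrite -addr_eq0 l0.
by apply/eqP; rewrite -addr_eq0 (edge_sum_neq0 ra e1 n0 e2).
Qed.

Lemma integral_cases al l : root al -> wt l ->
  pr l al = 0 \/ exists p : nat,
    pr l al = - p.+1%:R \/ pr l (- al) = - p.+1%:R.
Proof.
move=> ra wl; have [z zE] := pairing_int ra wl.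
case: z zE => [[|p]|p] zE; first by left.
  right; exists p; right; by rewrite pairing_opp_root zE.
by right; exists p; left; rewrite zE NegzE rmorphN.
Qed.

(** Either the pairing is -1 and the reflection is the endpoint [l + al] of an edge, or [l = - al]
    and the reflection is [- l], a weight by [wt_opp]. *)
Lemma wt_refl_neg al l (p : nat) : root al -> wt l -> pr l al = - p.+1%:R -> wt (refl al l).
Proof.
move=> ra wl lp; have [p0|lE] := negative_cases ra wl lp; last first.
  have -> : refl al l = - l by rewrite lE refl_opp refl_self.
  exact: wt_opp.
have H := pairing_string ra wl lp.
have e1 := H 0%N isT; rewrite scale0r addr0 in e1.
rewrite /refl lp p0 scaleNr opprK scale1r; exact: (edge_weightD f_lin f_br e1).
Qed.

Lemma wt_refl al l : root al -> wt l -> wt (refl al l).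
Proof.
move=> ra wl; have [l0|[p [lp|lp]]] := integral_cases ra wl.
- by rewrite refl_orth.
- exact: wt_refl_neg lp.
- by rewrite -refl_neg; apply: wt_refl_neg lp => //; exact: (is_rootN L Pu PD).
Qed.

(** A nonnegative pairing of [l] would give [l + al] a pairing of at least 2 with [al], which by
    [negative_cases] for [- al] means [l + al = al]. So the pairing is negative, and it is -1
    because [l] is not [- al]. *)
Lemma edge_refl al l : root al -> edge al l -> l != 0 -> l + al != 0 -> l + al = refl al l.
Proof.
move=> ra e1 l0 la0.
have wl := edge_weight e1; have wla := edge_weightD f_lin f_br e1.
have rna : root (- al) := is_rootN L Pu PD ra.
have [z zE] := pairing_int ra wl.
have big (q : nat) : pr l al = q%:R -> l + al = refl al l.
  move=> lq; have E : pr (l + al) (- al) = - q.+2%:R.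
    rewrite pairing_opp_root pairingD lq (pairing_self ra).
    by rewrite -natrD addn2.
  have [//|] := negative_cases rna wla E.
  rewrite opprK => /eqP; rewrite -subr_eq0 addrK => /eqP l00.
  by rewrite l00 eqxx in l0.
case: z zE => [q|q]; first exact: big.
rewrite NegzE rmorphN => lq; have [q0|lE] := negative_cases ra wl lq.
  by rewrite /refl lq q0 scaleNr scale1r opprK.
by rewrite lE addNr eqxx in la0.
Qed.

(** Negative pairings provide edges at [l] and [l'], to which [edge_pair] applies. In its second
    case [l = - al] would give [l' = 0], so the pairing of [l] is -1 and [l + al] is its
    reflection. *)
Lemma negative_pair al l l' (p q : nat) : root al -> wt l -> wt l' ->
  pr l al = - p.+1%:R -> pr l' al = - q.+1%:R -> l' = l \/ l' = - refl al l.
Proof.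
move=> ra wl wl' lp lq.
have H := pairing_string ra wl lp.
have H' := pairing_string ra wl' lq.
have e1 := H 0%N isT; have e2 := H' 0%N isT; rewrite scale0r addr0 in e1; rewrite scale0r addr0 in e2.
have [->|E] := edge_pair ra e1 e2; [by left | right].
have [p0|lE] := negative_cases ra wl lp.
  by rewrite E /refl lp p0 scaleNr scale1r opprK opprD.
exfalso; move: lq; rewrite E lE opprK subrr pairing0 => /eqP.
by rewrite eq_sym oppr_eq0 pnatr_eq0.
Qed.

(** Replacing weights by their opposites reduces to two negative pairings. *)
Lemma nonorthogonal_pair al l l' : root al -> wt l -> wt l' ->
  pr l al != 0 -> pr l' al != 0 ->
  [\/ l' = l, l' = - l, l' = refl al l | l' = - refl al l].
Proof.
have key l1 l2 (p : nat) : root al -> wt l1 -> wt l2 -> pr l1 al = - p.+1%:R ->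
    pr l2 al != 0 -> [\/ l2 = l1, l2 = - l1, l2 = refl al l1 | l2 = - refl al l1].
  move=> ra w1 w2 lp n2; have [l20|[q [lq|lq]]] := integral_cases ra w2.
  - by rewrite l20 eqxx in n2.
  - by have [->|->] := negative_pair ra w1 w2 lp lq; [constructor 1 | constructor 4].
  - have lq' : pr (- l2) al = - q.+1%:R.
      by rewrite -lq pairing_opp_root pairingN.
    have [E|E] := negative_pair ra w1 (wt_opp w2) lp lq'.
      by constructor 2; rewrite -E opprK.
    by constructor 3; rewrite -[l2]opprK E opprK.
move=> ra wl wl' n1 n2; have [l0|[p [lp|lp]]] := integral_cases ra wl.
- by rewrite l0 eqxx in n1.
- exact: key lp n2.
- have lp' : pr (- l) al = - p.+1%:R.
    by rewrite -lp pairing_opp_root pairingN.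
  have [->|->|->|->] := key _ _ _ ra (wt_opp wl) wl' lp' n2; rewrite ?opprK.
  + by constructor 2.
  + by constructor 1.
  + by constructor 4; rewrite refl_opp.
  + by constructor 3; rewrite refl_opp opprK.
Qed.

(** * The Weyl orbit of a nonzero weight *)

Section Orbit.
Variable om : hdual.
Hypothesis om_wt : wt om.
Hypothesis om0 : om != 0.
Local Notation Orb := (weyl_orbit br om).

Lemma orbit_refl al l : root al -> Orb l -> Orb (refl al l).
Proof.
move=> ra [w Ww ->]; rewrite reflE; exists (root_reflection br al \o w) => //.
exact: weyl_refl.
Qed.

Lemma orbit_self : Orb om.
Proof. by exists id => //; exact: weyl_id. Qed.

Lemma orbit_ind (Q : hdual -> Prop) : Q om ->
  (forall al l, root al -> Orb l -> Q l -> Q (refl al l)) -> forall l, Orb l -> Q l.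
Proof.
move=> Q0 Qs _ [w Ww ->]; suff : Orb (w om) /\ Q (w om) by case.
elim: Ww => [|al w' ra Ww' [HO HQ]]; first by split=> //; exact: orbit_self.
by split; rewrite /= -reflE; [exact: orbit_refl | exact: Qs].
Qed.

Lemma orbit_wt l : Orb l -> wt l.
Proof. by elim/orbit_ind => // al l' ra _; exact: wt_refl. Qed.

Lemma orbit_neq0 l : Orb l -> l != 0.
Proof. by elim/orbit_ind => // al l' ra _; exact: refl_neq0. Qed.

(* The sum of the weight spaces over the orbit and of the part of [V_0] they generate is
   invariant. *)
Lemma weights_orbit l : wt l -> l = 0 \/ Orb l.
Proof.
pose O : pred 'I_n := fun j => `[< Orb (mu j) >].
pose VO := (\sum_(j | O j) <[s`_j]>)%VS.
pose U := (VO + \sum_(i < d) \sum_(j | O j) <[f (row i P) *m s`_j]>)%VS.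
have inO j : Orb (mu j) -> O j by move=> Oj; apply/asboolP.
have Oin j : O j -> Orb (mu j) by move=> /asboolP.
have VOU : (VO <= U)%VS by exact: addvSl.
have sVO j : O j -> s`_j \in VO.
  move=> jO; rewrite /VO (bigD1 j jO) /=; apply: (subvP (addvSl _ _)); exact: memv_line.
have gU i j : O j -> f (row i P) *m s`_j \in U.
  move=> jO; apply: (subvP (addvSr _ _)); rewrite (bigD1 i) //=.
  apply: (subvP (addvSl _ _)); rewrite (bigD1 j jO) /=.
  apply: (subvP (addvSl _ _)); exact: memv_line.
have fU x j : O j -> f x *m s`_j \in U.
  move=> jO; rewrite (rep_coord Pu f_lin) mulmx_suml memv_suml // => i _.
  by rewrite -scalemxAl memvZ // gU.
have wU l' w : weight_vector f l' w -> Orb l' -> forall x, f x *m w \in U.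
  move=> Hw Ol x; rewrite (weight_coord s_basis w) mulmx_sumr memv_suml // => j _.
  rewrite -scalemxAr; have [->|wj] := eqVneq (coord s j w) 0; first by rewrite scale0r mem0v.
  by rewrite memvZ // fU // inO // (weight_vector_coord s_basis s_weight Hw wj).
have wU1 l' w : weight_vector f l' w -> Orb l' -> w \in U.
  move=> Hw Ol; rewrite (weight_coord s_basis w) memv_suml // => j _.
  have [->|wj] := eqVneq (coord s j w) 0; first by rewrite scale0r mem0v.
  rewrite memvZ // (subvP VOU) // sVO // inO //.
  by rewrite (weight_vector_coord s_basis s_weight Hw wj).
have beta_cases i : beta i = 0 \/ root (beta i).
  have [->|b0] := eqVneq (beta i) 0; [by left | right].
  by apply/(is_rootP L Pu PD); split=> //; exists i.
have rowP i : root_vector br (beta i) (row i P) := row_root_vector L Pu PD i.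
have row_act i l' w : weight_vector f l' w -> beta i = 0 -> exists k, f (row i P) *m w = k *: w.
  move=> Hw b0.
  have rh : row i P \in h by apply: (root_vector0_mem L hC); rewrite -b0; exact: rowP.
  by exists (l' (vsproj h (row i P))); rewrite -Hw vsprojK.
have orb_step i l' w : weight_vector f l' w -> Orb l' -> f (row i P) *m w != 0 ->
    l' + beta i = 0 \/ Orb (l' + beta i).
  move=> Hw Ol fw; have [b0|rb] := beta_cases i; first by rewrite b0 addr0; right.
  have [->|lb0] := eqVneq (l' + beta i) 0; [by left | right].
  have e1 : edge (beta i) l' by exists (row i P), w; split.
  by rewrite (edge_refl rb e1 (orbit_neq0 Ol) lb0); exact: orbit_refl.
have step2 k i l' w : weight_vector f l' w -> Orb l' ->
    f (row k P) *m (f (row i P) *m w) \in U.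
  move=> Hw Ol.
  have Hiw := rep_raise f_lin f_br (rowP i) Hw.
  have Hkw := rep_raise f_lin f_br (rowP k) Hw.
  have [b0|rb] := beta_cases i.
    have [q ->] := row_act i l' w Hw b0.
    by rewrite -scalemxAr memvZ // (wU l').
  have [iw0|iw0] := eqVneq (f (row i P) *m w) 0; first by rewrite iw0 mulmx0 mem0v.
  have [lb0|Ob] := orb_step i l' w Hw Ol iw0; last exact: wU Hiw Ob _.
  (* Here [f (row i P) *m w] has weight 0. Exchanging the two operators costs a bracket term, which
     acts on [w] and so stays in [U]. *)
  have comm : f (row k P) *m (f (row i P) *m w) =
      f (row i P) *m (f (row k P) *m w) + f (br (row k P) (row i P)) *m w.
    by rewrite f_br mulmxBl !mulmxA addrC subrK.
  have [kw0|kw0] := eqVneq (f (row k P) *m w) 0.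
    by rewrite comm kw0 mulmx0 add0r (wU l').
  have [lk0|Ok] := orb_step k l' w Hw Ol kw0; last first.
    by rewrite comm memvD //; [exact: wU Hkw Ok _ | exact: wU Hw Ol _].
  (* Both operators shift weights by [- l'], so the result has weight [- l'], the reflection of the
     root [l'] in itself. *)
  have bk : beta k = - l' by apply/eqP; rewrite -addr_eq0 addrC lk0.
  have Okk : Orb (l' + beta i + beta k).
    have rl' : root l'.
      rewrite -[l']opprK -bk; apply: (is_rootN L Pu PD).
      have [b0|//] := beta_cases k.
      by move: (orbit_neq0 Ol); rewrite -[l']opprK -bk b0 oppr0 eqxx.
    by rewrite lb0 add0r bk -(refl_self rl'); exact: orbit_refl.
  exact: wU1 (rep_raise f_lin f_br (rowP k) Hiw) Okk.
have Uinv k v : v \in U -> f (row k P) *m v \in U.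
  pose g : 'Hom('cV[K]_m, 'cV[K]_m) := linfun (mulmx (f (row k P))).
  have gE w : g w = f (row k P) *m w by rewrite lfunE.
  suff : (U <= g @^-1: U)%VS by move=> /subvP H /H; rewrite -memv_preim gE.
  rewrite subv_add; apply/andP; split.
    apply/subv_sumP => j jO.
    by rewrite -memvE -memv_preim gE gU.
  apply/subv_sumP => i _; apply/subv_sumP => j jO.
  by rewrite -memvE -memv_preim gE; exact: step2 (s_weight j) (Oin j jO).
have [U0|Ufull] := f_irr (invariant_of_rows Pu f_lin Uinv).
  have [j0 j0E] := (is_weightP s_basis s_weight om).1 om_wt.
  have := subvP VOU _ (sVO j0 (inO j0 _)); rewrite j0E => /(_ orbit_self).
  by rewrite U0 memv0 (negbTE (s_neq0 s_basis j0)).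
move=> wl; have [->|l0] := eqVneq l 0; [by left | right].
apply: contrapT => nOl.
have [j1 j1E] := (is_weightP s_basis s_weight l).1 wl.
(* The coordinate along a basis vector of nonzero weight outside the orbit vanishes on [U], although
   [U] is the whole space. *)
pose g : 'Hom('cV[K]_m, K^o) := linfun (coord s j1 : 'cV[K]_m -> K^o).
have gE w : g w = coord s j1 w by rewrite lfunE.
have : (U <= lker g)%VS.
  have nz l' w : weight_vector f l' w -> l' != l -> w \in lker g.
    move=> Hw; apply: contraR; rewrite memv_ker gE => wj.
    by rewrite -(weight_vector_coord s_basis s_weight Hw wj) j1E.
  rewrite subv_add; apply/andP; split.
    apply/subv_sumP => j jO.
    rewrite -memvE; apply: nz (s_weight j) _; apply/eqP => E; apply: nOl; rewrite -E; exact: Oin.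
  apply/subv_sumP => i _; apply/subv_sumP => j jO.
  rewrite -memvE; have [->|fs0] := eqVneq (f (row i P) *m s`_j) 0; first exact: mem0v.
  apply: nz (rep_raise f_lin f_br (rowP i) (s_weight j)) _; apply/eqP => E.
  have [E0|Ol] := orb_step i _ _ (s_weight j) (Oin j jO) fs0.
    by rewrite -E E0 eqxx in l0.
  by apply: nOl; rewrite -E.
move=> /subvP /(_ s`_j1); rewrite Ufull memvf memv_ker gE => /(_ isT) /eqP.
by rewrite coord_free ?(basis_free s_basis) // eqxx => /eqP; rewrite oner_eq0.
Qed.

Lemma orbit_opp l : Orb l -> Orb (- l).
Proof.
move=> Ol; have [/eqP|//] := weights_orbit (wt_opp (orbit_wt Ol)).
by rewrite oppr_eq0 (negbTE (orbit_neq0 Ol)).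
Qed.

Lemma orbit_neq_opp l : Orb l -> l != - l.
Proof.
move=> Ol; apply/eqP => E; move/eqP: (orbit_neq0 Ol); apply.
by apply: opp_eq_self; rewrite -E.
Qed.

(** One member of each pair of opposite weights is selected greedily from the finite list of weights
    in the orbit. Keeping [om] at the head makes it the first of the final enumeration. *)
Lemma orbit_representatives : exists r' : seq hdual, let r := om :: r' in
  [/\ forall l, l \in r -> Orb l, forall l, Orb l -> l \in r \/ - l \in r,
      uniq r & forall l l', l \in r -> l' \in r -> l != - l'].
Proof.
suff H : forall t : seq hdual, (forall l, l \in t -> Orb l) -> exists r' : seq hdual,
    let r := om :: r' in
  [/\ forall l, l \in r -> Orb l, forall l, l \in t -> l \in r \/ - l \in r,
      uniq r & forall l l', l \in r -> l' \in r -> l != - l'].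
  have [l|r' [r1 r2 r3 r4]] := H [seq mu j | j <- enum 'I_n & `[< Orb (mu j) >]].
    by move=> /mapP [j]; rewrite mem_filter => /andP [/asboolP Oj _] ->.
  exists r'; split=> // l Ol; apply: r2; have [j jE] := (is_weightP s_basis s_weight l).1 (orbit_wt Ol).
  apply/mapP; exists j => //; rewrite mem_filter mem_enum andbT.
  by apply/asboolP; rewrite jE.
elim=> [_|x t IH Ht].
  exists [::]; split=> //.
  - by move=> l; rewrite inE => /eqP ->; exact: orbit_self.
  - move=> l l'; rewrite !inE => /eqP -> /eqP ->; exact: orbit_neq_opp orbit_self.
have [l lt|r' [r1 r2 r3 r4]] := IH; first by apply: Ht; rewrite inE lt orbT.
have Ox : Orb x by apply: Ht; rewrite inE eqxx.
have [xr|xr] := boolP ((x \in om :: r') || (- x \in om :: r')).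
  exists r'; split=> // l; rewrite inE => /orP [/eqP ->|/r2 //].
  by apply/orP.
move: xr; rewrite negb_or => /andP [xr nxr].
have sub l : (l \in om :: x :: r') = (l == x) || (l \in om :: r').
  by rewrite !inE orbCA.
exists (x :: r'); split.
- by move=> l; rewrite sub => /orP [/eqP ->|/r1].
- move=> l; rewrite inE !sub => /orP [/eqP ->|/r2 [->|->]]; [by left; rewrite eqxx | |].
  + by left; rewrite orbT.
  + by right; rewrite orbT.
- move: r3 xr; rewrite /= !inE !negb_or => /andP [-> ->] /andP [xo ->].
  by rewrite eq_sym xo.
- move=> l l'; rewrite !sub => /orP [/eqP ->|lr] /orP [/eqP ->|lr'].
  + exact: orbit_neq_opp.
  + by apply: contra nxr => /eqP ->; rewrite opprK.
  + by apply: contra nxr => /eqP <-.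
  + exact: r4.
Qed.

Variable r' : seq hdual.
Let r := om :: r'.
Hypothesis r_orb : forall l, l \in r -> Orb l.
Hypothesis r_cover : forall l, Orb l -> l \in r \/ - l \in r.
Hypothesis r_uniq : uniq r.
Hypothesis r_opp : forall l l', l \in r -> l' \in r -> l != - l'.

(* The coefficients of a relation extend to an odd function on the orbit, which is constant by
   evaluation at the coroots, hence zero. *)
Lemma representatives_free : free r.
Proof.
rewrite -[r]/(tval (in_tuple r)); apply/freeP => k rel.
have rN (i : 'I_(size r)) : (in_tuple r)`_i \in r by rewrite mem_nth.
pose e (i : 'I_(size r)) : hdual := (in_tuple r)`_i.
pose ind (l l' : hdual) : K := (l == l')%:R.
(* The odd extension of the coefficients: [k i] at [e i], [- k i] at [- e i], and 0 elsewhere. *)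
pose C l : K := \sum_(i < size r) k i * (ind l (e i) - ind l (- e i)).
have CN l : C (- l) = - C l.
  rewrite /C -sumrN; apply: eq_bigr => i _; rewrite -mulrN opprB /ind.
  by rewrite eqr_oppLR (eqr_opp l).
have relp al : \sum_(i < size r) k i * pr (e i) al = 0.
  rewrite -[RHS](pairing0 al) -rel /pairing sum_lfunE; apply: eq_bigr => i _.
  by rewrite scale_lfunE.
have Crefl al l : root al -> Orb l -> C l = C om -> C (refl al l) = C om.
  move=> ra Ol <-; have [z0|z0] := eqVneq (pr l al) 0; first by rewrite refl_orth.
  have wl := orbit_wt Ol.
  have nz : l != - l := orbit_neq_opp Ol.
  have ri := refl_neq0 ra (orbit_neq0 Ol).
  have Or := orbit_refl ra Ol.
  have nl : refl al l != l.
    apply/eqP => E; have := refl_coroot l ra; rewrite E => /esym E2.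
    move/eqP: z0; apply; apply/eqP; have /eqP := E2; rewrite -subr_eq0 -opprD oppr_eq0.
    by rewrite -mulr2n mulrn_eq0.
  (* Since no other representative pairs nontrivially with [al], the relation evaluated at the
     coroot reduces to [pr l al * (C l - C (refl al l)) = 0], or to [pr l al * C l = 0] if the
     reflection is [- l]. *)
  have pick (i : 'I_(size r)) : pr (e i) al != 0 ->
      [\/ e i = l, e i = - l, e i = refl al l | e i = - refl al l].
    by move=> ne; apply: nonorthogonal_pair ne => //; apply: orbit_wt; apply: r_orb; exact: rN.
  have [E|NE] := eqVneq (refl al l) (- l).
    have Z : pr l al * C l = 0.
      rewrite -[RHS](relp al) /C mulr_sumr; apply: eq_bigr => i _.
      rewrite mulrCA; congr (_ * _); rewrite /ind.
      have [p0|p0] := eqVneq (pr (e i) al) 0.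
        have -> : (l == e i) = false by apply: contraNF z0 => /eqP ->; rewrite p0.
        have -> : (l == - e i) = false.
          by apply: contraNF z0 => /eqP ->; rewrite pairingN p0 oppr0.
        by rewrite p0 subrr mulr0.
      have [->|->|->|->] := pick i p0; rewrite ?E ?opprK ?pairingN ?eqxx ?(negbTE nz);
        by rewrite ?subr0 ?sub0r ?mulr1 ?mulrN1.
    by rewrite E CN; move/eqP: Z; rewrite mulf_eq0 (negbTE z0) /= => /eqP ->; rewrite oppr0.
  have NE2 : (- refl al l == l) = false by rewrite eqr_oppLR (negbTE NE).
  have Z : pr l al * (C l - C (refl al l)) = 0.
    rewrite -[RHS](relp al) /C -sumrB mulr_sumr; apply: eq_bigr => i _.
    rewrite -mulrBr mulrCA; congr (_ * _); rewrite /ind.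
    have rr := refl_coroot l ra.
    have [p0|p0] := eqVneq (pr (e i) al) 0.
      have nz' : pr (refl al l) al != 0 by rewrite rr oppr_eq0.
      have -> : (l == e i) = false by apply: contraNF z0 => /eqP ->; rewrite p0.
      have -> : (l == - e i) = false.
        by apply: contraNF z0 => /eqP ->; rewrite pairingN p0 oppr0.
      have -> : (refl al l == e i) = false by apply: contraNF nz' => /eqP ->; rewrite p0.
      have -> : (refl al l == - e i) = false.
        by apply: contraNF nz' => /eqP ->; rewrite pairingN p0 oppr0.
      by rewrite p0 !subrr mulr0.
    have nr : refl al l != - refl al l := orbit_neq_opp Or.
    have [->|->|->|->] := pick i p0; rewrite ?opprK ?pairingN ?rr ?eqxx ?(negbTE nz) ?(negbTE nl)
      ?(negbTE NE) ?(negbTE nr) ?[l == refl _ _]eq_sym ?(negbTE nl) ?[l == - refl _ _]eq_sym ?NE2;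
      rewrite ?subr0 ?sub0r ?opprK ?mulr1 ?mulrN1 ?opprK //.
  by move/eqP: Z; rewrite mulf_eq0 (negbTE z0) /= subr_eq0 => /eqP ->.
have Call l : Orb l -> C l = C om by elim/orbit_ind => // al l' ra Ol'; exact: Crefl.
(* [C] is odd, and constant on the orbit, which contains [- om]. *)
have C0 : C om = 0.
  have := Call _ (orbit_opp orbit_self); rewrite CN => /eqP.
  by rewrite -subr_eq0 -opprD oppr_eq0 -mulr2n mulrn_eq0 /= => /eqP.
move=> i; have := Call _ (r_orb (rN i)); rewrite C0 /C (bigD1 i) //= big1 ?addr0.
  rewrite /ind /e eqxx (negbTE (r_opp (rN i) (rN i))) subr0 mulr1; exact.
move=> j ji; rewrite /ind /e (negbTE (r_opp (rN i) (rN j))).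
have -> : ((in_tuple r)`_i == (in_tuple r)`_j) = false.
  by rewrite nth_uniq ?ltn_ord // eq_sym; apply: contraNF ji.
by rewrite subrr mulr0.
Qed.

Lemma representatives_size : (size r <= \dim h)%N.
Proof.
have := representatives_free; rewrite /free => /eqP <-.
apply: (leq_trans (dimvS (subvf _))); rewrite dimvf.
by rewrite /dim /= muln1.
Qed.

(** At a common zero [y] of the representatives all weights vanish, so [f y = 0]. Evaluation at the
    representatives therefore embeds [h] in a space of dimension [size r]. *)
Lemma representatives_span : (forall y, f (vsval y) = 0 -> y = 0) -> size r = \dim h.
Proof.
move=> inj; apply/eqP; rewrite eqn_leq representatives_size /=.
pose g (y : subvs_of h) : 'rV[K]_(size r) := \row_i (r`_i y).
have glin : linear g by move=> k y t; apply/rowP => i; rewrite !mxE linearP.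
pose gl : {linear subvs_of h -> 'rV[K]_(size r)} := HB.pack g (GRing.isLinear.Build _ _ _ _ g glin).
have kg : lker (linfun gl) == 0%VS.
  apply/lker0P => y t; rewrite !lfunE /= => E; apply/eqP; rewrite -subr_eq0; apply/eqP.
  have g0 : g (y - t) = 0 by have := linearB gl y t; rewrite /= => ->; rewrite E subrr.
  apply: inj.
  have rz l : l \in r -> l (y - t) = 0.
    move=> lr; have ir : (index l r < size r)%N by rewrite index_mem.
    by have /rowP/(_ (Ordinal ir)) := g0; rewrite !mxE nth_index.
  have mu0 j : mu j (y - t) = 0.
    have wj : wt (mu j) by apply/(is_weightP s_basis s_weight); exists j.
    have [->|Oj] := weights_orbit wj; first by rewrite zero_lfunE.
    have [lr|lr] := r_cover Oj; first exact: rz.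
    by apply/eqP; rewrite -oppr_eq0 -opp_lfunE rz.
  have z v : f (vsval (y - t)) *m v = 0.
    rewrite (weight_coord s_basis v) mulmx_sumr big1 // => j _.
    by rewrite -scalemxAr s_weight mu0 scale0r scaler0.
  apply/matrixP => a b'.
  by have := z (delta_mx b' 0); rewrite -colE => /colP /(_ a); rewrite !mxE.
have D : \dim (linfun gl @: fullv) = \dim {: subvs_of h} by rewrite limg_dim_eq // (eqP kg) capv0.
have := dimvS (subvf (linfun gl @: fullv)); rewrite D !dimvf.
by rewrite /dim /= mul1n.
Qed.

End Orbit.
End SymmetricWeights.

(** * Cayley transforms normalizing a representation *)

Section CayleyConsequences.
Variables (K : numFieldType) (d : nat) (br : 'rV[K]_d -> 'rV[K]_d -> 'rV[K]_d).
Hypothesis L : ss_lie br.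
Variable h : {vspace 'rV[K]_d}.
Hypothesis hC : cartan_subalgebra br h.
Variable P : 'M[K]_d.
Hypothesis Pu : P \in unitmx.
Hypothesis PD : forall y : subvs_of h, exists D : 'rV[K]_d,
    P *m ad br (vsval y) = diag_mx D *m P.
Local Notation hdual := (hdual h).
Local Notation beta := (beta L h P).
Variables (m : nat) (f : 'rV[K]_d -> 'M[K]_m).
Hypothesis f_lin : linear f.
Hypothesis f_br : forall x y, f (br x y) = f x *m f y - f y *m f x.
Variables (n : nat) (s : n.-tuple 'cV[K]_m) (mu : 'I_n -> hdual).
Hypothesis s_basis : basis_of fullv s.
Hypothesis s_weight : forall j, weight_vector f (mu j) s`_j.
Local Notation wt := (is_weight (h := h) f).
Local Notation edge := (edge (h := h) br f).
Local Notation root := (is_root (h := h) br).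
Implicit Types (y : subvs_of h) (al l : hdual) (x : 'rV[K]_d) (v w : 'cV[K]_m).

(** All that is retained of [rho g = cayley_transform u]. The determinant condition leads to
    [wt_opp], the conjugation condition to [edge_pair]. *)
Definition cayley_normalizes (u : 'M[K]_m) : Prop :=
  1%:M - u \in unitmx /\ exists c : 'M[K]_m,
    [/\ c *m (1%:M - u) = 1%:M + u, c \in unitmx, \det c = 1 &
        forall x, exists x', c *m f x = f x' *m c].

Variable bs : seq (subvs_of h).
Hypothesis bs_span : span bs = fullv.

(* A nonzero linear form vanishes at finitely many points of the moment curve, because the
   restriction is a nonzero polynomial. *)
Definition moment_point (t : nat) : subvs_of h := \sum_(j < size bs) t%:R ^+ j *: bs`_j.

Hypothesis cayley : forall t : nat, exists N0 : nat, forall N : nat, (N0 <= N)%N ->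
  cayley_normalizes (N.+1%:R^-1 *: f (vsval (moment_point t))).

Lemma moment_avoid (ls : seq hdual) : (forall l, l \in ls -> l != 0) ->
  exists t, forall l, l \in ls -> l (moment_point t) != 0.
Proof.
move=> ls0.
pose p (l : hdual) : {poly K} := \poly_(j < size bs) (l bs`_j : K).
have p0 l : l \in ls -> p l != 0.
  move=> lls; apply: contraNneq (ls0 l lls) => pl; apply/eqP/lfunP => y.
  have : y \in span bs by rewrite bs_span memvf.
  rewrite -[bs]/(tval (in_tuple bs)) => /coord_span ->.
  rewrite linear_sum zero_lfunE big1 // => j _.
  have lj : l bs`_j = 0.
    by have := congr1 (fun q : {poly K} => q`_j) pl; rewrite coef_poly coef0 ltn_ord.
  by rewrite linearZ /= lj; exact: mulr0.
have pe l t : (p l).[t%:R] = l (moment_point t).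
  rewrite /p /moment_point horner_poly linear_sum; apply: eq_bigr => j _.
  by rewrite linearZ [RHS]mulrC.
pose q := \prod_(l <- ls) p l.
have q0 : q != 0 by rewrite prodf_seq_neq0; apply/allP => l lls /=; exact: p0.
have [t Ht] : exists t : nat, q.[t%:R] != 0.
  apply/not_existsP => H.
  have := @max_poly_roots _ q [seq (i%:R : K) | i <- iota 0 (size q)] q0.
  rewrite size_map size_iota ltnn => /(_ _ _)/negP; apply => //.
    apply/allP => _ /mapP [i _ ->]; rewrite /poly.root; apply/negPn/negP; exact: H.
  by rewrite map_inj_uniq ?iota_uniq // => i j /eqP; rewrite eqr_nat => /eqP.
exists t => l lls; rewrite -pe; move: Ht; rewrite horner_prod prodf_seq_neq0.
by move=> /allP /(_ l lls).
Qed.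

Lemma singular_kernel (M : 'M[K]_m) : \det M = 0 -> exists2 v : 'cV[K]_m, v != 0 & M *m v = 0.
Proof.
move=> M0; have /det0P [w w0 wM] : \det M^T == 0 by rewrite det_tr M0.
exists w^T; first by rewrite trmx_eq0.
by rewrite -[M]trmxK -trmx_mul wM trmx0.
Qed.

Lemma horner_char_poly (A : 'M[K]_m) a : (char_poly A).[a] = \det (a%:M - A).
Proof.
rewrite /char_poly horner_sum; apply: eq_bigr => g _.
rewrite hornerM horner_exp !hornerE; congr (_ * _).
rewrite (big_morph _ (fun p q => hornerM p q a) (hornerC 1 a)).
by apply: eq_bigr => i _; rewrite !mxE !(hornerE, hornerMn).
Qed.

(** By symmetry of the characteristic polynomial, [- l x] is an eigenvalue of [f x], hence the value
    at [x] of some weight; for generic [x] this weight can only be [- l]. *)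
Lemma wt_opp_of_cayley l : wt l -> wt (- l).
Proof.
move=> [v v0 Hv]; apply: contrapT => nwt.
have [t Ht] : exists t, forall l', l' \in [seq mu j + l | j : 'I_n] -> l' (moment_point t) != 0.
  apply: moment_avoid => l' /mapP [j _ ->]; rewrite addr_eq0; apply/eqP => E; apply: nwt.
  by apply/(is_weightP s_basis s_weight); exists j.
set x := moment_point t in Ht; pose u := f (vsval x).
have [N0 HN] := cayley t.
(* The two polynomials agree at every integer beyond [N0], which is more points than a nonzero
   difference has roots. *)
have E : char_poly u = char_poly (- u).
  apply/eqP; rewrite -subr_eq0; apply/negPn/negP => p0.
  set p := _ - _ in p0.
  have := @max_poly_roots _ p [seq ((N0 + i).+1%:R : K) | i <- iota 0 (size p)] p0.
  rewrite size_map size_iota ltnn => /(_ _ _)/negP; apply => //.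
    apply/allP => _ /mapP [i _ ->]; rewrite /poly.root /p hornerD hornerN !horner_char_poly opprK.
    have [U1 [c [cE cu c1 _]]] := HN _ (leq_addr i N0).
    set N : K := (N0 + i).+1%:R; have NN : N != 0 by rewrite pnatr_eq0.
    have E1 : N%:M - u = N *: (1%:M - N^-1 *: u).
      by rewrite scalerBr scalerA mulfV // scale1r scalemx1.
    have E2 : N%:M + u = N *: (1%:M + N^-1 *: u).
      by rewrite scalerDr scalerA mulfV // scale1r scalemx1.
    by rewrite E1 E2 !detZ -cE det_mulmx c1 mul1r subrr.
  by rewrite map_inj_uniq ?iota_uniq // => i j /eqP; rewrite eqr_nat eqSS eqn_add2l => /eqP.
have r1 : (char_poly u).[l x] = 0.
  rewrite horner_char_poly; apply/eqP/negPn/negP => D0.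
  have U : (l x)%:M - u \in unitmx by rewrite unitmxE unitfE.
  move/eqP: v0; apply; rewrite -(mulKmx U v) mulmxBl mul_scalar_mx Hv subrr.
  by rewrite mulmx0.
have [w w0 Hw] : exists2 w : 'cV[K]_m, w != 0 & ((l x)%:M + u) *m w = 0.
  by apply: singular_kernel; rewrite -[u]opprK -horner_char_poly -E.
have [j wj] := coord_neq0 s_basis w0.
have /eqP := congr1 (coord s j) Hw; rewrite mulmxDl mul_scalar_mx linearD linearZ linear0.
rewrite /= /u (coord_weight s_basis s_weight) -mulrDl mulf_eq0 (negbTE wj) orbF.
have := Ht (mu j + l) (map_f _ (mem_enum _ j)).
by rewrite add_lfunE addrC => /negbTE ->.
Qed.

Lemma cayley_scalar (u c : 'M[K]_m) (a : K) v : 1%:M - u \in unitmx ->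
  c *m (1%:M - u) = 1%:M + u -> c \in unitmx -> v != 0 -> u *m v = a *: v ->
  [/\ 1 - a != 0, 1 + a != 0 & c *m v = ((1 + a) / (1 - a)) *: v].
Proof.
move=> U1 cE cu v0 uv.
have E1 : (1%:M - u) *m v = (1 - a) *: v by rewrite mulmxBl mul1mx uv scalerBl scale1r.
have a1 : 1 - a != 0.
  apply: contraNneq v0 => a0; apply/eqP.
  by rewrite -(mulKmx U1 v) E1 a0 scale0r mulmx0.
have E2 : (1 - a) *: (c *m v) = (1 + a) *: v.
  by rewrite scalemxAr -E1 mulmxA cE mulmxDl mul1mx uv scalerDl scale1r.
have E3 : c *m v = ((1 + a) / (1 - a)) *: v.
  by rewrite mulrC -scalerA -E2 scalerA mulVf // scale1r.
split=> //; apply: contraNneq v0 => a0; apply/eqP.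
by rewrite -(mulKmx cu v) E3 a0 mul0r scale0r mulmx0.
Qed.

(** Only the component of [x'] in the root space of [al] moves weight [l] to [l + al], and that root
    space is the line of [x0]. *)
Lemma root_component al x0 (x' : 'rV[K]_d) : root al -> root_vector br al x0 -> x0 != 0 ->
  exists S : K, forall l v j, weight_vector f l v -> mu j = l + al ->
    coord s j (f x' *m v) = S * coord s j (f x0 *m v).
Proof.
move=> ra Hx0 x00.
pose xa := \sum_(i | beta i == al) (x' *m invmx P) 0 i *: row i P.
have Hxa : root_vector br al xa.
  rewrite /xa; elim/big_rec: _ => [|i z /eqP bi Hz].
    by move=> y; rewrite (br0r L) scaler0.
  apply: (root_vectorD L) => //; apply: (root_vectorZ L); rewrite -bi.
  exact: row_root_vector.
have [S SE] := root_space_dim1 L hC Pu PD ra Hx0 x00 Hxa; exists S => l v j Hv jE.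
have -> : S * coord s j (f x0 *m v) = coord s j (f xa *m v).
  by rewrite SE (repZ f_lin) -scalemxAl linearZ.
rewrite (rep_coord Pu f_lin x') /xa (rep_sum f_lin) !mulmx_suml !linear_sum.
rewrite [RHS]big_mkcond /=; apply: eq_bigr => i _.
case: eqP => [_|bi]; first by rewrite (repZ f_lin).
rewrite -scalemxAl linearZ; apply/eqP; rewrite mulf_eq0; apply/orP; right.
apply/negPn/negP => c0; apply: bi.
have Hi := rep_raise f_lin f_br (row_root_vector L Pu PD i) Hv.
have := weight_vector_coord s_basis s_weight Hi c0; rewrite jE.
by move=> /addrI ->.
Qed.

(** In [c *m f x0 = f x' *m c], compare the components of weight [l + al] on vectors of weight [l]:
    the factor [S] of [root_component] is the same for all [l]. *)
Lemma edge_pair_of_cayley al l l' : root al -> edge al l -> edge al l' -> l' = l \/ l' = - l - al.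
Proof.
move=> ra [x0 [v [Hx0 Hv xv]]] [x1 [v' [Hx1 Hv' xv']]]; apply: contrapT => /not_orP [n1 n2].
have x00 : x0 != 0.
  by apply: contraNneq xv => ->; rewrite -(scale0r 0) (repZ f_lin) scale0r mul0mx.
(* Both edges can be realized by the single root vector [x0]. *)
have [k kE] := root_space_dim1 L hC Pu PD ra Hx0 x00 Hx1.
have {}xv' : f x0 *m v' != 0.
  by apply: contraNneq xv' => E; rewrite kE (repZ f_lin) -scalemxAl E scaler0.
(* These three forms become the factors of the product below; each is nonzero as long as the
   conclusion fails. *)
have [t Ht] : exists t, forall l1, l1 \in [:: al; l - l'; l + l' + al] -> l1 (moment_point t) != 0.
  apply: moment_avoid => l1; rewrite !inE => /or3P [] /eqP ->; first by case: ra.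
    by rewrite subr_eq0; apply/eqP => E; apply: n1.
  rewrite -addrA addrCA addr_eq0; apply/eqP => E; apply: n2; rewrite E.
  by rewrite opprD.
have [N0 HN] := cayley t; have [U1 [c [cE cu _ cn]]] := HN _ (leqnn N0).
set y := moment_point t in Ht U1 cE; set N : K := N0.+1%:R in U1 cE.
have N0' : N != 0 by rewrite pnatr_eq0.
pose u := N^-1 *: f (vsval y).
have uE l1 w : weight_vector f l1 w -> u *m w = (N^-1 * l1 y) *: w.
  by move=> Hw; rewrite /u -scalemxAl Hw scalerA.
have [x' x'E] := cn x0.
have [S HS] := root_component x' ra Hx0 x00.
pose e := N^-1 * al y.
have key l1 w : weight_vector f l1 w -> f x0 *m w != 0 -> let a := N^-1 * l1 y in
    [/\ 1 - a != 0, 1 + a != 0, 1 - (a + e) != 0 & S * (1 + a) * (1 - (a + e)) = (1 + (a + e)) * (1 - a)].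
  move=> Hw xw a.
  have w0 : w != 0 by apply: contraNneq xw => ->; rewrite mulmx0.
  have [a1 a2 ca] := cayley_scalar U1 cE cu w0 (uE _ _ Hw).
  have Hxw := rep_raise f_lin f_br Hx0 Hw.
  have [b1 b2 cb] := cayley_scalar U1 cE cu xw (uE _ _ Hxw).
  have aeE : N^-1 * (l1 + al) y = a + e by rewrite add_lfunE mulrDr.
  rewrite aeE in b1 b2 cb.
  have [j xj] := coord_neq0 s_basis xw.
  have jE := weight_vector_coord s_basis s_weight Hxw xj.
  have EL : coord s j (c *m (f x0 *m w)) = (1 + (a + e)) / (1 - (a + e)) * coord s j (f x0 *m w).
    by rewrite cb linearZ.
  have ER : coord s j (f x' *m (c *m w)) = (1 + a) / (1 - a) * (S * coord s j (f x0 *m w)).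
    by rewrite ca -scalemxAr [LHS]linearZ; congr (_ * _); exact: HS Hw jE.
  have E : (1 + (a + e)) / (1 - (a + e)) = (1 + a) / (1 - a) * S.
    by apply: (mulIf xj); rewrite -[RHS]mulrA -ER -EL !mulmxA x'E.
  split=> //.
  have -> : S * (1 + a) * (1 - (a + e)) = ((1 + a) / (1 - a) * S) * (1 - a) * (1 - (a + e)).
    by field.
  by rewrite -E; field.
have [] := key _ _ Hv xv; have [] := key _ _ Hv' xv'.
set a' := N^-1 * l' y; set a := N^-1 * l y => p1 p2 p3 E' q1 q2 q3 E.
(* Eliminating [S] from the two instances of [key] leaves exactly this product. *)
have : 2%:R * e * (a - a') * (a + a' + e) == 0.
  have H : (1 + (a + e)) * (1 - a) * ((1 + a') * (1 - (a' + e))) =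
      (1 + (a' + e)) * (1 - a') * ((1 + a) * (1 - (a + e))).
    by rewrite -E -E'; ring.
  have -> : 2%:R * e * (a - a') * (a + a' + e) =
     (1 + (a + e)) * (1 - a) * ((1 + a') * (1 - (a' + e))) -
      (1 + (a' + e)) * (1 - a') * ((1 + a) * (1 - (a + e))) by ring.
  by rewrite H subrr.
have h1 := Ht al (mem_head _ _).
have h2 : l y - l' y != 0.
  have := Ht (l - l'); rewrite add_lfunE opp_lfunE; apply.
  by rewrite !inE eqxx orbT.
have h3 : l y + l' y + al y != 0.
  have := Ht (l + l' + al); rewrite !add_lfunE; apply.
  by rewrite !inE eqxx !orbT.
rewrite /e /a /a' -mulrBr -!mulrDr !mulf_eq0 pnatr_eq0 /= invr_eq0 (negbTE N0') /=.
by rewrite (negbTE h1) (negbTE h2) (negbTE h3).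
Qed.

End CayleyConsequences.

(** * Exclusion of the highest weight 0 *)

Section ZeroHighestWeight.
Variables (K : numFieldType) (d : nat) (br : 'rV[K]_d -> 'rV[K]_d -> 'rV[K]_d).
Hypothesis L : ss_lie br.
Variable h : {vspace 'rV[K]_d}.
Hypothesis hC : cartan_subalgebra br h.
Variable P : 'M[K]_d.
Hypothesis Pu : P \in unitmx.
Hypothesis PD : forall y : subvs_of h, exists D : 'rV[K]_d,
    P *m ad br (vsval y) = diag_mx D *m P.
Local Notation hdual := (hdual h).
Local Notation beta := (beta L h P).
Local Notation coroot := (coroot br).
Variables (m : nat) (f : 'rV[K]_d -> 'M[K]_m).
Hypothesis f_lin : linear f.
Hypothesis f_br : forall x y, f (br x y) = f x *m f y - f y *m f x.
Hypothesis f_irr : forall W : {vspace 'cV[K]_m},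
  (forall x v, v \in W -> f x *m v \in W) -> W = 0%VS \/ W = fullv.
Variables (n : nat) (s : n.-tuple 'cV[K]_m) (mu : 'I_n -> hdual).
Hypothesis s_basis : basis_of fullv s.
Hypothesis s_weight : forall j, weight_vector f (mu j) s`_j.
Local Notation root := (is_root (h := h) br).

Let act x : {linear 'cV[K]_m -> 'cV[K]_m} := mulmx (f x).

(** Otherwise [f x *m v] would be a lowest weight vector of weight 2, against
    [lowest_weight_string]. *)
Lemma zero_weight_killed (v : 'cV[K]_m) (al : hdual) (x : 'rV[K]_d) :
  weight_vector f (0 : hdual) v -> root al ->
  (forall z, root_vector br (- al) z -> f z *m v = 0) ->
  root_vector br al x -> f x *m v = 0.
Proof.
move=> Hv ra kill Hx; have [->|x0] := eqVneq x 0.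
  by rewrite -(scale0r 0) (repZ f_lin) scale0r mul0mx.
have [f0 [_ Hf' ef']] := sl2_pair_exists L hC Pu PD ra Hx x0.
have Hf : root_vector br (- al) f0 := Hf'.
have ef : br x f0 = vsval (coroot al) := ef'.
have EF w : act x (act f0 w) - act f0 (act x w) = act (vsval (coroot al)) w.
  by rewrite /act /= -ef f_br mulmxBl !mulmxA.
have HE w : act (vsval (coroot al)) (act x w) =
    act x (act (vsval (coroot al)) w) + 2%:R *: act x w.
  rewrite /act /=; have := f_br (vsval (coroot al)) x.
  rewrite Hx (coroot2 L hC Pu PD ra) (repZ f_lin) => /esym/eqP; rewrite subr_eq => /eqP E.
  by rewrite mulmxA E mulmxDl -scalemxAl mulmxA addrC.
have Hv0 : f (vsval (coroot al)) *m v = 0 by rewrite Hv zero_lfunE scale0r.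
have fv : f f0 *m v = 0 := kill _ Hf.
have fu : act f0 (act x v) = 0.
  have := EF v; rewrite /act /= fv Hv0 mulmx0 sub0r => /eqP.
  by rewrite oppr_eq0 => /eqP.
have hu : act (vsval (coroot al)) (act x v) = 2%:R *: act x v.
  by rewrite HE /act /= Hv0 mulmx0 add0r.
apply/eqP/negPn/negP => u0.
have [j jE _] := lowest_weight_string EF HE
  (@coroot_spec _ _ _ _ _ _ _ _ _ s_basis s_weight al) u0 hu fu.
have : (2 + j)%:R == 0 :> K by rewrite natrD jE addNr.
by rewrite pnatr_eq0.
Qed.

(** A maximal vector of weight 0 is killed by the positive root vectors, then by the negative ones,
    hence by everything; it spans an invariant line, which is the whole space. *)
Lemma zero_highest_weight (Pos : set hdual) : positive_system br Pos ->
  highest_weight br f Pos (0 : hdual) -> forall x, f x = 0.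
Proof.
move=> [PR Ptot _ _] [v [v0 Hv kill]].
have fb i : f (row i P) *m v = 0.
  have Hi := row_root_vector L Pu PD i.
  have [b0|b0] := eqVneq (beta i) 0.
    have rh : row i P \in h by apply: (root_vector0_mem L hC); rewrite -b0.
    by rewrite -(vsprojK rh) Hv zero_lfunE scale0r.
  have rb : root (beta i) by apply/(is_rootP L Pu PD); split=> //; exists i.
  have [Pb|Pb] := Ptot _ rb; first exact: kill Pb Hi.
  by apply: zero_weight_killed Hv rb _ Hi => z Hz; exact: kill Pb Hz.
have fv x : f x *m v = 0.
  by rewrite (rep_coord Pu f_lin) mulmx_suml big1 // => i _; rewrite -scalemxAl fb scaler0.
have [|V0|Vfull] := f_irr (W := <[v]>%VS).
- by move=> x w /vlineP [k ->]; rewrite -scalemxAr fv scaler0 mem0v.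
- by move/eqP: v0; case; apply/eqP; rewrite -memv0 -V0 memv_line.
move=> x; apply/matrixP => i j; rewrite mxE.
pose w : 'cV[K]_m := delta_mx j 0.
have /vlineP [k kE] : w \in <[v]>%VS by rewrite Vfull memvf.
have : f x *m w = 0 by rewrite kE -scalemxAr fv scaler0.
by rewrite /w -colE => /colP /(_ i); rewrite !mxE.
Qed.

End ZeroHighestWeight.

(** * Ranks of subgroups *)

Section IntegerRank.

(** More rows than columns give a rational relation; multiplying by the product of all denominators
    makes it integral. *)
Lemma int_dependent (k n : nat) (N : 'M[int]_(k, n)) : (n < k)%N ->
  exists2 z : 'I_k -> int, exists i, z i != 0 & forall j, \sum_i z i * N i j = 0.
Proof.
move=> nk; pose M : 'M[rat]_(k, n) := map_mx intr N.
have : kermx M != 0.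
  rewrite kermx_eq0 /row_free neq_ltn.
  by rewrite (leq_ltn_trans (rank_leq_col M) nk).
move=> /rowV0Pn [v /sub_kermxP vM v0].
pose z i := numq (v 0 i) * \prod_(i' | i' != i) denq (v 0 i').
pose D : rat := (\prod_i denq (v 0 i))%:~R.
have zE i : (z i)%:~R = D * v 0 i.
  rewrite /z /D [in RHS](bigD1 i) //= !intrM -[X in _ = _ * X]divq_num_den.
  have d0 : (denq (v 0 i))%:~R != 0 :> rat by rewrite intr_eq0 denq_eq0.
  by field.
exists z.
  have [i vi] : exists i, v 0 i != 0.
    apply/existsP; apply: contraNT v0; rewrite negb_exists => /forallP H.
    by apply/eqP/rowP => i; rewrite mxE; apply/eqP/negPn/H.
  exists i; rewrite /z mulf_neq0 ?numq_eq0 //; apply/prodf_neq0 => i' _.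
  exact: denq_neq0.
move=> j; apply: (@intr_inj rat); rewrite rmorph_sum /= mulr0z.
have /rowP /(_ j) := vM; rewrite !mxE => H.
transitivity (D * \sum_i v 0 i * M i j); last by rewrite H mulr0.
by rewrite mulr_sumr; apply: eq_bigr => i _; rewrite rmorphM /= zE mulrA mxE.
Qed.

(** The generated subgroup lies in the lattice of integer combinations of [r]. Freeness over [K]
    gives independence over the integers, and [int_dependent] bounds any independent family. *)
Lemma gen_subgroup_rank (K : numFieldType) (vT : vectType K) (S : set vT) (n : nat) (r : n.-tuple vT) :
  free r -> (forall i : 'I_n, S r`_i) ->
  (forall x, S x -> (exists i : 'I_n, x = r`_i) \/ (exists i : 'I_n, x = - r`_i)) ->
  subgroup_rank (gen_subgroup S) n.
Proof.
move=> fr rS Sr.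
pose B : set vT := [set x | exists z : 'I_n -> int, x = \sum_(i < n) r`_i *~ z i].
have SB : S `<=` B.
  move=> x /Sr [[i ->]|[i ->]].
    exists (fun j => (j == i)%:R); rewrite (bigD1 i) //= eqxx big1 ?addr0 ?mulr1z // => j /negbTE ->.
    by rewrite mulr0z.
  exists (fun j => - (j == i)%:R); rewrite (bigD1 i) //= eqxx big1 ?addr0 ?mulrN1z // => j /negbTE ->.
  by rewrite oppr0 mulr0z.
have genB x : gen_subgroup S x -> B x.
  apply=> //.
    by exists (fun=> 0); rewrite big1 // => i _; rewrite mulr0z.
  move=> _ _ [z ->] [z' ->]; exists (fun i => z i - z' i); rewrite -sumrB.
  by apply: eq_bigr => i _; rewrite mulrzBr.
split.
  exists (fun i : 'I_n => r`_i); split.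
    by move=> i C C0 CB SC; apply: SC; exact: rS.
  move=> z z0 i; have /freeP/(_ (fun i => (z i)%:~R)) := fr.
  have -> : \sum_(i < n) (z i)%:~R *: r`_i = 0.
    by rewrite -[RHS]z0; apply: eq_bigr => j _; rewrite scaler_int.
  by move=> /(_ erefl i) /eqP; rewrite intr_eq0 => /eqP.
move=> k e eS indep; rewrite leqNgt; apply/negP => nk.
have [N NE] : exists N : 'M[int]_(k, n), forall a, e a = \sum_(i < n) r`_i *~ N a i.
  have /choice [z Hz] : forall a, exists z : 'I_n -> int, e a = \sum_(i < n) r`_i *~ z i.
    by move=> a; exact: genB (eS a).
  by exists (\matrix_(a, i) z a i) => a; rewrite Hz; apply: eq_bigr => i _; rewrite mxE.
have [z [a za] Hz] := int_dependent N nk.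
move/eqP: za; apply; apply: (indep z).
under eq_bigr => b _ do rewrite NE mulrz_suml.
rewrite exchange_big big1 // => i _.
under eq_bigr => b _ do rewrite -mulrzA.
rewrite -mulrz_sumr; under eq_bigr do rewrite mulrC; by rewrite Hz mulr0z.
Qed.

End IntegerRank.

(** * Complexification of a Lie group representation *)

Section Complexify.
Variables (R : realType) (b : ground) (d : nat).
Local Notation F := (gfield R b).
Local Notation C := R[i].
Local Notation toCv := (map_mx (@toC R b)).

Lemma toC_delta (i : 'I_d) : toCv (delta_mx 0 i) = delta_mx 0 i :> 'rV[C]_d.
Proof. exact: map_delta_mx. Qed.

Lemma linear_delta_ext (W : lmodType C) (g g' : 'rV[C]_d -> W) :
  linear g -> linear g' -> (forall i, g (delta_mx 0 i) = g' (delta_mx 0 i)) -> g =1 g'.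
Proof.
move=> gl gl' E x.
pose u : {linear 'rV[C]_d -> W} := HB.pack g (GRing.isLinear.Build _ _ _ _ g gl).
pose u' : {linear 'rV[C]_d -> W} := HB.pack g' (GRing.isLinear.Build _ _ _ _ g' gl').
rewrite -[g x]/(u x) -[g' x]/(u' x) (row_sum_delta x) !linear_sum.
by apply: eq_bigr => i _; rewrite !linearZZ /= E.
Qed.

Lemma complexify_map_linear m (g : 'rV[F]_d -> 'M[C]_m) : linear (complexify_map g).
Proof.
move=> k x y; rewrite /complexify_map scaler_sumr -big_split; apply: eq_bigr => i _ /=.
by rewrite !mxE scalerDl scalerA.
Qed.

Lemma complexify_map_delta m (g : 'rV[F]_d -> 'M[C]_m) i :
  complexify_map g (delta_mx 0 i) = g (delta_mx 0 i).
Proof.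
rewrite /complexify_map (bigD1 i) //= mxE !eqxx scale1r big1 ?addr0 // => j ji.
by rewrite mxE (negbTE ji) andbF scale0r.
Qed.

Variable br : 'rV[F]_d -> 'rV[F]_d -> 'rV[F]_d.
Hypothesis L : ss_lie br.
Local Notation brC := (complexify_bracket br).

Lemma complexify_bracket_linl y : linear (brC^~ y).
Proof.
move=> k x z; rewrite /complexify_bracket scaler_sumr -big_split; apply: eq_bigr => i _ /=.
rewrite scaler_sumr -big_split; apply: eq_bigr => j _ /=.
by rewrite !mxE scalerA -scalerDl mulrDl mulrA.
Qed.

Lemma complexify_bracket_linr x : linear (brC x).
Proof.
move=> k y z; rewrite /complexify_bracket scaler_sumr -big_split; apply: eq_bigr => i _ /=.
rewrite scaler_sumr -big_split; apply: eq_bigr => j _ /=.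
by rewrite !mxE scalerA -scalerDl mulrDr mulrCA.
Qed.

Lemma complexify_bracket_toC (x y : 'rV[F]_d) : brC (toCv x) (toCv y) = toCv (br x y).
Proof.
rewrite {2}(row_sum_delta x) (br_suml L) raddf_sum /=; apply: eq_bigr => i _.
rewrite (brZl L) {2}(row_sum_delta y) (br_sumr L) scaler_sumr raddf_sum /=.
apply: eq_bigr => j _; rewrite (brZr L) scalerA !mxE map_mxZ rmorphM.
by [].
Qed.

Lemma complexify_bracket_delta i j :
  brC (delta_mx 0 i) (delta_mx 0 j) = toCv (br (delta_mx 0 i) (delta_mx 0 j)).
Proof. by rewrite -!toC_delta complexify_bracket_toC. Qed.

Lemma complexify_ad_delta i : ad brC (delta_mx 0 i) = toCv (ad br (delta_mx 0 i)).
Proof.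
apply/row_matrixP => j; rewrite -map_row !rowE.
have -> : delta_mx 0 j *m ad br (delta_mx 0 i) = br (delta_mx 0 i) (delta_mx 0 j) by exact: mul_ad.
rewrite -complexify_bracket_delta.
pose u : {linear 'rV[C]_d -> 'rV[C]_d} :=
  HB.pack (brC (delta_mx 0 i)) (GRing.isLinear.Build _ _ _ _ _ (complexify_bracket_linr (delta_mx 0 i))).
by rewrite /ad -[brC _]/(u : _ -> _) mul_rV_lin1.
Qed.

(** The Jacobi identity is trilinear, so it suffices on the standard basis, where it comes from
    [br]. Nondegeneracy survives because the Gram matrix of the Killing form is the image of an
    invertible matrix. *)
Lemma complexify_ss_lie : ss_lie brC.
Proof.
have ladd (u v : 'rV[C]_d -> 'rV[C]_d) : linear u -> linear v -> linear (fun x => u x - v x).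
  by move=> lu lv k x y; rewrite lu lv scalerBr opprD addrACA.
have lcomp (u v : 'rV[C]_d -> 'rV[C]_d) : linear u -> linear v -> linear (fun x => u (v x)).
  by move=> lu lv k x y; rewrite lv lu.
have ll := complexify_bracket_linl; have lr := complexify_bracket_linr.
have jac x y z : brC (brC x y) z = brC x (brC y z) - brC y (brC x z).
  apply: (@linear_delta_ext _ (fun x => brC (brC x y) z) (fun x => brC x (brC y z) - brC y (brC x z))).
  - exact: (lcomp (brC^~ z) (brC^~ y)).
  - by apply: ladd => //; exact: (lcomp (brC y) (brC^~ z)).
  move=> i; apply: (@linear_delta_ext _ (fun y => brC (brC (delta_mx 0 i) y) z)
    (fun y => brC (delta_mx 0 i) (brC y z) - brC y (brC (delta_mx 0 i) z))).
  - exact: (lcomp (brC^~ z) (brC (delta_mx 0 i))).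
  - by apply: ladd => //; exact: (lcomp (brC (delta_mx 0 i)) (brC^~ z)).
  move=> j; apply: (@linear_delta_ext _ (brC (brC (delta_mx 0 i) (delta_mx 0 j)))
    (fun z => brC (delta_mx 0 i) (brC (delta_mx 0 j) z) - brC (delta_mx 0 j) (brC (delta_mx 0 i) z))) => //.
  - by apply: ladd; [exact: (lcomp (brC (delta_mx 0 i)) (brC (delta_mx 0 j))) |
                     exact: (lcomp (brC (delta_mx 0 j)) (brC (delta_mx 0 i)))].
  by move=> k; rewrite -!toC_delta !complexify_bracket_toC (ss_jacobi L) raddfB.
split=> // x Hx.
pose B : 'M[F]_d := \matrix_(i, j) killing br (delta_mx 0 i) (delta_mx 0 j).
have Bu : B \in unitmx.
  rewrite -row_free_unit -kermx_eq0; apply/rowV0P => z /sub_kermxP zB.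
  apply: (ss_nondeg L) => y; rewrite (row_sum_delta y) (killing_sumr L) big1 // => j _.
  rewrite (killingZr L) (row_sum_delta z) (killing_suml L).
  have := congr1 (fun M : 'rV[F]_d => M 0 j) zB; rewrite !mxE => H.
  suff -> : \sum_i killing br (z 0 i *: delta_mx 0 i) (delta_mx 0 j) = 0 by rewrite mulr0.
  by rewrite -[RHS]H; apply: eq_bigr => i _; rewrite (killingZl L) mxE.
have adl : linear (ad brC).
  move=> k u v; apply/row_matrixP => j; apply/rowP => l.
  by rewrite !mxE ll !mxE.
have kE i j : killing brC (delta_mx 0 i) (delta_mx 0 j) = (toCv B) i j.
  by rewrite /killing !complexify_ad_delta -map_mxM trace_map_mx !mxE.
have xB : x *m toCv B = 0.
  apply/rowP => j; rewrite mxE [RHS]mxE -[RHS](Hx (delta_mx 0 j)) /killing.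
  pose u : {linear 'rV[C]_d -> 'M[C]_d} := HB.pack (ad brC) (GRing.isLinear.Build _ _ _ _ _ adl).
  rewrite {2}(row_sum_delta x) -[ad brC (\sum_i _)]/(u (\sum_i _)) linear_sum mulmx_suml linear_sum.
  apply: eq_bigr => i _; rewrite linearZZ -scalemxAl linearZZ /= -kE.
  by [].
have Bc : toCv B \in unitmx by rewrite map_unitmx.
by rewrite -(mulmxK Bc x) xB mul0mx.
Qed.

Variables (m : nat) (g : 'rV[F]_d -> 'M[C]_m).
Hypothesis g_sum : forall x, g x = \sum_i toC (x 0 i) *: g (delta_mx 0 i).
Hypothesis g_br : forall x y, g (br x y) = g x *m g y - g y *m g x.
Local Notation gC := (complexify_map g).

Lemma complexify_map_toC x : gC (toCv x) = g x.
Proof. by rewrite g_sum; apply: eq_bigr => i _; rewrite mxE. Qed.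

Lemma complexify_map_bracket x y : gC (brC x y) = gC x *m gC y - gC y *m gC x.
Proof.
have gl := complexify_map_linear g.
have lm (A : 'M[C]_m) : linear (fun x => gC x *m A - A *m gC x).
  move=> k u v; rewrite gl mulmxDl mulmxDr -scalemxAl -scalemxAr scalerBr opprD.
  by rewrite addrACA.
have lm' (A : 'M[C]_m) : linear (fun x => A *m gC x - gC x *m A).
  move=> k u v; rewrite gl mulmxDl mulmxDr -scalemxAl -scalemxAr scalerBr opprD.
  by rewrite addrACA.
apply: (@linear_delta_ext _ (fun x => gC (brC x y)) (fun x => gC x *m gC y - gC y *m gC x)) => //.
  by move=> k u v; rewrite complexify_bracket_linl gl.
move=> i; apply: (@linear_delta_ext _ (fun y => gC (brC (delta_mx 0 i) y))
  (fun y => gC (delta_mx 0 i) *m gC y - gC y *m gC (delta_mx 0 i))) => //.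
  by move=> k u v; rewrite complexify_bracket_linr gl.
by move=> j; rewrite complexify_bracket_delta complexify_map_toC g_br !complexify_map_delta.
Qed.

End Complexify.

Lemma trmx_map_commutator (K K' : fieldType) (phi : {rmorphism K -> K'}) d (A X Y : 'M[K]_d) :
  (map_mx phi A)^T = (map_mx phi X)^T *m (map_mx phi Y)^T - (map_mx phi Y)^T *m (map_mx phi X)^T ->
  A = Y *m X - X *m Y.
Proof.
rewrite -!trmx_mul -!map_mxM -raddfB -raddfB => /trmx_inj.
exact: (@map_mx_inj _ _ phi).
Qed.

Lemma jacobi_of_ad (K : fieldType) d (br : 'rV[K]_d -> 'rV[K]_d -> 'rV[K]_d) x y z :
  (forall x y, y *m ad br x = br x y) ->
  ad br (br x y) = ad br y *m ad br x - ad br x *m ad br y ->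
  br (br x y) z = br x (br y z) - br y (br x z).
Proof. by move=> adE E; rewrite -(adE (br x y)) E mulmxBr !mulmxA !adE. Qed.

(** * Adjoint representation, determinant and Cayley condition on the group *)

Section LieGroupFacts.
Variables (R : realType) (b : ground) (d : nat).
Local Notation F := (gfield R b).
Local Notation C := R[i].
Local Notation toCv := (map_mx (@toC R b)).
Variable G : lieGroupType F d.
Hypothesis G_connected : connected [set: G].
Variables (c : chart F d G) (c_atlas : atlas c) (c_one : cdom c 1%g).
Local Notation e := (cmap c 1%g).
Hypothesis G_semisimple : semisimple (lie_bracket c).
Local Notation br := (lie_bracket c).
Local Notation brC := (complexify_bracket br).

(** Transposed, because [Ad] acts on row vectors; given complex entries so that the lemmas on
    [sigma] apply. *)
Definition adjoint_rep (g : G) : 'M[C]_d := (toCv (lin1_mx (Ad c g)))^T.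

Lemma mul_lin1_Ad g y : y *m lin1_mx (Ad c g) = Ad c g y.
Proof.
pose u : {linear 'rV[F]_d -> 'rV[F]_d} :=
  HB.pack (Ad c g) (GRing.isLinear.Build _ _ _ _ _ (Ad_is_linear c_atlas c_one g)).
by rewrite -[Ad c g]/(u : _ -> _) mul_rV_lin1.
Qed.

Lemma adjoint_rep_mul g g' : adjoint_rep (g * g')%g = adjoint_rep g *m adjoint_rep g'.
Proof.
rewrite /adjoint_rep -trmx_mul -map_mxM; congr (map_mx _ _)^T.
apply/row_matrixP => i; rewrite !rowE mulmxA !mul_lin1_Ad.
exact: Ad_mul.
Qed.

Lemma adjoint_rep_one : adjoint_rep 1%g = 1%:M.
Proof.
rewrite /adjoint_rep -[RHS](trmx1 C d) -(map_mx1 (@toC R b)); congr (map_mx _ _)^T.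
by apply/row_matrixP => i; rewrite !rowE mul_lin1_Ad Ad_one // mulmx1.
Qed.

Lemma adjoint_rep_is_Cdiff i j : is_Cdiff (fun z => adjoint_rep (cinv c z) i j) e
  (fun v => toC (lie_bracket c v (delta_mx 0 j) 0 i)).
Proof.
have D := Ad_differentiable c_atlas c_one (delta_mx 0 j).
have -> : (fun z => adjoint_rep (cinv c z) i j) =
    (fun z => toC (Ad c (cinv c z) (delta_mx 0 j) 0 i)).
  by apply/funext => z; rewrite !mxE.
have [DC E] := is_Cdiff_toC (differentiable_coord_comp i D).
by split=> // v; rewrite E (derivable_coord i (diff_derivable D)).2.
Qed.

Lemma drho_adjoint_rep x : drho adjoint_rep c x = (toCv (ad br x))^T.
Proof.
apply/matrixP => i j; rewrite mxE (adjoint_rep_is_Cdiff i j).2 !mxE.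
by [].
Qed.

Lemma lie_bracket_ss_lie : ss_lie br.
Proof.
have linr := lie_bracket_linear_r c_atlas c_one.
have adE x y : y *m ad br x = br x y.
  pose u : {linear 'rV[F]_d -> 'rV[F]_d} :=
    HB.pack (br x) (GRing.isLinear.Build _ _ _ _ _ (linr x)).
  by rewrite /ad -[br x]/(u : _ -> _) mul_rV_lin1.
split.
- exact: lie_bracket_linear_l.
- exact: linr.
- move=> x y z.
  have := drho_bracket c_atlas c_one adjoint_rep_one adjoint_rep_mul
    (fun i j => (adjoint_rep_is_Cdiff i j).1) x y.
  rewrite !drho_adjoint_rep => /(@trmx_map_commutator _ _ (@toC R b)) E.
  exact: jacobi_of_ad adE E.
- by case: G_semisimple.
Qed.

Lemma brC_ss_lie : ss_lie brC.
Proof. exact: complexify_ss_lie lie_bracket_ss_lie. Qed.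

Section Representation.
Variables (m : nat) (rho : G -> 'M[C]_m).
Hypothesis rho_rep : representation rho.
Local Notation f := (complexify_map (drho rho c)).

Lemma rep_mul g g' : rho (g * g')%g = rho g *m rho g'.
Proof. by case: rho_rep. Qed.

Lemma rep_unit g : rho g \in unitmx.
Proof. by case: rho_rep. Qed.

Lemma rep_one : rho 1%g = 1%:M.
Proof.
have := rep_mul 1%g 1%g; rewrite mulg1 => E.
by have := mulKmx (rep_unit 1%g) (rho 1%g); rewrite -E mulVmx // rep_unit.
Qed.

Lemma rep_Cdiff i j : Cdiff (fun z => rho (cinv c z) i j) e.
Proof.
case: rho_rep => _ _ /(_ c c_atlas i j) S.
exact: Csmooth_Cdiff (@cimg_open _ _ _ c) S (cmap_cimg c_one).
Qed.

Lemma f_toC x : f (toCv x) = drho rho c x.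
Proof. exact: complexify_map_toC (drho_sum rep_Cdiff) x. Qed.

Lemma f_bracket x y : f (brC x y) = f x *m f y - f y *m f x.
Proof.
apply: (complexify_map_bracket lie_bracket_ss_lie (drho_sum rep_Cdiff)).
exact: (drho_bracket c_atlas c_one rep_one rep_mul rep_Cdiff).
Qed.

Lemma f_irreducible : irreducible_rep rho -> forall W : {vspace 'cV[C]_m},
  (forall x v, v \in W -> f x *m v \in W) -> W = 0%VS \/ W = fullv.
Proof.
move=> [m0 irr] W Winv; apply: irr => g v vW.
pose p : 'M[C]_m := \matrix_(i, j) (projv W (delta_mx j 0 : 'cV[C]_m)) i 0.
have pE w : p *m w = projv W w.
  have {2}-> : w = \sum_j w j 0 *: delta_mx j 0.
    by rewrite {1}(matrix_sum_delta w); apply: eq_bigr => j _; rewrite big_ord1.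
  rewrite linear_sum; apply/colP => i; rewrite mxE summxE; apply: eq_bigr => j _.
  by rewrite linearZ /= !mxE mulrC.
have ext (A B : 'M[C]_m) : (forall w : 'cV[C]_m, A *m w = B *m w) -> A = B.
  move=> H; apply/matrixP => i j.
  by have := H (delta_mx j 0); rewrite -!colE => /colP /(_ i); rewrite !mxE.
(* [p] is the matrix of a projection onto [W], so [W] is the kernel of [Q]. *)
pose Q := 1%:M - p.
have QW w : w \in W -> Q *m w = 0.
  by move=> wW; rewrite mulmxBl mul1mx pE projv_id // subrr.
have Qw w : Q *m w = w - projv W w by rewrite mulmxBl mul1mx pE.
have QQ : Q *m Q = Q.
  by apply: ext => w; rewrite -mulmxA [in LHS](Qw w) mulmxBr (QW _ (memv_proj _ _)) subr0.
have Qd x : Q *m drho rho c x *m (1%:M - Q) = 0.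
  apply: ext => w; rewrite mul0mx -!mulmxA.
  have -> : (1%:M - Q) *m w = projv W w by rewrite /Q opprB addrC subrK pE.
  by rewrite QW // -f_toC; apply: Winv; exact: memv_proj.
have := invariant_group c_atlas c_one rep_one rep_mul rep_Cdiff QQ Qd G_connected g.
move=> /(congr1 (mulmx^~ v)); rewrite mul0mx -!mulmxA.
have -> : (1%:M - Q) *m v = v by rewrite /Q opprB addrC subrK pE projv_id.
rewrite mulmxBl mul1mx pE => /eqP; rewrite subr_eq0 => /eqP ->.
exact: memv_proj.
Qed.

Lemma Cdiff_prod (k : nat) (u : 'I_k -> 'rV[F]_d -> C) (a : 'rV[F]_d) :
  (forall i, Cdiff (u i) a) -> Cdiff (fun z => \prod_i u i z) a.
Proof.
move=> H; elim: k u H => [|k IH] u H.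
  have -> : (fun z => \prod_i u i z) = (fun=> 1) by apply/funext => z; rewrite big_ord0.
  exact: (is_Cdiff_cst 1 a).1.
have -> : (fun z => \prod_i u i z) = (fun z => u ord0 z * \prod_i u (lift ord0 i) z).
  by apply/funext => z; rewrite big_ord_recl.
exact: (is_CdiffM (Cdiff_is (H ord0)) (Cdiff_is (IH _ (fun i => H (lift ord0 i))))).1.
Qed.

Lemma det_Cdiff : Cdiff (fun z => \det (rho (cinv c z))) e.
Proof.
have dC (s : 'S_m) : Cdiff (fun z => (-1) ^+ s * \prod_i rho (cinv c z) i (s i)) e.
  apply: (is_CdiffM (is_Cdiff_cst _ _) (Cdiff_is _)).1.
  by apply: Cdiff_prod => i; exact: rep_Cdiff.
have H := (is_Cdiff_sum (index_enum _) xpredT (fun s => Cdiff_is (dC s))).1.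
have -> : (fun z => \det (rho (cinv c z))) =
  (fun z => \sum_(s : 'S_m) (-1) ^+ s * \prod_i rho (cinv c z) i (s i)) by [].
exact: H.
Qed.

Definition det_rep (g : G) : 'M[C]_1 := (\det (rho g))%:M.

Lemma det_rep_one : det_rep 1%g = 1%:M.
Proof. by rewrite /det_rep rep_one det1. Qed.

Lemma det_rep_mul g g' : det_rep (g * g')%g = det_rep g *m det_rep g'.
Proof. by rewrite /det_rep rep_mul det_mulmx scalar_mxM. Qed.

Lemma det_rep_Cdiff i j : Cdiff (fun z => det_rep (cinv c z) i j) e.
Proof.
have -> : (fun z => det_rep (cinv c z) i j) = (fun z => \det (rho (cinv c z))).
  by apply/funext => z; rewrite !ord1 mxE eqxx.
exact: det_Cdiff.
Qed.

(** Matrices of size 1 commute, so the differential vanishes on brackets, hence everywhere by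
    [perfect]. *)
Lemma drho_det_rep x : drho det_rep c x = 0.
Proof.
have S := drho_sum det_rep_Cdiff.
pose D : 'cV[C]_d := \col_i drho det_rep c (delta_mx 0 i) 0 0.
have DE y : (y *m D) 0 0 = complexify_map (drho det_rep c) y 0 0.
  by rewrite mxE /complexify_map summxE; apply: eq_bigr => i _; rewrite !mxE.
have D0 : D = 0.
  apply: (perfect brC_ss_lie) => y z; rewrite DE.
  rewrite (complexify_map_bracket lie_bracket_ss_lie S
    (drho_bracket c_atlas c_one det_rep_one det_rep_mul det_rep_Cdiff)).
  by rewrite !mxE !big_ord1 mulrC subrr.
apply/matrixP => i j; rewrite !ord1 [RHS]mxE -(complexify_map_toC S) -DE D0.
by rewrite mulmx0 mxE.
Qed.

(* A group homomorphism into GL_1 with zero differential is trivial: the matrices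
   diag(1, det (rho g)) preserve the line on which [Q] vanishes. *)
Lemma det_rep_trivial g : \det (rho g) = 1.
Proof.
pose sg (g0 : G) : 'M[C]_(1 + 1) := block_mx 1%:M 0 0 (det_rep g0).
pose Q : 'M[C]_(1 + 1) := block_mx 1%:M (- 1%:M) 0 0.
have sg1 : sg 1%g = 1%:M by rewrite /sg det_rep_one -scalar_mx_block.
have sgM g1 g2 : sg (g1 * g2)%g = sg g1 *m sg g2.
  by rewrite /sg det_rep_mul mulmx_block !mulmx0 !mul0mx !mulmx1 !addr0 add0r.
have sgE i j : (fun z => sg (cinv c z) i j) = (fun=> (i == j)%:R) \/
    (fun z => sg (cinv c z) i j) = (fun z => det_rep (cinv c z) 0 0).
  case: (split_ordP i) => i' ->; case: (split_ordP j) => j' ->; rewrite !ord1.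
  - by left; apply/funext => z; rewrite /sg block_mxEul mxE eqxx.
  - by left; apply/funext => z; rewrite /sg block_mxEur mxE.
  - by left; apply/funext => z; rewrite /sg block_mxEdl mxE.
  - by right; apply/funext => z; rewrite /sg block_mxEdr.
have sgC i j : Cdiff (fun z => sg (cinv c z) i j) e.
  by case: (sgE i j) => ->; [exact: (is_Cdiff_cst _ _).1|exact: det_rep_Cdiff].
have sg0 x : drho sg c x = 0.
  apply/matrixP => i j; rewrite [LHS]mxE [RHS]mxE; case: (sgE i j) => ->.
    exact: (is_Cdiff_cst _ _).2.
  by have /matrixP/(_ 0 0) := drho_det_rep x; rewrite !mxE.
have QQ : Q *m Q = Q.
  by rewrite /Q mulmx_block !mulmx0 !mul0mx !mulmx1 !addr0 mul1mx.
have sQ x : Q *m drho sg c x *m (1%:M - Q) = 0 by rewrite sg0 mulmx0 mul0mx.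
have := invariant_group c_atlas c_one sg1 sgM sgC QQ sQ G_connected g.
rewrite (scalar_mx_block 1) /Q opp_block_mx add_block_mx !mulmx_block.
(* The upper right entry of the product is [1 - \det (rho g)]. *)
move=> /matrixP/(_ (lshift 1 0) (rshift 1 0)).
rewrite block_mxEur ?mulmx0 ?mul0mx ?mulmx1 ?mul1mx ?oppr0 ?addr0 ?add0r.
rewrite mul1mx opprK mulmx1 mulNmx mul1mx !mxE !eqxx => /eqP.
by rewrite subr_eq0 => /eqP.
Qed.

Section CayleyFacts.
Hypothesis rho_cayley : Cayley rho c.
Variable h : {vspace 'rV[F]_d}.
Local Notation H := (complexify_sub h).

(** The Cayley condition is available only at points of [h] itself; their images still span the
    complexification. *)
Definition real_basis : seq (subvs_of H) := [seq vsproj H (toCv x) | x <- vbasis h].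

Lemma toCv_vbasis x : x \in (vbasis h : seq _) -> toCv x \in H.
Proof. by move=> xh; apply: memv_span; exact: map_f. Qed.

Lemma real_basis_span : span real_basis = fullv.
Proof.
pose u : {linear subvs_of H -> 'rV[C]_d} := vsval.
apply/eqP; rewrite eqEsubv subvf /=; apply/subvP => y _.
have : vsval y \in (linfun u @: span real_basis)%VS.
  rewrite limg_span -map_comp.
  have -> : [seq (linfun u \o (fun x => vsproj H (toCv x))) x | x <- vbasis h] = [seq toCv x | x <- vbasis h].
    by apply/eq_in_map => x xh; rewrite /= lfunE /= vsprojK // toCv_vbasis.
  exact: subvsP.
by move=> /memv_imgP [z zs]; rewrite lfunE /= => /subvs_inj ->.
Qed.

Definition real_moment_point (t : nat) : 'rV[F]_d :=
  \sum_(j < size (vbasis h)) t%:R ^+ j *: (vbasis h)`_j.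

(** The coefficients along the moment curve are natural numbers, so its points come from [h]. *)
Lemma moment_point_real t : vsval (moment_point real_basis t) = toCv (real_moment_point t).
Proof.
rewrite /moment_point linear_sum raddf_sum /=.
rewrite -(big_mkord xpredT (fun j => vsval (t%:R ^+ j *: real_basis`_j))).
rewrite -(big_mkord xpredT (fun j => toCv (t%:R ^+ j *: (vbasis h)`_j))).
rewrite size_map; apply: eq_big_nat => j /andP [_ jh].
rewrite linearZ /= map_mxZ rmorphXn rmorph_nat (nth_map 0) // vsprojK //.
by apply: toCv_vbasis; exact: mem_nth.
Qed.

Lemma small_scale (N : set 'rV[F]_d) v : open N -> N 0 ->
  exists N0 : nat, forall k : nat, (N0 <= k)%N -> N (k.+1%:R^-1 *: v).
Proof.
move=> oN N00.
have cs : {for (0 : F^o), continuous (fun k : F^o => k *: v)} by exact: scalel_continuous.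
have : \forall k \near (0 : F^o), N (k *: v).
  by apply: cs; rewrite scale0r; exact: open_nbhs_nbhs.
move=> /nbhs_ballP [e /= e0 He].
have [r r0 eE] := ofR_pos e0.
have ofR_nat (k : nat) : ofR b (k%:R : R) = k%:R.
  by elim: k => [|k IH]; [exact: ofR0|rewrite -natr1 ofRD IH ofR1 natr1].
exists (Num.bound r^-1) => k kr; apply: He; rewrite /ball /= sub0r normrN normfV normr_nat.
rewrite -[ltLHS]mul1r ltr_pdivrMr ?ltr0n // eE -(ofR_nat k.+1) -ofRM -(ofR1 R b) ofR_lt.
rewrite mulrC -ltr_pdivrMr // div1r (lt_le_trans (archi_boundP _)) ?invr_ge0 ?(ltW r0) //.
by rewrite ler_nat (leq_trans kr).
Qed.

Lemma cayley_normalizes_moment t : exists N0 : nat, forall N : nat, (N0 <= N)%N ->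
  cayley_normalizes f (N.+1%:R^-1 *: f (vsval (moment_point real_basis t))).
Proof.
have [N [oN N00 HN]] := rho_cayley.
have [N0 HN0] := small_scale (real_moment_point t) oN N00.
exists N0 => k kN0.
set u := _ *: f _.
have uE : u = drho rho c (k.+1%:R^-1 *: real_moment_point t).
  have D0 : drho rho c 0 = 0.
    by rewrite (drho_sum rep_Cdiff) big1 // => i _; rewrite mxE rmorph0 scale0r.
  rewrite -[_ *: real_moment_point t]addr0 (drho_linear rep_Cdiff) D0 addr0.
  by rewrite fmorphV rmorph_nat /u moment_point_real f_toC.
have [un [g gE]] := HN _ (HN0 _ kN0).
rewrite -uE in un gE.
split=> //; exists (rho g); split.
- by rewrite gE mulmxKV.
- exact: rep_unit.
- exact: det_rep_trivial.
(* The witness is the complex linear extension of [Ad c g], applied to [x]. *)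
move=> x; exists (\sum_i x 0 i *: toCv (Ad c g (delta_mx 0 i))).
rewrite {1}/complexify_map mulmx_sumr.
have fs : f (\sum_i x 0 i *: toCv (Ad c g (delta_mx 0 i))) =
    \sum_i x 0 i *: f (toCv (Ad c g (delta_mx 0 i))).
  pose fl : {linear 'rV[C]_d -> 'M[C]_m} :=
    HB.pack f (GRing.isLinear.Build _ _ _ _ f (complexify_map_linear (drho rho c))).
  rewrite -[f]/(fl : _ -> _) linear_sum; apply: eq_bigr => i _; exact: linearZZ.
rewrite fs mulmx_suml; apply: eq_bigr => i _.
rewrite -scalemxAr -scalemxAl f_toC.
by rewrite (drho_Ad c_atlas c_one rep_mul rep_Cdiff).
Qed.

End CayleyFacts.

End Representation.
End LieGroupFacts.

(** Complexification changes nothing over the complex numbers, where the given dimension serves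
    directly. *)
Lemma F_dim_complexify (R : realType) (b : ground) (d m n : nat) (g : 'rV[gfield R b]_d -> 'M[R[i]]_m)
    (h : {vspace 'rV[gfield R b]_d}) :
  (forall x, g x = \sum_i toC (x 0 i) *: g (delta_mx 0 i)) ->
  F_dim b [set g x | x in [set` h]] n ->
  (b = RealField -> F_dim ComplexField [set complexify_map g x | x in [set` complexify_sub h]] n) ->
  F_dim ComplexField [set complexify_map g x | x in [set` complexify_sub h]] n.
Proof.
case: b g h => g h g_sum Fg H; first exact: H.
have -> : complexify_sub h = h.
  rewrite /complexify_sub -[RHS](span_basis (vbasisP h)); congr (span _).
  by rewrite -[RHS]map_id; apply: eq_map => x; apply/rowP => i; rewrite mxE.
have -> : complexify_map g = g by apply/funext => x; rewrite g_sum.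
exact: Fg.
Qed.

(** The image of [H] has dimension at least [n], while [H] has dimension at most [n]; rank and
    nullity leave no kernel. *)
Lemma F_dim_injective (R : realType) (d m n : nat) (f : 'rV[R[i]]_d -> 'M[R[i]]_m)
    (H : {vspace 'rV[R[i]]_d}) :
  linear f -> F_dim ComplexField [set f x | x in [set` H]] n -> (\dim H <= n)%N ->
  \dim H = n /\ forall y : subvs_of H, f (vsval y) = 0 -> y = 0.
Proof.
move=> fl [e [e_free SE]] Hn.
pose u : {linear 'rV[R[i]]_d -> 'M[R[i]]_m} := HB.pack f (GRing.isLinear.Build _ _ _ _ f fl).
pose t := [tuple e i | i < n].
have tE (i : 'I_n) : t`_i = e i by rewrite -tnth_nth tnth_mktuple.
have ft : free t.
  apply/freeP => k k0; apply: e_free; rewrite -[RHS]k0.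
  by apply: eq_bigr => i _; rewrite tE.
have tH : (span t <= linfun u @: H)%VS.
  apply/span_subvP => _ /mapP [i _ ->].
  have : [set A | exists a : 'I_n -> R[i], A = \sum_(i < n) a i *: e i] (e i).
    exists (fun j => (j == i)%:R); rewrite (bigD1 i) //= eqxx scale1r big1 ?addr0 // => j /negbTE ->.
    by rewrite scale0r.
  rewrite -[X in X (e i)]SE => -[x xH <-]; apply/memv_imgP; exists x => //.
  by rewrite lfunE.
have dt : \dim (span t) = n by move: ft; rewrite /free size_tuple => /eqP.
have := dimvS tH; rewrite dt => nH.
have kH := limg_ker_dim (linfun u) H.
have HE : \dim H = n.
  by apply/eqP; rewrite eqn_leq Hn -kH (leq_trans nH) // leq_addl.
have k0 : \dim (H :&: lker (linfun u)) = 0%N.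
  by apply/eqP; rewrite -leqn0 -(leq_add2r n) add0n -{2}HE -kH leq_add2l.
split=> // y fy; apply: subvs_inj; apply/eqP; rewrite -memv0.
move/eqP: k0; rewrite dimv_eq0 => /eqP <-.
by rewrite memv_cap subvsP memv_ker lfunE /= -[f _]/(u _) in fy *; rewrite fy.
Qed.

(** * The three conclusions for a representation of an abstract Lie algebra *)

Section CayleyWeights.
Variables (K : numFieldType) (d : nat) (br : 'rV[K]_d -> 'rV[K]_d -> 'rV[K]_d).
Hypothesis L : ss_lie br.
Variable h : {vspace 'rV[K]_d}.
Hypothesis hC : cartan_subalgebra br h.
Variables (m : nat) (f : 'rV[K]_d -> 'M[K]_m).
Hypothesis f_lin : linear f.
Hypothesis f_br : forall x y, f (br x y) = f x *m f y - f y *m f x.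
Hypothesis f_irr : forall W : {vspace 'cV[K]_m},
  (forall x v, v \in W -> f x *m v \in W) -> W = 0%VS \/ W = fullv.
Variables (Pos : set (hdual h)) (om : hdual h).
Hypothesis Pos_positive : positive_system br Pos.
Hypothesis om_highest : highest_weight br f Pos om.
Hypothesis f_neq0 : ~ forall x, f x = 0.
Variable bs : seq (subvs_of h).
Hypothesis bs_span : span bs = fullv.
Hypothesis cayley : forall t : nat, exists N0 : nat, forall N : nat, (N0 <= N)%N ->
  cayley_normalizes f (N.+1%:R^-1 *: f (vsval (moment_point bs t))).
Local Notation Orb := (weyl_orbit br om).

Lemma cayley_weights :
  [/\ weights br f = Orb \/ weights br f = Orb `|` [set 0] /\ ~ Orb 0,
      forall l, weights br f l -> l = 0 \/ Orb l,
      (forall y : subvs_of h, f (vsval y) = 0 -> y = 0) ->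
        subgroup_rank (gen_subgroup Orb) (\dim h)
    & forall n, (\dim h <= n)%N -> exists omega : nat -> hdual h,
        [/\ omega 1%N = om, forall i, (2 <= i <= n)%N -> weight_lattice br (omega i)
          & Orb = [set l | exists2 i, (1 <= i <= n)%N & l = omega i \/ l = - omega i]]].
Proof.
have [P [Pu PD]] := joint_eigenbasis L hC.
have [v [v0 Hv _]] := om_highest.
have [n' [s [sb /choice [mu sw]]]] := weight_basis_exists L Pu PD f_lin f_br f_irr v0 Hv.
have opp := wt_opp_of_cayley sb sw bs_span cayley.
have pair := edge_pair_of_cayley L hC Pu PD f_lin f_br sb sw bs_span cayley.
have om_wt : is_weight f om by exists v.
have om0 : om != 0.
  apply/eqP => om0; apply: f_neq0; move: om_highest; rewrite om0.
  exact: (zero_highest_weight L hC Pu PD f_lin f_br f_irr sb sw Pos_positive).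
have lat (l : hdual h) : is_weight f l -> weight_lattice br l.
  exact: (weight_in_lattice L hC Pu PD f_lin f_br sb sw).
have wtE (l : hdual h) : weights br f l <-> is_weight f l.
  by split=> [[]|wl] //; split=> //; exact: lat.
have cases (l : hdual h) : is_weight f l -> l = 0 \/ Orb l.
  exact: (weights_orbit L hC Pu PD f_lin f_br f_irr sb sw pair om_wt om0).
have orb_wt (l : hdual h) : Orb l -> is_weight f l.
  exact: (orbit_wt L hC Pu PD f_lin f_br sb sw pair opp om_wt).
have orb_neq0 (l : hdual h) : Orb l -> l != 0.
  exact: (orbit_neq0 L hC Pu PD om0).
have orb_opp (l : hdual h) : Orb l -> Orb (- l).
  exact: (orbit_opp L hC Pu PD f_lin f_br f_irr sb sw pair opp om_wt om0).
have [r' [r1 r2 r3 r4]] := orbit_representatives L hC Pu PD f_lin f_br sb sw pair opp om_wt om0.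
have rsize := representatives_size L hC Pu PD f_lin f_br f_irr sb sw pair opp om_wt om0 r1 r3 r4.
split.
- have [w0|w0] := pselect (is_weight f (0 : hdual h)); [right|left].
    split; last by move=> /orb_neq0; rewrite eqxx.
    apply/seteqP; split=> l; first by move=> /wtE /cases [->|]; [right|left].
    by case=> [/orb_wt|->]; [move=> ?; exact/wtE|exact/wtE].
  apply/seteqP; split=> l; last by move=> /orb_wt ?; exact/wtE.
  by move=> /wtE wl; have [l0|//] := cases _ wl; case: w0; rewrite -l0.
- by move=> l /wtE; exact: cases.
- move=> inj.
  have rE := representatives_span L hC Pu PD f_lin f_br f_irr sb sw pair opp om_wt om0 r1 r2 r3 r4 inj.
  have fr := representatives_free L hC Pu PD f_lin f_br f_irr sb sw pair opp om_wt om0 r1 r3 r4.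
  pose t := in_tuple (om :: r'); rewrite -rE.
  apply: (@gen_subgroup_rank _ _ _ _ t fr) => [i|l Ol].
    by apply: r1; exact: mem_nth.
  have [lr|lr] := r2 _ Ol; [left|right].
    have ir : (index l (om :: r') < size (om :: r'))%N by rewrite index_mem.
    by exists (Ordinal ir); rewrite /= nth_index.
  have ir : (index (- l) (om :: r') < size (om :: r'))%N by rewrite index_mem.
  by exists (Ordinal ir); rewrite /= nth_index // opprK.
move=> n hn; pose omega i := nth om (om :: r') i.-1; exists omega.
have omr i : omega i \in om :: r'.
  rewrite /omega; case: (ltnP i.-1 (size (om :: r'))) => ir; first exact: mem_nth.
  by rewrite nth_default // mem_head.
split=> // [i _|]; first exact/lat/orb_wt/r1.
have orb_index l : l \in om :: r' -> exists2 i, (1 <= i <= n)%N & l = omega i.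
  move=> lr; exists (index l (om :: r')).+1; last by rewrite /omega nth_index.
  have ir : (index l (om :: r') < size (om :: r'))%N by rewrite index_mem.
  exact: leq_trans ir (leq_trans rsize hn).
apply/seteqP; split=> l /=.
  move=> /r2 [] /orb_index [i ni lE]; exists i => //; first by left.
  by right; rewrite -lE opprK.
by case=> i _ [->|->]; [|apply: orb_opp]; exact: r1.
Qed.

End CayleyWeights.

Theorem theorem5p6 (R : realType) (b : ground) (d : nat)
    (G : lieGroupType (gfield R b) d)
    (G_connected : connected [set: G])
    (c : chart (gfield R b) d G) (c_atlas : atlas c) (c_one : cdom c 1%g)
    (G_semisimple : semisimple (lie_bracket c))
    (h : {vspace 'rV[gfield R b]_d})
    (h_cartan : cartan_subalgebra (complexify_bracket (lie_bracket c))
                                  (complexify_sub h))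
    (g0 : {vspace 'rV[gfield R b]_d})
    (g0_zero_part : zero_part (lie_bracket c) h g0)
    (g0_eq_h : g0 = h)
    (P : set (hdual (complexify_sub h)))
    (P_positive : positive_system (complexify_bracket (lie_bracket c)) P)
    (m : nat) (rho : G -> 'M[R[i]]_m)
    (rho_rep : representation rho)
    (rho_irr : irreducible_rep rho)
    (omega1 : hdual (complexify_sub h))
    (omega1_highest : highest_weight (complexify_bracket (lie_bracket c))
                        (complexify_map (drho rho c)) P omega1)
    (n : nat) (dim_h : \dim h = n)
    (dim_drho_h : F_dim b [set drho rho c x | x in [set` h]] n)
    (rho_cayley : Cayley rho c) :
  let Wt := weights (complexify_bracket (lie_bracket c))
              (complexify_map (drho rho c)) in
  let Lambda := weight_lattice (complexify_bracket (lie_bracket c))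
                  (h := complexify_sub h) in
  let Orb := weyl_orbit (complexify_bracket (lie_bracket c)) omega1 in
  [/\ (Wt = Orb \/ (Wt = Orb `|` [set 0] /\ ~ Orb 0)) /\
      (forall lambda, Wt lambda -> lambda = 0 \/ Orb lambda),
      (* For a real group, injectivity of [drho] on the real space [h] does not
         imply injectivity on its complexification, and without the latter
         this clause fails: take SL_2(C) as a real group acting on C^2, where
         [n] is 2 and the rank of the orbit is 1. *)
      (b = RealField ->
         F_dim ComplexField
           [set complexify_map (drho rho c) x | x in [set` complexify_sub h]]
           n) ->
        subgroup_rank (gen_subgroup Orb) n
    & exists omega : nat -> hdual (complexify_sub h),
        [/\ omega 1%N = omega1,
            forall i, (2 <= i <= n)%N -> Lambda (omega i)
          & Orb = [set lambda | exists2 i, (1 <= i <= n)%N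
                     & lambda = omega i \/ lambda = - omega i]]].
Proof.
move=> Wt Lambda Orb.
have L := brC_ss_lie c_atlas c_one G_semisimple.
have flin := complexify_map_linear (drho rho c).
have fbr := f_bracket c_atlas c_one G_semisimple rho_rep.
have fsum := drho_sum (rep_Cdiff c_atlas c_one rho_rep).
have firr := f_irreducible G_connected c_atlas c_one rho_rep rho_irr.
have cay := cayley_normalizes_moment G_connected c_atlas c_one G_semisimple rho_rep rho_cayley h.
have dimH : (\dim (complexify_sub h) <= n)%N.
  by rewrite (leq_trans (dim_span _)) // size_map size_tuple dim_h.
(* If the differential were zero, the dimension of [drho h] would force [n = 0]; a zero Cartan
   subalgebra is its own centralizer, which makes the Lie algebra zero, against [0 < d]. *)
have f_neq0 : ~ forall x, complexify_map (drho rho c) x = 0.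
  move=> f0; have [d0 _] := G_semisimple.
  have n0 : n = 0%N.
    case: (n) dim_drho_h => // n' [e [e_free SE]].
    have eS i : [set drho rho c x | x in [set` h]] (e i).
      rewrite SE; exists (fun j => (j == i)%:R); rewrite (bigD1 i) //= eqxx rmorph_nat scale1r.
      by rewrite big1 ?addr0 // => j /negbTE ->; rewrite rmorph_nat scale0r.
    have e0 i : e i = 0.
      by have [x _ <-] := eS i; rewrite -(f_toC c_atlas c_one rho_rep) f0.
    have /e_free/(_ ord0)/eqP : \sum_(i < n'.+1) toC (1 : gfield R b) *: e i = 0.
      by rewrite big1 // => i _; rewrite e0 scaler0.
    by rewrite oner_eq0.
  have H0 : complexify_sub h = 0%VS.
    by apply/eqP; rewrite -dimv_eq0 -leqn0 (leq_trans dimH) // n0.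
  have xH (x : 'rV[R[i]]_d) : x \in complexify_sub h.
    apply: (cartan_self_centralizing L h_cartan) => y.
    have y0 : vsval y = 0 by apply/eqP; rewrite -memv0 -H0 subvsP.
    by rewrite y0; exact: br0l.
  have := xH (delta_mx 0 (Ordinal d0)); rewrite H0 memv0 => /eqP /rowP /(_ (Ordinal d0)) /eqP.
  by rewrite !mxE !eqxx oner_eq0.
have [a1 a2 rk om] := cayley_weights L h_cartan flin fbr firr P_positive omega1_highest f_neq0
  (real_basis_span h) cay.
split=> [|H|]; [by [] | | exact: om].
have [<- inj] := F_dim_injective flin (F_dim_complexify fsum dim_drho_h H) dimH.
exact: rk.
Qed.
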